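(* (1) Let $n\ge4$ and $2\le q<n-1$. The assertion ''if $\mu\in L^q(\Omega)$ and $u$ is the Dirichlet minimizer of $\mathcal E_\mu(\cdot;\Omega)$, then $\dim_{\mathcal H}\mathcal K_u\le n-q$'' is false. Specifically, there exist a bounded domain $\Omega\subset\mathbb R^n$, an admissible boundary datum $u_0$, and a charge $\mu\in L(n-1,\infty)(\Omega)$ with compact support in $\Omega$ (so that $\mu\in L^q(\Omega)$), such that the Dirichlet minimizer $u$ satisfies $|\mathcal K_u|>0$ (Lebesgue measure). (2) For every $n\ge3$, the assertion ''$\mathcal H^{n-1}(\mathcal K_u)=0$ for every Dirichlet minimizer $u$'' is false, even for absolutely continuous data $\mu$: there exist a bounded domain $\Omega\subset\mathbb R^n$, an admissible boundary datum $u_0$ and a charge $\mu\in L^1(\Omega)$ such that the Dirichlet minimizer $u$ satisfies $\mathcal H^{n-1}(\mathcal K_u)>0$.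
   Context: Dirichlet setting. Let $\Omega\subset\mathbb R^n$ be a bounded domain and $\mu\in L^1(\Omega)$. For a weakly spacelike $u$ on $\Omega$ ($u\in W^{1,\infty}_{\mathrm{loc}}(\Omega)$, Lipschitz representative, $|Du|\le1$ a.e.), ''$u=u_0$ on $\partial\Omega$'' means that for every $x_0\in\partial\Omega$ and every open straight segment $\ell\subset\Omega$ with endpoint $x_0$, $\lim_{x\to x_0,\,x\in\ell}u(x)=u_0(x_0)$. The boundary datum $u_0\in C^0(\partial\Omega)$ is admissible if $|u_0(x)-u_0(y)|<|x-y|$ whenever $x\ne y$ in $\partial\Omega$ and $\overline{xy}\subset\overline\Omega$, and $u_0$ has an extension $\tilde u_0\in W^{1,\infty}(\Omega)$ with $\|D\tilde u_0\|_{L^\infty}\le1$ and $\tilde u_0=u_0$ on $\partial\Omega$, in the sense that $\lim_{x\to x_0,\,x\in\ell}\tilde u_0(x)=u_0(x_0)$ for every $x_0\in\partial\Omega$ and every open straight segment $\ell\subset\Omega$ with endpoint $x_0$. The Dirichlet minimizer is the unique minimizer of $\mathcal E_\mu(w;\Omega)=\int_\Omega\bigl(1-\sqrt{1-|Dw|^2}\bigr)dx-\int_\Omega\mu w\,dx$ among $w\in W^{1,\infty}(\Omega)$ with $\|Dw\|_{L^\infty}\le1$ and $w=u_0$ on $\partial\Omega$. $\mathcal S_u:=\bigcup\{\overline{xy}\subset\Omega: x\ne y,\ |u(x)-u(y)|=|x-y|\}$ and $\mathcal K_u:=\overline{\mathcal S_u}\cap\Omega$. $L(n-1,\infty)(\Omega)$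 is the weak Lebesgue (Marcinkiewicz) space: $\sup_{\lambda>0}\lambda^{n-1}|\{x\in\Omega:|\mu(x)|>\lambda\}|<\infty$. $\mathcal H^{s}$ and $\dim_{\mathcal H}$ are Hausdorff measure and dimension. *)

(* Defs.v *)
(* R^n is represented by 'rV[R]_n, for an arbitrary R : realType. *)
From HB Require Import structures.
From mathcomp Require Import all_boot all_order all_algebra.
From mathcomp Require Import all_classical all_reals all_analysis.

Set Implicit Arguments.
Unset Strict Implicit.
Unset Printing Implicit Defensive.

Import Order.TTheory GRing.Theory Num.Theory.
Import numFieldNormedType.Exports.

Local Open Scope classical_set_scope.
Local Open Scope ring_scope.

(* The sigma-algebra on R^n is generated by the coordinate maps, i.e. it is the
   product (equivalently, the Borel) sigma-algebra. *)
Section rV_measurable.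
Context {R : realType} (n : nat).

Let coords : 'I_n -> 'rV[R]_n -> measurableTypeR R := fun i x => x ord0 i.

Let rV_set0 : g_sigma_preimage coords set0.
Proof. exact: sigma_algebra0. Qed.

Let rV_setC A : g_sigma_preimage coords A -> g_sigma_preimage coords (~` A).
Proof. exact: sigma_algebraC. Qed.

Let rV_bigcup (F : (set 'rV[R]_n)^nat) :
  (forall i, g_sigma_preimage coords (F i)) ->
  g_sigma_preimage coords (\bigcup_i (F i)).
Proof. exact: sigma_algebra_bigcup. Qed.

HB.instance Definition _ := @isMeasurable.Build default_measure_display
  'rV[R]_n (g_sigma_preimage coords) rV_set0 rV_setC rV_bigcup.

Lemma measurable_rV_coord (i : 'I_n) :
  measurable_fun [set: 'rV[R]_n]
    (fun x : 'rV[R]_n => x ord0 i : measurableTypeR R).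
Proof.
move=> _ Y mY; rewrite setTI; apply: sub_sigma_algebra => /=.
rewrite -bigcup_seq/=; exists i => /=; first by rewrite mem_index_enum.
by exists Y => //; rewrite setTI.
Qed.

Lemma measurable_fun_rV d (T : measurableType d) (f : T -> 'rV[R]_n) :
  (forall i, measurable_fun [set: T] (fun t => f t ord0 i : measurableTypeR R)) ->
  measurable_fun [set: T] f.
Proof.
move=> mf _ Y mY; rewrite setTI.
suff: measurable `<=` [set A | measurable (f @^-1` A)] by apply.
apply: smallest_sub => /=.
  split => /=.
  - by rewrite preimage_set0.
  - by move=> A mA; rewrite setTD preimage_setC; exact: measurableC.
  - by move=> F mF; rewrite preimage_bigcup; exact: bigcup_measurable.
rewrite -bigcup_seq => A [i _] /= [B mB <-].
by rewrite setTI; have := mf i measurableT B mB; rewrite setTI.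
Qed.

End rV_measurable.

(* Lebesgue measure on R^n: the n-fold product of the library's Lebesgue
   measure on R, transported along (x, y) |-> (x, y_1, .., y_n). *)
Section rV_lebesgue.
Context {R : realType}.

Definition consrV n (p : measurableTypeR R * 'rV[R]_n) : 'rV[R]_n.+1 :=
  \row_(i < n.+1) oapp (fun j => p.2 ord0 j) p.1 (unlift ord0 i).

Lemma measurable_consrV n : measurable_fun setT (@consrV n).
Proof.
apply: measurable_fun_rV => i; rewrite /consrV.
case: (unliftP ord0 i) => [j ->|->].
- under eq_fun do rewrite mxE liftK /=.
  exact: (measurableT_comp (measurable_rV_coord j) measurable_snd).
- under eq_fun do rewrite mxE unlift_none /=.
  exact: measurable_fst.
Qed.

Let headrV n (x : 'rV[R]_n.+1) : measurableTypeR R * 'rV[R]_n :=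
  (x ord0 ord0, \row_j x ord0 (lift ord0 j)).

Let headrVK n : cancel (@headrV n) (@consrV n).
Proof.
move=> x; apply/rowP => i; rewrite /consrV mxE /headrV.
by case: (unliftP ord0 i) => [j ->|->] /=; rewrite ?mxE.
Qed.

Let consrVK n : cancel (@consrV n) (@headrV n).
Proof.
case=> a y; rewrite /headrV /consrV mxE unlift_none /=; congr pair.
by apply/rowP => j; rewrite !mxE liftK.
Qed.

Let measurable_headrV n : measurable_fun setT (@headrV n).
Proof.
apply/measurable_fun_pairP; split.
  exact: (measurable_rV_coord ord0).
apply: measurable_fun_rV => i; rewrite /comp/=.
under eq_fun do rewrite mxE.
exact: (measurable_rV_coord (lift ord0 i)).
Qed.

Section step.
Context (n : nat) (m : {sigma_finite_measure set 'rV[R]_n -> \bar R}).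

Definition lebesgue_step : set 'rV[R]_n.+1 -> \bar R :=
  pushforward (@lebesgue_measure R \x m)%E (@consrV n).

Let step0 : lebesgue_step set0 = 0%E.
Proof. by rewrite /lebesgue_step /pushforward preimage_set0 measure0. Qed.

Let step_ge0 A : (0 <= lebesgue_step A)%E.
Proof. by rewrite /lebesgue_step /pushforward measure_ge0. Qed.

Let step_additive : semi_sigma_additive lebesgue_step.
Proof.
move=> F mF tF mUF; rewrite /lebesgue_step /pushforward preimage_bigcup.
apply: measure_semi_sigma_additive.
- by move=> k; rewrite -[X in measurable X]setTI; exact: measurable_consrV.
- apply/trivIsetP => /= i j _ _ ij; rewrite -preimage_setI.
  by move/trivIsetP : tF => /(_ _ _ _ _ ij) ->//; rewrite preimage_set0.
- rewrite -preimage_bigcup -[X in measurable X]setTI.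
  exact: measurable_consrV.
Qed.

HB.instance Definition _ := isMeasure.Build _ _ _ lebesgue_step
  step0 step_ge0 step_additive.

Let step_sigma_finite : sigma_finite setT lebesgue_step.
Proof.
have /sigma_finiteP[F [TF ndF Foo]] := sigma_finiteT (@lebesgue_measure R).
have /sigma_finiteP[G [TG ndG Goo]] := sigma_finiteT m.
exists (fun k => @headrV n @^-1` (F k `*` G k)).
  rewrite -preimage_bigcup (_ : \bigcup_k _ = setT) ?preimage_setT//.
  apply/seteqP; split=> // -[x y] _.
  have [j _ Fjx] : (\bigcup_k F k) x by rewrite -TF.
  have [k _ Gky] : (\bigcup_k G k) y by rewrite -TG.
  exists (maxn j k) => //; split.
  - by move: x Fjx; exact/subsetPset/ndF/leq_maxl.
  - by move: y Gky; exact/subsetPset/ndG/leq_maxr.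
move=> k; have [mF Flty] := Foo k; have [mG Glty] := Goo k; split.
  rewrite -[X in measurable X]setTI; apply: measurable_headrV => //.
  exact: measurableX.
rewrite /lebesgue_step /pushforward -comp_preimage.
rewrite (_ : _ \o _ = id); last by apply/funext => x /=; rewrite consrVK.
by rewrite preimage_id product_measure1E// lte_mul_pinfty// ge0_fin_numE.
Qed.

HB.instance Definition _ :=
  Measure_isSigmaFinite.Build _ _ _ lebesgue_step step_sigma_finite.

End step.

Fixpoint lebesgue_rV (n : nat) : {sigma_finite_measure set 'rV[R]_n -> \bar R} :=
  if n is k.+1 then lebesgue_step (lebesgue_rV k) else \d_(0 : 'rV[R]_0).

(* lebesgue_rV n is the Lebesgue measure: it has the right value on products. *)
Lemma lebesgue_rV_prod n (A : 'I_n -> set (measurableTypeR R)) :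
  (forall i, measurable (A i)) ->
  lebesgue_rV n [set x | forall i, A i (x ord0 i)] =
  (\prod_(i < n) lebesgue_measure (A i))%E.
Proof.
have measurable_box k (B : 'I_k -> set (measurableTypeR R)) :
    (forall i, measurable (B i)) ->
    measurable [set x : 'rV[R]_k | forall i, B i (x ord0 i)].
  move=> mB; rewrite (_ : [set _ | _] =
      \bigcap_(i in [set: 'I_k]) ((fun x : 'rV[R]_k => x ord0 i) @^-1` B i)).
    apply: fin_bigcap_measurable; first exact: finite_finset.
    move=> i _; rewrite -[X in measurable X]setTI.
    by apply: (measurable_rV_coord i) => //; exact: mB.
  by apply/seteqP; split=> x /= h i; [move=> _; exact: h|exact: (h i)].
elim: n A => [|n IHn] A mA.
  by rewrite big_ord0 /= diracE mem_set// => -[].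
rewrite big_ord_recl -IHn; last by move=> i; exact: mA.
rewrite /= /lebesgue_step /pushforward.
rewrite -product_measure1E//; last first.
  exact: (measurable_box n (fun j => A (lift ord0 j)) (fun j => mA _)).
congr ((_ \x _)%E _); apply/seteqP; split=> -[a y] /=.
  move=> h; split=> [|j].
    by have := h ord0; rewrite /consrV mxE unlift_none.
  by have := h (lift ord0 j); rewrite /consrV mxE liftK.
move=> [h0 h] i; rewrite /consrV mxE.
by case: (unliftP ord0 i) => [j ->|->] /=.
Qed.

End rV_lebesgue.

Section euclidean.
Context {R : realType} {n : nat}.
Implicit Types (x y : 'rV[R]_n) (A : set 'rV[R]_n).

(* The library norm on 'rV[R]_n is the sup norm; it is only used for the
   (norm-independent) topology, boundedness and local Lipschitz continuity. *)
Definition enorm x : R := Num.sqrt (\sum_i x ord0 i ^+ 2).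

Definition closed_segment x y := [set x + t *: (y - x) | t in `[0, 1]].
Definition open_segment x y := [set x + t *: (y - x) | t in `]0, 1[].

Definition boundary A := closure A `\` interior A.

Definition bounded_domain A :=
  [/\ A !=set0, open A, connected A & bounded_set A].

End euclidean.

Section hausdorff.
Context {R : realType} {n : nat}.
Implicit Types (s d : R) (A U : set 'rV[R]_n).
Local Open Scope ereal_scope.

Definition ediam A : \bar R :=
  ereal_sup [set (enorm (xy.1 - xy.2))%:E | xy in A `*` A].

(* diam(U)^s, with the usual conventions for s = 0: the empty set contributes
   0 and a nonempty set contributes 1. *)
Definition diam_pow s U : \bar R :=
  if `[< U = set0 >] then 0 else ediam U `^ s.

Definition hausdorff_premeasure d s A : \bar R :=
  ereal_inf [set \sum_(k <oo) diam_pow s (U k) | U in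
    [set U : (set 'rV[R]_n)^nat |
      A `<=` \bigcup_k U k /\ forall k, ediam (U k) <= d%:E]].

(* Without the normalizing constant (volume of the unit s-ball over 2^s), which
   affects neither positivity nor vanishing. *)
Definition hausdorff_measure s A : \bar R :=
  ereal_sup [set hausdorff_premeasure d s A | d in [set d | (0 < d)%R]].

Definition hausdorff_dim A : \bar R :=
  ereal_inf [set s%:E | s in [set s | (0 <= s)%R /\ hausdorff_measure s A = 0]].

End hausdorff.

Section function_spaces.
Context {R : realType} {n : nat}.
Local Notation leb := (@lebesgue_rV R n).
Implicit Types (Omega : set 'rV[R]_n) (f u w phi mu : 'rV[R]_n -> R)
  (g : 'rV[R]_n -> 'rV[R]_n).

(* Functions on Omega are total functions whose values off Omega are ignored. *)
Definition in_Lp Omega (p : \bar R) f :=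
  measurable_fun Omega f /\ finite_norm leb p (f \_ Omega).

Definition in_weak_Lp Omega (p : R) f :=
  measurable_fun Omega f /\
  (ereal_sup [set (lam `^ p)%:E *
                  leb (Omega `&` [set x | lam < `|f x|]%R)
             | lam in [set lam : R | (0 < lam)%R]] < +oo)%E.

Definition compactly_supported_in Omega f :=
  exists K, [/\ compact K, K `<=` Omega &
    {ae leb, forall x, Omega x -> ~ K x -> f x = 0}].

Definition basis_vec (i : 'I_n) : 'rV[R]_n := delta_mx ord0 i.

Definition partial (i : 'I_n) f : 'rV[R]_n -> R := 'D_(basis_vec i) f.

Definition smooth f := forall s : seq 'I_n,
  continuous (foldr partial f s) /\
  forall i x, derivable (foldr partial f s) x (basis_vec i).

Definition test_function Omega phi :=
  [/\ smooth phi, compact (closure [set x | phi x != 0]) &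
      closure [set x | phi x != 0] `<=` Omega].

Definition is_weak_gradient Omega u g := forall (i : 'I_n) phi,
  test_function Omega phi ->
  \int[leb]_(x in Omega) (u x * partial i phi x) =
  - \int[leb]_(x in Omega) (g x ord0 i * phi x).

Definition Linfty_weak_gradient Omega u g :=
  (forall i, in_Lp Omega +oo%E (fun x => g x ord0 i)) /\
  is_weak_gradient Omega u g.

Definition W1infty Omega u :=
  in_Lp Omega +oo%E u /\ exists g, Linfty_weak_gradient Omega u g.

(* Du, a choice of representative (unique almost everywhere) of the weak
   gradient; meaningful when u is in W1infty Omega. *)
Definition weak_gradient Omega u : 'rV[R]_n -> 'rV[R]_n :=
  xget (fun=> 0) [set g | Linfty_weak_gradient Omega u g].

Definition locally_lipschitz Omega u := forall x, Omega x ->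
  exists2 V, nbhs x V & [lipschitz u y | y in V].

Definition equal_on_boundary Omega u u0 := forall x0 y,
  boundary Omega x0 -> open_segment x0 y `<=` Omega ->
  u @ within (open_segment x0 y) (nbhs x0) --> u0 x0.

(* The class over which the energy is minimized; u is required to be the
   Lipschitz representative, so that pointwise values make sense. *)
Definition competitor Omega u0 w :=
  [/\ W1infty Omega w, locally_lipschitz Omega w,
      ('N[leb]_+oo[EFin \o ((enorm \o weak_gradient Omega w) \_ Omega)] <= 1)%E
    & equal_on_boundary Omega w u0].

Definition admissible Omega u0 :=
  [/\ {within boundary Omega, continuous u0},
      forall x y, boundary Omega x -> boundary Omega y -> x != y ->
        closed_segment x y `<=` closure Omega ->
        `|u0 x - u0 y| < enorm (x - y)
    & exists w, competitor Omega u0 w].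

Definition energy Omega mu w : R :=
  \int[leb]_(x in Omega) (1 - Num.sqrt (1 - enorm (weak_gradient Omega w x) ^+ 2))
  - \int[leb]_(x in Omega) (mu x * w x).

Definition is_minimizer Omega u0 mu u :=
  competitor Omega u0 u /\
  forall w, competitor Omega u0 w -> energy Omega mu u <= energy Omega mu w.

Definition dirichlet_minimizer Omega u0 mu u :=
  is_minimizer Omega u0 mu u /\
  forall v, is_minimizer Omega u0 mu v -> {in Omega, v =1 u}.

Definition dirichlet_data Omega u0 mu :=
  [/\ bounded_domain Omega, admissible Omega u0 & in_Lp Omega 1%E mu].

Definition light_segments Omega u : set 'rV[R]_n :=
  \bigcup_(xy in [set xy : 'rV[R]_n * 'rV[R]_n |
      [/\ xy.1 != xy.2, closed_segment xy.1 xy.2 `<=` Omega &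
          `|u xy.1 - u xy.2| = enorm (xy.1 - xy.2)]])
    closed_segment xy.1 xy.2.

Definition light_set Omega u : set 'rV[R]_n :=
  closure (light_segments Omega u) `&` Omega.

End function_spaces.

(* Main.v *)
Require Import Defs.
From HB Require Import structures.
From mathcomp Require Import all_boot all_order all_algebra.
From mathcomp Require Import all_classical all_reals all_analysis.
From mathcomp Require Import measurable_realfun ess_sup_inf ring lra.

Set Implicit Arguments.
Unset Strict Implicit.
Unset Printing Implicit Defensive.

Import Order.TTheory GRing.Theory Num.Theory.
Import numFieldNormedType.Exports.
Local Open Scope classical_set_scope.
Local Open Scope ring_scope.

(** One example serves both parts: a minimizer whose set of light points has
    positive volume, hence Hausdorff dimension equal to the dimension of the space
    and positive Hausdorff measure in every smaller dimension (hausdorff_null).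

    The building block is a function with a single light segment. In dimension
    n + 1, with n at least 2, let a and b be the distances to the poles -e_0 and
    e_0, and put sig = (a + b) / 2 and tau = (a - b) / 2. The function
    U = tau * cutoff (sig), where the cutoff is 1 for sig <= 2 and has small
    slope, is compactly supported. It has slope one along the segment between the
    poles, where sig = 1, and |DU| < 1 elsewhere, in the quantitative form
    gap_ge. Hence V = DU / sqrt (1 - |DU|^2) is smooth off the segment, and so is
    the charge M = - div V. Both are of order 1 / r, with r the distance to the
    axis of the poles (mV_bound, mM_bound), so they belong to weak L^n. The
    segment itself carries no charge: close to it V is parallel to D tau, and the
    confocal ellipsoids on which sig is constant are orthogonal to the level sets
    of tau, so that multiplying V by a function of sig which cuts the segment off
    does not create any further divergence (div_mPhi).

    Such a field V is a calibration. Its divergence is - M in the sense of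
    duality with all competitors, V is the gradient of the integrand
    1 - sqrt (1 - |p|^2) at p = DU, and this integrand is uniformly convex. So U
    minimizes the energy, and a competitor of the same energy has the same
    gradient (calibrated_energy). A function with vanishing gradient is constant
    along lines, and competitors agree where a line meets the boundary
    (equal_weak_gradients_eq); this gives uniqueness.

    All of this is invariant under U(x) |-> r U((x - c) / r), which keeps slopes
    and multiplies the charge by 1 / r. One copy of U is placed in each of a
    sequence of disjoint cubes whose half-sides are bounded by a geometric
    sequence (cube_packing). Every cube is centred at a point of the unit cube that the
    earlier cubes leave uncovered; the centres accumulate at all points that are
    never covered, and these have positive volume because the cubes are small.
    Each centre is the midpoint of a light segment, so the closure of the set of
    centres consists of light points. The total charge is still in weak L^n: the
    set where it exceeds lambda in absolute value is covered by tubes of radius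
    C / lambda whose lengths are summable (tubes_weak_Lp). As weak L^n is
    contained in L^q for q < n on sets of finite volume (weak_Lp_Lq), the charge
    has all the integrability that is claimed. *)

(** * Topology and measurability in spaces of row vectors *)

Section rV_topology.
Context {R : realType} {n : nat}.
Implicit Types (x y : 'rV[R]_n) (A D : set 'rV[R]_n).

Lemma rV_norm_le x e : 0 <= e ->
  (`|x| <= e) <-> (forall i, `|x ord0 i| <= e).
Proof.
move=> e0; rewrite (_ : `|x| = mx_norm x)// mx_normrE; split.
  move=> xe i; apply: le_trans xe.
  by apply/bigmax_geP; right => /=; exists (ord0, i).
by move=> xe; apply/bigmax_leP; split => //= -[j i] _ /=; rewrite (ord1 j).
Qed.

Lemma rV_norm_lt x e : 0 < e ->
  (`|x| < e) <-> (forall i, `|x ord0 i| < e).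
Proof.
move=> e0; rewrite (_ : `|x| = mx_norm x)// mx_normrE; split.
  move=> xe i; apply: le_lt_trans xe.
  by apply/bigmax_geP; right => /=; exists (ord0, i).
by move=> xe; apply/bigmax_ltP; split => //= -[j i] _ /=; rewrite (ord1 j).
Qed.

Lemma rV_coord_le x i : `|x ord0 i| <= `|x|.
Proof. by move: i; apply/rV_norm_le. Qed.

Lemma measurable_box (B : 'I_n -> set R) :
  (forall i, measurable (B i)) ->
  measurable [set x : 'rV[R]_n | forall i, B i (x ord0 i)].
Proof.
move=> mB; rewrite (_ : [set _ | _] =
    \bigcap_(i in [set: 'I_n]) ((fun x : 'rV[R]_n => x ord0 i) @^-1` B i)).
  apply: fin_bigcap_measurable; first exact: finite_finset.
  move=> i _; rewrite -[X in measurable X]setTI.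
  by apply: (measurable_rV_coord i) => //; exact: mB.
by apply/seteqP; split=> x /= h i; [move=> _; exact: h|exact: (h i)].
Qed.

Definition cube (c : 'rV[R]_n) (r : R) : set 'rV[R]_n :=
  [set x | forall i, `|x ord0 i - c ord0 i| <= r].

Lemma cubeE c r : cube c r = [set x | forall i, `[c ord0 i - r, c ord0 i + r]%classic (x ord0 i)].
Proof.
apply/seteqP; split => x /= h i; have := h i; rewrite /= in_itv/= ler_norml;
lra.
Qed.

Lemma measurable_cube c r : measurable (cube c r).
Proof.
rewrite cubeE.
apply: (@measurable_box (fun i => `[c ord0 i - r, c ord0 i + r]%classic)) => i.
exact: measurable_itv.
Qed.

(** Rational boxes form a countable base, so the product sigma-algebra
    contains every open set. *)
Lemma open_measurable_rV A : open A -> measurable A.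
Proof.
move=> oA.
pose F (qk : 'rV[rat]_n * nat) : set 'rV[R]_n :=
  if `[< cube (map_mx ratr qk.1) (qk.2.+1%:R^-1) `<=` A >]
  then cube (map_mx ratr qk.1) (qk.2.+1%:R^-1) else set0.
have -> : A = \bigcup_qk F qk.
  apply/seteqP; split => [x Ax|x [qk _]]; last first.
    by rewrite /F; case: ifPn => // /asboolP; apply.
  have /nbhs_ballP[e /= e0 xA] : nbhs x A by rewrite nbhsE/=; exists A.
  rewrite mx_norm_ball in xA.
  have [k ke] : exists k : nat, k.+1%:R^-1 < e / 2.
    have [k] := @ltr_add_invr R 0 (e / 2) ltac:(by rewrite divr_gt0).
    by rewrite add0r; exists k.
  have k0 : 0 < k.+1%:R^-1 :> R by rewrite invr_gt0.
  have [q xq] : {q : 'rV[rat]_n & forall i, `|x ord0 i - ratr (q ord0 i)| <= k.+1%:R^-1}.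
    have h i : {q : rat | `|x ord0 i - ratr q| <= k.+1%:R^-1}.
      apply: cid.
      have xk : x ord0 i - k.+1%:R^-1 < x ord0 i by rewrite ltrBlDr ltrDl.
      have [q] := rat_in_itvoo xk.
      rewrite in_itv/= => /andP[q1 q2]; exists q.
      by move: (k.+1%:R^-1) q1 q2 k0 => z q1 q2 k0; rewrite ler_norml; lra.
    exists (\row_i sval (h i)) => i; rewrite mxE; exact: (svalP (h i)).
  exists (q, k) => //; rewrite /F /=; case: ifPn => [_|/asboolP h].
    by move=> i; rewrite mxE.
  exfalso; apply: h => y yq; apply: xA => /=; apply/rV_norm_lt => // i.
  rewrite !mxE; have := xq i; have := yq i; rewrite mxE.
  move: (k.+1%:R^-1) ke => d ke; rewrite !ler_norml ltr_norml; lra.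
apply: countable_bigcupT_measurable => // qk; rewrite /F; case: ifPn => // _.
exact: measurable_cube.
Qed.

Lemma closed_measurable_rV A : closed A -> measurable A.
Proof.
by move=> cA; rewrite -(setCK A); apply: measurableC; apply: open_measurable_rV; exact: closed_openC.
Qed.

Lemma continuous_open_measurable_rV D (f : 'rV[R]_n -> R) : open D ->
  (forall x, D x -> {for x, continuous f}) -> measurable_fun D f.
Proof.
move=> oD cf; apply: (measurability _ (measurable_realfun.RGenOpens.measurableE R)) => _ [_ [a [b ->]] <-].
have -> : D `&` f @^-1` `]a, b[ = interior (D `&` f @^-1` `]a, b[).
  apply/seteqP; split; last exact: interior_subset.
  move=> x [Dx fx]; rewrite /interior/=; apply: filterI.
    by rewrite nbhsE/=; exists D.
  apply: (cf x Dx); apply: open_nbhs_nbhs; split => //.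
by apply: open_measurable_rV; exact: open_interior.
Qed.

Lemma continuous_measurable_rV (f : 'rV[R]_n -> R) :
  continuous f -> measurable_fun [set: 'rV[R]_n] f.
Proof.
move=> cf; apply: continuous_open_measurable_rV; first exact: openT.
by move=> x _; exact: cf.
Qed.

Lemma lebesgue_cube c r : 0 <= r ->
  lebesgue_rV n (cube c r) = ((2 * r) ^+ n)%:E.
Proof.
move=> r0; rewrite cubeE (@lebesgue_rV_prod _ _ (fun i => `[c ord0 i - r, c ord0 i + r]%classic)); last by move=> i; exact: measurable_itv.
rewrite (eq_bigr (fun=> (2 * r)%:E)); last first.
  move=> i _; rewrite lebesgue_measure_itv/= lte_fin -EFinD.
  case: ifPn => [_|]; first by congr EFin; ring.
  rewrite -leNgt => h; congr EFin; lra.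
by rewrite prodEFin big_const_ord iter_mulr_1.
Qed.

End rV_topology.

(** * Integrals of partial derivatives *)

Section bounded_support.
Context d (T : measurableType d) (R : realType) (mu : {measure set T -> \bar R}).

Lemma bounded_support_integrable (f : T -> R) A M : measurable A ->
  (mu A < +oo)%E -> measurable_fun [set: T] f -> (forall x, `|f x| <= M) ->
  (forall x, ~ A x -> f x = 0) -> mu.-integrable [set: T] (EFin \o f).
Proof.
move=> mA muA mf fM f0.
have -> : EFin \o f = (EFin \o f) \_ A.
  apply/funext => x; rewrite patchE; case: ifPn => // /negP xA /=.
  by rewrite f0// => Ax; apply: xA; rewrite inE.
apply/(integrable_mkcond _ mA).
apply: measurable_bounded_integrable => //; first exact: measurable_funTS.
exists M; split; first exact: num_real.
by move=> x Mx y _ /=; apply: (le_trans (fM _)); exact: ltW.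
Qed.

End bounded_support.

Section fubini_rV.
Context {R : realType} (n : nat).
Notation leb := (@lebesgue_rV R).

(** Boundedness and bounded support make both iterated integrals available, so
    that the coordinate 0 can be integrated first or last. *)
Lemma Rintegral_rVS (f : 'rV[R]_n.+1 -> R) r M : 0 <= r ->
  measurable_fun [set: 'rV[R]_n.+1] f -> (forall x, `|f x| <= M) ->
  (forall x, ~ cube 0 r x -> f x = 0) ->
  \int[leb n.+1]_x f x =
    fine (\int[@lebesgue_measure R]_t \int[leb n]_y (f (consrV (t, y)))%:E)%E /\
  \int[leb n.+1]_x f x =
    fine (\int[leb n]_y \int[@lebesgue_measure R]_t (f (consrV (t, y)))%:E)%E.
Proof.
move=> r0 mf fM f0.
have mfc : measurable_fun [set: (measurableTypeR R * 'rV[R]_n)%type]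
    (fun p => f (consrV p)).
  exact: (measurableT_comp mf (@measurable_consrV R n)).
have intc : (@lebesgue_measure R \x leb n)%E.-integrable
    [set: (measurableTypeR R * 'rV[R]_n)%type] (EFin \o (fun p => f (consrV p))).
  apply: (@bounded_support_integrable _ _ _ _ _ (@consrV R n @^-1` cube 0 r) M) => //.
  - rewrite -[X in measurable X]setTI.
    by apply: measurable_consrV => //; exact: measurable_cube.
  - have := lebesgue_cube (0 : 'rV[R]_n.+1) r0.
    by rewrite /= /lebesgue_step /pushforward => ->; rewrite ltry.
  - by move=> p ?; exact: f0.
have E : (\int[leb n.+1]_x (f x)%:E)%E =
    (\int[(@lebesgue_measure R \x leb n)%E]_p (f (consrV p))%:E)%E.
  rewrite /= -[RHS](@integral_pushforward _ _ _ _ _ _ (@measurable_consrV R n)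
    (@lebesgue_measure R \x leb n)%E setT (EFin \o f))//.
  exact/measurable_EFinP.
rewrite /Rintegral E; split; congr fine.
  by rewrite -(integral12_prod_meas1 intc).
by rewrite -(integral21_prod_meas1 intc).
Qed.

End fubini_rV.

Section directional.
Context {R : realType}.

(** A directional derivative only sees the restriction of the function to a line,
    so it may be computed in any parametrization of that line. *)
Lemma derive_along (V W : normedModType R) (f : V -> R) (g : W -> R) a v b w :
  (forall h : R, f (h *: v + a) = g (h *: w + b)) ->
  derive f a v = derive g b w /\ (derivable f a v <-> derivable g b w).
Proof.
move=> fg; rewrite /derive /derivable.
have -> : (fun h : R => h^-1 *: ((f \o shift a) (h *: v) - f a)) =
          (fun h : R => h^-1 *: ((g \o shift b) (h *: w) - g b)).
  apply/funext => h /=; rewrite fg; congr (_ *: (_ - _)).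
  by have := fg 0; rewrite !scale0r !add0r.
by [].
Qed.

End directional.

Section integral_partial.
Context {R : realType}.
Notation leb := (@lebesgue_rV R).

Lemma partial_near n (f g : 'rV[R]_n -> R) x i :
  (\forall y \near x, f y = g y) ->
  partial i f x = partial i g x /\
  (derivable f x (basis_vec i) <-> derivable g x (basis_vec i)).
Proof.
move=> fg; split; first exact: near_eq_derive.
by split; apply: near_eq_derivable => //; apply: filterS fg => y ->.
Qed.

Lemma compact_continuous_bounded (V : normedModType R) (K : set V) (g : V -> R) :
  compact K -> {within K, continuous g} ->
  exists2 M, 0 <= M & forall x, K x -> `|g x| <= M.
Proof.
move=> cK cg; have := compact_bounded (continuous_compact cg cK).
move=> [M [_ hM]]; exists (`|M| + 1) => // x Kx.
by apply: (hM (`|M| + 1)); [rewrite ltr_pwDr// ler_norm|exists x].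
Qed.

Lemma closed_cube n (c : 'rV[R]_n) r : closed (cube c r).
Proof.
rewrite (_ : cube c r = \bigcap_(i in [set: 'I_n])
    (fun x : 'rV[R]_n => x ord0 i) @^-1` [set t | `|t - c ord0 i| <= r]).
  apply: closed_bigI => i _; apply: preimage_closed.
    by move=> x _; exact: coord_continuous.
  rewrite (_ : [set t | _] = `[c ord0 i - r, c ord0 i + r]%classic).
    exact: interval_closed.
  by apply/seteqP; split => t; rewrite /= in_itv/= ler_norml; lra.
by apply/seteqP; split => x /= h i; [move=> _; exact: h|exact: (h i)].
Qed.

Lemma compact_cube n (c : 'rV[R]_n) r : compact (cube c r).
Proof.
apply: bounded_closed_compact; last exact: closed_cube.
exists (`|c| + `|r|); split; first exact: num_real.
move=> M cM x xc; apply: le_trans (ltW cM).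
apply/rV_norm_le => [|i]; first by rewrite addr_ge0.
rewrite -(subrK (c ord0 i) (x ord0 i)) (le_trans (ler_normD _ _))// addrC lerD//.
  exact: rV_coord_le.
exact: le_trans (xc i) (ler_norm _).
Qed.

Lemma continuous_supp_bounded n (g : 'rV[R]_n -> R) r : continuous g ->
  (forall x, ~ cube 0 r x -> g x = 0) -> exists2 M, 0 <= M & forall x, `|g x| <= M.
Proof.
move=> cg g0.
have [M M0 gM] : exists2 M, 0 <= M & forall x, cube 0 r x -> `|g x| <= M.
  apply: compact_continuous_bounded; first exact: compact_cube.
  exact: continuous_subspaceT.
exists M => // x; have [xr|xr] := pselect (cube 0 r x); first exact: gM.
by rewrite g0// normr0.
Qed.

Lemma partial_supp n (f : 'rV[R]_n -> R) i r :
  (forall x, ~ cube 0 r x -> f x = 0) ->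
  forall x, ~ cube 0 r x -> partial i f x = 0.
Proof.
move=> f0 x xr.
have oC : open (~` cube (0 : 'rV[R]_n) r).
  by apply: closed_openC; exact: closed_cube.
have [|-> _] := @partial_near n f (cst 0) x i; last by rewrite /partial derive_cst.
by apply: filterS (open_nbhs_nbhs (conj oC xr)) => y; exact: f0.
Qed.

Lemma consrV0 n (p : R * 'rV[R]_n) : consrV p ord0 ord0 = p.1.
Proof. by rewrite /consrV mxE unlift_none. Qed.

Lemma consrVS n (p : R * 'rV[R]_n) j : consrV p ord0 (lift ord0 j) = p.2 ord0 j.
Proof. by rewrite /consrV mxE liftK. Qed.

Lemma consrV_e0 n t (y : 'rV[R]_n) (h : R) :
  h *: basis_vec ord0 + consrV (t, y) = consrV (h *: 1 + t, y).
Proof.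
apply/rowP => i; case: (unliftP ord0 i) => [j|] ->; rewrite mxE.
  by rewrite !consrVS !mxE eqxx/= mulr0 add0r.
by rewrite !consrV0 !mxE !eqxx/=.
Qed.

Lemma consrV_eS n t (y : 'rV[R]_n) (h : R) j :
  h *: basis_vec (lift ord0 j) + consrV (t, y) = consrV (t, h *: basis_vec j + y).
Proof.
apply/rowP => i; case: (unliftP ord0 i) => [k|] ->; rewrite mxE.
  rewrite !consrVS !mxE eqxx/= ; congr (_ * _%:R + _); congr nat_of_bool.
by rewrite !consrV0 !mxE/= mulr0 add0r.
Qed.

Lemma consrV_continuousl n (y : 'rV[R]_n) : continuous (fun t : R => consrV (t, y)).
Proof.
move=> t; apply/cvgrPdist_le => /= e e0; near=> s.
apply/rV_norm_le => [|i]; first exact: ltW.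
case: (unliftP ord0 i) => [k|] ->; rewrite !mxE.
  by rewrite !liftK/= subrr normr0 ltW.
rewrite !unlift_none/=; near: s.
by apply: cvgr_dist_le e0 => //; exact: cvg_id.
Unshelve. all: by end_near. Qed.

Lemma consrV_continuousr n (t : R) : continuous (fun y : 'rV[R]_n => consrV (t, y)).
Proof.
move=> y.
apply: (iffRL (@cvgrPdist_le _ _ _ (nbhs y) _ _ _)) => e e0; near=> z.
have yz : `|y - z| <= e.
  by near: z; move: e e0; apply/cvgrPdist_le; exact: cvg_id.
apply/rV_norm_le => [|i]; first exact: ltW.
case: (unliftP ord0 i) => [k|] ->; rewrite !mxE.
  by rewrite !liftK/=; have := rV_coord_le (y - z) k; rewrite !mxE => /le_trans; apply.
by rewrite !unlift_none/= subrr normr0 ltW.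
Unshelve. all: by end_near. Qed.

(** Induction on the dimension. In direction 0 the inner integral over the
    coordinate 0 vanishes by the fundamental theorem of calculus; in the other
    directions the inner integral over the remaining coordinates vanishes by
    induction. *)
Lemma integral_partial0 n (i : 'I_n) (f : 'rV[R]_n -> R) r : 0 <= r ->
  (forall x, derivable f x (basis_vec i)) -> continuous (partial i f) ->
  (forall x, ~ cube 0 r x -> f x = 0) -> \int[leb n]_x partial i f x = 0.
Proof.
move=> r0; elim: n i f => [[]//|n IHn] i f df cf f0.
have [M M0 fM] := continuous_supp_bounded cf (partial_supp i f0).
have [E1 E2] := Rintegral_rVS r0 (continuous_measurable_rV cf) fM (partial_supp i f0).
case: (unliftP ord0 i) => [j|] ij; subst i.
  rewrite E1; under eq_integral => t _.
    rewrite (_ : integral _ _ _ = 0%E); first over.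
    pose F y := f (consrV (t, y)).
    have dF y : partial (lift ord0 j) f (consrV (t, y)) = partial j F y /\
       (derivable f (consrV (t, y)) (basis_vec (lift ord0 j)) <-> derivable F y (basis_vec j)).
      by apply: derive_along => h; rewrite consrV_eS.
    have F0 y : ~ cube 0 r y -> F y = 0.
      move=> yr; apply: f0 => h; apply: yr => k; have := h (lift ord0 k).
      by rewrite consrVS !mxE.
    have -> : (fun y => (partial (lift ord0 j) f (consrV (t, y)))%:E) =
              EFin \o partial j F.
      by apply/funext => y /=; rewrite (dF y).1.
    have cF : continuous (partial j F).
      have -> : partial j F = partial (lift ord0 j) f \o (fun y => consrV (t, y)).
        by apply/funext => y /=; rewrite (dF y).1.
      move=> y; apply: continuous_comp; first exact: consrV_continuousr.
      exact: cf.
    have [M' M'0 FM] := continuous_supp_bounded cF (partial_supp j F0).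
    rewrite -[LHS]fineK.
      have dFj y : derivable F y (basis_vec j) := (dF y).2.1 (df (consrV (t, y))).
      exact: (congr1 EFin (IHn j F dFj cF F0)).
    apply: integrable_fin_num => //.
    apply: (@bounded_support_integrable _ _ _ _ _ (cube 0 r) M') => //.
    - exact: measurable_cube.
    - by have /= -> := lebesgue_cube (0 : 'rV[R]_n) r0; rewrite ltry.
    - exact: continuous_measurable_rV.
    - exact: partial_supp.
  by rewrite integral0.
rewrite E2; under eq_integral => y _.
  rewrite (_ : integral _ _ _ = 0%E); first over.
  pose F (t : R) := f (consrV (t, y)).
  have dF (t : R) : partial ord0 f (consrV (t, y)) = derive F t 1 /\
     (derivable f (consrV (t, y)) (basis_vec ord0) <-> derivable F t 1).
    by apply: derive_along => h; rewrite consrV_e0.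
  have F0 (t : R) : r < `|t| -> F t = 0.
    move=> tr; apply: f0 => h; have := h ord0.
    by rewrite consrV0 !mxE subr0 leNgt tr.
  have dF' (t : R) : derivable F t 1 := (dF t).2.1 (df (consrV (t, y))).
  have cF : continuous (fun t : R => partial ord0 f (consrV (t, y))).
    move=> t; apply: continuous_comp; first exact: consrV_continuousl.
    exact: cf.
  have r1 : - (r + 1) < r + 1 by lra.
  have -> : (\int[lebesgue_measure]_t (partial ord0 f (consrV (t, y)))%:E =
      \int[lebesgue_measure]_(t in `[(- (r + 1))%R, (r + 1)%R]) (partial ord0 f (consrV (t, y)))%:E)%E.
    rewrite [RHS]integral_mkcond; apply: eq_integral => t _.
    rewrite patchE; case: ifPn => // /negP ht; congr EFin.
    apply: (partial_supp ord0 f0) => h; apply: ht; rewrite inE/= in_itv/=.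
    have := h ord0; rewrite consrV0 !mxE subr0 ler_norml => /andP[h1 h2].
    by rewrite (le_trans _ h1) ?(le_trans h2) ?lerN2 ?lerDl.
  rewrite (@continuous_FTC2 _ (fun t => partial ord0 f (consrV (t, y))) F _ _ r1).
  - by rewrite !F0 ?subee// ?normrN ger0_norm; lra.
  - exact: continuous_subspaceT.
  - have cFF (t : R) : F x @[x --> t] --> F t.
      by apply: differentiable_continuous; apply/derivable1_diffP.
    split => [t _||].
    + exact: dF'.
    + by apply: cvg_at_right_filter; exact: cFF.
    + by apply: cvg_at_left_filter; exact: cFF.
  - by move=> t _; rewrite derive1E (dF t).1.
by rewrite integral0.
Qed.

End integral_partial.

(** * Smooth functions on an open set *)

Section smooth_on.
Context {R : realType} {n : nat}.
Implicit Types (D : set 'rV[R]_n) (f g : 'rV[R]_n -> R).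

(** An inductive wrapper keeps the proposition atomic for automation. *)
Inductive smooth_on D f : Prop := SmoothOn of forall (s : seq 'I_n) x, D x ->
  {for x, continuous (foldr (@partial R n) f s)} /\
  forall i, derivable (foldr (@partial R n) f s) x (basis_vec i).

Lemma smooth_onT f : smooth_on setT f -> smooth f.
Proof. by move=> [sf] s; split=> [x|i x]; have [? ?] := sf s x I. Qed.

(** Polynomial expressions in the functions that satisfy P. *)
Inductive alg (P : ('rV[R]_n -> R) -> Prop) : ('rV[R]_n -> R) -> Prop :=
| alg_base f of P f : alg P f
| alg_add f g of alg P f & alg P g : alg P (fun x => f x + g x)
| alg_mul f g of alg P f & alg P g : alg P (fun x => f x * g x).

Lemma alg_sub (P Q : ('rV[R]_n -> R) -> Prop) f :
  (forall g, P g -> Q g) -> alg P f -> alg Q f.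
Proof.
move=> PQ; elim=> [g Pg|g h _ IHg _ IHh|g h _ IHg _ IHh].
- exact/alg_base/PQ.
- exact: (alg_add IHg IHh).
- exact: (alg_mul IHg IHh).
Qed.

Lemma near_open D f g x : open D -> D x -> (forall y, D y -> f y = g y) ->
  \forall y \near x, f y = g y.
Proof.
by move=> oD Dx fg; apply: filterS (open_nbhs_nbhs (conj oD Dx)) => y; exact: fg.
Qed.

Lemma continuous_near f g x : (\forall y \near x, f y = g y) ->
  {for x, continuous f} -> {for x, continuous g}.
Proof.
move=> fg cf; rewrite /prop_for /continuous_at -(nbhs_singleton fg).
exact: (cvg_trans (near_eq_cvg fg) cf).
Qed.

Lemma partialD f g x i : derivable f x (basis_vec i) ->
  derivable g x (basis_vec i) ->
  derivable (fun y => f y + g y) x (basis_vec i) /\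
  partial i (fun y => f y + g y) x = partial i f x + partial i g x.
Proof. by move=> df dg; split; [exact: (derivableD df dg)|exact: (deriveD df dg)]. Qed.

Lemma partialM f g x i : derivable f x (basis_vec i) ->
  derivable g x (basis_vec i) ->
  derivable (fun y => f y * g y) x (basis_vec i) /\
  partial i (fun y => f y * g y) x = f x * partial i g x + g x * partial i f x.
Proof. by move=> df dg; split; [exact: (derivableM df dg)|exact: (deriveM df dg)]. Qed.

(** Every iterated partial derivative agrees on D with a member of P: as D is
    open, changing a function off D does not affect its derivatives on D. *)
Lemma smooth_on_coind (P : ('rV[R]_n -> R) -> Prop) D : open D ->
  (forall f x, P f -> D x ->
     {for x, continuous f} /\ forall i, derivable f x (basis_vec i)) ->
  (forall f i, P f -> exists2 g, P g & forall x, D x -> partial i f x = g x) ->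
  forall f, P f -> smooth_on D f.
Proof.
move=> oD Pc Pd f Pf; split=> s.
have [g Pg fg] : exists2 g, P g & forall x, D x -> foldr (@partial R n) f s x = g x.
  elim: s => [|i s [g Pg fg]] /=; first by exists f.
  have [g' Pg' gg'] := Pd g i Pg; exists g' => // x Dx.
  by rewrite -gg'//; apply: (partial_near i _).1; exact: near_open fg.
move=> x Dx; have [cg dg] := Pc g x Pg Dx.
have fgx := near_open oD Dx fg; split=> [|i].
  apply: continuous_near cg; apply: filterS fgx => y; exact: esym.
exact/(partial_near i fgx).2.
Qed.

Lemma smooth_on_partial D f i : smooth_on D f -> smooth_on D (partial i f).
Proof.
by move=> [sf]; split=> s x Dx; have := sf (rcons s i) x Dx; rewrite foldr_rcons.
Qed.

Lemma smooth_on_cont D f x : smooth_on D f -> D x -> {for x, continuous f}.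
Proof. by move=> [sf] Dx; have [] := sf [::] x Dx. Qed.

Lemma smooth_on_derivable D f x i : smooth_on D f -> D x ->
  derivable f x (basis_vec i).
Proof. by move=> [sf] Dx; have [_] := sf [::] x Dx; exact. Qed.

(** A family of functions whose partial derivatives are polynomials in smooth
    functions and in the members of the family consists of smooth functions. *)
Lemma smooth_on_family (K : Type) (v : K -> 'rV[R]_n -> R) D : open D ->
  (forall k x, D x -> {for x, continuous (v k)} /\
     forall i, derivable (v k) x (basis_vec i)) ->
  (forall k i, exists2 g, alg (fun f => smooth_on D f \/ exists k, f = v k) g &
     forall x, D x -> partial i (v k) x = g x) ->
  forall f, alg (fun f => smooth_on D f \/ exists k, f = v k) f -> smooth_on D f.
Proof.
move=> oD vc vd; set Q := (fun f => _).
have cd f x : alg Q f -> D x ->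
    {for x, continuous f} /\ forall i, derivable f x (basis_vec i).
  move=> Qf Dx; elim: Qf => {f}.
  - move=> f [sf|[k ->]]; last exact: vc.
    by split; [exact: smooth_on_cont sf Dx|move=> i; exact: smooth_on_derivable sf Dx].
  - move=> f g _ [cf df] _ [cg dg]; split; first exact: continuousD.
    by move=> i; exact: (partialD (df i) (dg i)).1.
  - move=> f g _ [cf df] _ [cg dg]; split; first exact: continuousM.
    by move=> i; exact: (partialM (df i) (dg i)).1.
apply: smooth_on_coind => // f i; elim => {f}.
- move=> f [sf|[k ->]]; last exact: vd.
  by exists (partial i f) => //; apply: alg_base; left; exact: smooth_on_partial.
- move=> f g Qf [f' Qf' ff'] Qg [g' Qg' gg'].
  exists (fun x => f' x + g' x); first exact: alg_add.
  move=> x Dx; rewrite -ff'// -gg'//.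
  by apply: (partialD _ _).2; [exact: (cd f x Qf Dx).2|exact: (cd g x Qg Dx).2].
- move=> f g Qf [f' Qf' ff'] Qg [g' Qg' gg'].
  exists (fun x => f x * g' x + g x * f' x).
    by apply: alg_add; exact: alg_mul.
  move=> x Dx; rewrite -ff'// -gg'//.
  by apply: (partialM _ _).2; [exact: (cd f x Qf Dx).2|exact: (cd g x Qg Dx).2].
Qed.

Lemma smooth_on_alg D f : open D -> alg (smooth_on D) f -> smooth_on D f.
Proof.
move=> oD af; apply: (@smooth_on_family void (fun=> f) D) => //.
by apply: alg_sub af => g; left.
Qed.

Section closure.
Variables (D : set 'rV[R]_n) (oD : open D).

Lemma smooth_onD f g : smooth_on D f -> smooth_on D g ->
  smooth_on D (fun x => f x + g x).
Proof. by move=> *; apply: smooth_on_alg => //; apply: alg_add; exact: alg_base. Qed.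

Lemma smooth_onM f g : smooth_on D f -> smooth_on D g ->
  smooth_on D (fun x => f x * g x).
Proof. by move=> *; apply: smooth_on_alg => //; apply: alg_mul; exact: alg_base. Qed.

Lemma smooth_on_cst (c : R) : smooth_on D (fun=> c).
Proof.
apply: (@smooth_on_coind (fun f => exists c, f = fun=> c)) => //; last by exists c.
- move=> f x [{}c ->] _; split; first exact: cst_continuous.
  by move=> i; exact: derivable_cst.
- move=> f i [{}c ->]; exists (fun=> 0) => [|x _]; first by exists 0.
  exact: derive_cst.
Qed.

Lemma smooth_on_near f g : (forall x, D x -> f x = g x) ->
  smooth_on D f -> smooth_on D g.
Proof.
move=> fg sf.
apply: (@smooth_on_coind (fun g => exists2 f, smooth_on D f & forall x, D x -> f x = g x)) => //; last by exists f.
- move=> {f g fg sf} g x [f sf fg] Dx; have fgx := near_open oD Dx fg; split.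
    exact: (continuous_near fgx (smooth_on_cont sf Dx)).
  by move=> i; apply: (partial_near i fgx).2.1; exact: (smooth_on_derivable sf Dx).
- move=> {f g fg sf} g i [f sf fg]; exists (partial i f).
    by exists (partial i f) => //; exact: smooth_on_partial.
  by move=> x Dx; rewrite (partial_near i (near_open oD Dx fg)).1.
Qed.

Lemma derive_coord i j (x : 'rV[R]_n) :
  derivable (fun y : 'rV[R]_n => y ord0 j) x (basis_vec i) /\
  partial i (fun y : 'rV[R]_n => y ord0 j) x = (i == j)%:R.
Proof.
have h : (fun h : R => h^-1 *: (((fun y : 'rV[R]_n => y ord0 j) \o shift x)
    (h *: basis_vec i) - x ord0 j)) @ 0^' --> ((i == j)%:R : R).
  apply: cvg_near_cst.
  near=> h; have h0 : h != 0 by near: h; exact: nbhs_dnbhs_neq.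
  by rewrite /= !mxE eqxx/= addrK /GRing.scale/= mulKf// eq_sym.
split; first by apply/cvg_ex; eexists; exact: h.
by apply/cvg_lim => //; exact: h.
Unshelve. all: by end_near. Qed.

Lemma smooth_on_coord j : smooth_on D (fun x => x ord0 j).
Proof.
apply: (@smooth_on_coind (fun f => smooth_on D f \/ f = fun x => x ord0 j)) => //; last by right.
- move=> f x [sf|->] Dx.
    by split; [exact: smooth_on_cont sf Dx|move=> i; exact: smooth_on_derivable sf Dx].
  by split; [exact: coord_continuous|move=> i; exact: (derive_coord _ _ _).1].
- move=> f i [sf|->].
    by exists (partial i f) => //; left; exact: smooth_on_partial.
  exists (fun=> (i == j)%:R); first by left; exact: smooth_on_cst.
  by move=> x _; rewrite (derive_coord _ _ _).2.
Qed.

Lemma smooth_onN f : smooth_on D f -> smooth_on D (fun x => - f x).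
Proof.
move=> sf; apply: (@smooth_on_near (fun x => -1 * f x)).
  by move=> x _; rewrite mulN1r.
by apply: smooth_onM => //; exact: smooth_on_cst.
Qed.

Lemma smooth_onB f g : smooth_on D f -> smooth_on D g ->
  smooth_on D (fun x => f x - g x).
Proof. by move=> sf sg; apply: smooth_onD => //; exact: smooth_onN. Qed.

Lemma smooth_on_sum (J : Type) (r : seq J) (F : J -> 'rV[R]_n -> R) :
  (forall j, smooth_on D (F j)) -> smooth_on D (fun x => \sum_(j <- r) F j x).
Proof.
move=> sF; elim: r => [|j r IH].
  by apply: smooth_on_near (smooth_on_cst 0) => x _; rewrite big_nil.
by apply: smooth_on_near (smooth_onD (sF j) IH) => x _; rewrite big_cons.
Qed.

Lemma smooth_on_prod (J : Type) (r : seq J) (F : J -> 'rV[R]_n -> R) :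
  (forall j, smooth_on D (F j)) -> smooth_on D (fun x => \prod_(j <- r) F j x).
Proof.
move=> sF; elim: r => [|j r IH].
  by apply: smooth_on_near (smooth_on_cst 1) => x _; rewrite big_nil.
by apply: smooth_on_near (smooth_onM (sF j) IH) => x _; rewrite big_cons.
Qed.

Lemma derivable1_comp (f g : R -> R) t : derivable f t 1 ->
  derivable g (f t) 1 -> derivable (fun s => g (f s)) t 1.
Proof.
have P (h : R -> R) s := @derivable1_diffP R _ h s.
by move=> /P df /P dg; apply/P; exact: (@differentiable_comp _ _ _ _ f g).
Qed.

Lemma partial_comp (phi : R -> R) f x i : derivable phi (f x) 1 ->
  derivable f x (basis_vec i) ->
  derivable (fun y => phi (f y)) x (basis_vec i) /\
  partial i (fun y => phi (f y)) x = 'D_1 phi (f x) * partial i f x.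
Proof.
move=> dphi df; pose g (h : R) := f (h *: basis_vec i + x).
have E (u : 'rV[R]_n -> R) : derive u x (basis_vec i) = 'D_1 (fun h : R => u (h *: basis_vec i + x)) 0 /\
    (derivable u x (basis_vec i) <-> derivable (fun h : R => u (h *: basis_vec i + x)) 0 1).
  by apply: derive_along => h; rewrite addr0 /GRing.scale/= mulr1.
have dg : derivable g 0 1 := (E f).2.1 df.
have g0 : g 0 = f x by rewrite /g scale0r add0r.
have dphig : derivable phi (g 0) 1 by rewrite g0.
rewrite /partial (E f).1 (E (fun y => phi (f y))).1; split.
  apply/(E (fun y => phi (f y))).2.
  exact: (derivable1_comp dg dphig).
by rewrite -!derive1E (derive1_comp dg dphig) g0.
Qed.

Lemma derivable1_continuous (phi : R -> R) t : derivable phi t 1 ->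
  {for t, continuous phi}.
Proof. by move=> /derivable1_diffP/differentiable_continuous. Qed.

Lemma continuous_comp1 (phi : R -> R) f x : derivable phi (f x) 1 ->
  {for x, continuous f} -> {for x, continuous (fun y => phi (f y))}.
Proof.
by move=> dphi cf; apply: continuous_comp => //; exact: derivable1_continuous.
Qed.

(** Smoothness of a composition when the derivatives of the outer functions
    are polynomials in the outer functions and in smooth functions. *)
Lemma smooth_on_comp (K : Type) (psi : K -> R -> R) f : smooth_on D f ->
  (forall k x, D x -> derivable (psi k) (f x) 1) ->
  (forall k, exists2 g,
     alg (fun h => smooth_on D h \/ exists k, h = fun x => psi k (f x)) g &
     forall x, D x -> 'D_1 (psi k) (f x) = g x) ->
  forall k, smooth_on D (fun x => psi k (f x)).
Proof.
move=> sf dpsi epsi k.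
apply: (@smooth_on_family K (fun k x => psi k (f x))) => //; last first.
  by apply: alg_base; right; exists k.
- move=> {}k i; have [g Qg gE] := epsi k.
  exists (fun x => g x * partial i f x).
    by apply: alg_mul => //; apply: alg_base; left; exact: smooth_on_partial.
  move=> x Dx; rewrite -gE// (partial_comp _ _).2//; first exact: dpsi.
  exact: (smooth_on_derivable sf Dx).
- move=> {}k x Dx; split.
    by apply: continuous_comp1; [exact: dpsi|exact: smooth_on_cont sf Dx].
  move=> i; apply: (partial_comp _ _).1; first exact: dpsi.
  exact: (smooth_on_derivable sf Dx).
Qed.

Lemma derive_inv (t : R) : t != 0 ->
  derivable (fun t : R => t^-1) t 1 /\ 'D_1 (fun t : R => t^-1) t = - (t ^- 2).
Proof.
move=> t0; have did : derivable (@id R) t 1 by exact: derivable_id.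
split; first exact: (@derivableV _ _ id t 1 t0 did).
rewrite (@deriveV _ _ id t 1) //.
by rewrite derive_id /GRing.scale/= mulr1.
Qed.

Lemma smooth_onV f : smooth_on D f -> (forall x, D x -> f x != 0) ->
  smooth_on D (fun x => (f x)^-1).
Proof.
move=> sf f0.
apply: (@smooth_on_comp unit (fun _ t => t^-1) f sf _ _ tt).
  by move=> _ x Dx; exact: (derive_inv (f0 x Dx)).1.
move=> _; exists (fun x => -1 * ((f x)^-1 * (f x)^-1)).
  apply: alg_mul; first by apply: alg_base; left; exact: smooth_on_cst.
  by apply: alg_mul; apply: alg_base; right; exists tt.
by move=> x Dx; rewrite (derive_inv (f0 x Dx)).2 mulN1r -invfM.
Qed.

Lemma derive_sqrtr (t : R) : 0 < t ->
  derivable Num.sqrt t 1 /\ 'D_1 Num.sqrt t = 2^-1 * (Num.sqrt t)^-1.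
Proof.
move=> t0; have [d e] := is_derive1_sqrt t0; split => //.
by rewrite e invfM.
Qed.

Lemma smooth_on_sqrt f : smooth_on D f -> (forall x, D x -> 0 < f x) ->
  smooth_on D (fun x => Num.sqrt (f x)).
Proof.
move=> sf f0.
have sv : smooth_on D (fun x => (f x)^-1).
  by apply: smooth_onV => // x Dx; rewrite gt_eqF// f0.
apply: (@smooth_on_comp unit (fun _ t => Num.sqrt t) f sf _ _ tt).
  by move=> _ x Dx; exact: (derive_sqrtr (f0 x Dx)).1.
move=> _; exists (fun x => (2^-1 * (f x)^-1) * Num.sqrt (f x)).
  apply: alg_mul; last by apply: alg_base; right; exists tt.
  by apply: alg_base; left; apply: smooth_onM => //; exact: smooth_on_cst.
move=> x Dx; rewrite (derive_sqrtr (f0 x Dx)).2 -mulrA; congr (_ * _).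
rewrite -[in X in _ = X * _](sqr_sqrtr (ltW (f0 x Dx))) expr2 invfM -mulrA.
by rewrite mulVf ?mulr1// gt_eqF// sqrtr_gt0 f0.
Qed.

End closure.

Lemma smooth_onU D D' f : smooth_on D f -> smooth_on D' f -> smooth_on (D `|` D') f.
Proof. by move=> [sf] [sf']; split=> s x [Dx|Dx]; [exact: sf|exact: sf']. Qed.

End smooth_on.

(** * A smooth step *)

Section step.
Context {R : realType}.

Lemma derive_comp1 (f g : R -> R) t : derivable f t 1 ->
  derivable g (f t) 1 ->
  derivable (fun s => g (f s)) t 1 /\
  'D_1 (fun s => g (f s)) t = 'D_1 g (f t) * 'D_1 f t.
Proof.
move=> df dg; split; last by rewrite -!derive1E (derive1_comp df dg).
exact: derivable1_comp.
Qed.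

(** The functions t^-k exp (-1/t), extended by 0 to t <= 0, are smooth together
    because the derivative of each of them is a combination of two others. *)
Definition flat (k : nat) (t : R) : R :=
  if 0 < t then t^-1 ^+ k * expR (- t^-1) else 0.

Lemma flat0 k t : t <= 0 -> flat k t = 0.
Proof. by rewrite /flat leNgt => /negbTE ->. Qed.

Lemma flat_ge0 k t : 0 <= flat k t.
Proof.
rewrite /flat; case: ifP => // t0.
by rewrite mulr_ge0 ?expR_ge0// exprn_ge0// invr_ge0 ltW.
Qed.

Lemma flat_gt0 k t : 0 < t -> 0 < flat k t.
Proof. by move=> t0; rewrite /flat t0 mulr_gt0 ?expR_gt0// exprn_gt0// invr_gt0. Qed.

Lemma exprn_expRN m (u : R) : 0 <= u -> u ^+ m * expR (- u) <= m`!%:R.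
Proof.
move=> u0; case: m => [|m].
  by rewrite expr0 mul1r fact0 -[leRHS]expR0 ler_expR oppr_le0.
have h : u ^+ m.+1 / m.+1`!%:R <= expR u.
  by apply: le_trans (expR_ge1Dxn m u0); rewrite lerDr.
rewrite expRN ler_pdivrMr ?expR_gt0// mulrC -ler_pdivrMr// ltr0n fact_gt0//.
Qed.

(** This quadratic bound gives the derivative 0 at the origin. *)
Lemma flat_le2 k t : `|flat k t| <= (k.+2)`!%:R * t ^+ 2.
Proof.
rewrite ger0_norm ?flat_ge0// /flat; case: ifPn => [t0|_]; last first.
  by rewrite mulr_ge0// sqr_ge0.
rewrite -ler_pdivrMr ?exprn_gt0//; have := @exprn_expRN k.+2 t^-1.
rewrite invr_ge0 (ltW t0) => /(_ isT); apply: le_trans.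
by rewrite -exprVn mulrAC -exprD addn2.
Qed.

Lemma flat_le k t : flat k t <= k`!%:R.
Proof.
rewrite /flat; case: ifPn => [t0|_] //.
by apply: exprn_expRN; rewrite invr_ge0 ltW.
Qed.

Lemma derive_flat k t : derivable (flat k) t 1 /\
  'D_1 (flat k) t = - k%:R * flat k.+1 t + flat k.+2 t.
Proof.
have [t0|t0|->] := ltgtP t 0.
- have nf : \forall s \near t, cst 0 s = flat k s.
    near=> s; rewrite flat0//; apply: ltW; near: s; exact: lt_nbhsl.
  split; first exact: near_eq_derivable nf (derivable_cst _ _ _).
  by rewrite -(near_eq_derive _ nf) derive_cst !flat0 ?ltW// mulr0 addr0.
- pose phi (u : R) := u ^+ k * expR (- u).
  have nf : \forall s \near t, (phi \o (fun s => s^-1)) s = flat k s.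
    near=> s; rewrite /flat ifT//; near: s; exact: lt_nbhsr.
  have tn0 : t != 0 by rewrite gt_eqF.
  have [di ei] := derive_inv tn0.
  have dN (u : R) : derivable (fun u => expR (- u)) u 1 /\
      'D_1 (fun u => expR (- u)) u = - expR (- u).
    have [||d e] := @derive_comp1 (fun u => - u) expR u.
    - exact/derivableN/derivable_id.
    - exact: derivable_expR.
    split => //; rewrite e (_ : derive expR (- u) 1 = expR (- u)); last by rewrite derive_val.
    rewrite deriveN; last exact: derivable_id.
    by rewrite derive_id mulrN1.
  have dX (u : R) : derivable (fun u : R => u ^+ k) u 1 /\
      'D_1 (fun u : R => u ^+ k) u = k%:R * u ^+ k.-1.
    have -> : (fun u : R => u ^+ k) = @id R ^+ k.
      by apply/funext => s; elim: k {phi nf} => //= m IH; rewrite exprS IH exprS.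
    split; first exact/derivableX/derivable_id.
    rewrite deriveX; last exact: derivable_id.
    by rewrite derive_id /GRing.scale/= mulr1 mulr_natl.
  have dphi (u : R) : derivable phi u 1 /\
     'D_1 phi u = k%:R * u ^+ k.-1 * expR (- u) - u ^+ k * expR (- u).
    split; first exact: (derivableM (dX u).1 (dN u).1).
    rewrite (deriveM (dX u).1 (dN u).1) (dX u).2 (dN u).2 /GRing.scale/=; ring.
  have [d1 e1] := derive_comp1 di (dphi _).1.
  split; first exact: near_eq_derivable nf d1.
  rewrite -(near_eq_derive _ nf) e1 ei (dphi _).2 /flat t0 -exprVn.
  case: k {phi nf dX dphi d1 e1} => [|k] /=.
    by rewrite !expr0; ring.
  by rewrite !exprS; ring.
- have h : (fun h : R => h^-1 *: ((flat k \o shift 0) (h *: 1) - flat k 0)) @ 0^' --> (0 : R).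
    apply/cvgr0Pnorm_le => e e0; near=> h.
    have h0 : h != 0 by near: h; exact: nbhs_dnbhs_neq.
    rewrite /= addr0 (@flat0 _ 0)// subr0 /GRing.scale/= mulr1 normrM normfV.
    rewrite ler_pdivrMl ?normr_gt0//; apply: le_trans (flat_le2 _ _) _.
    rewrite -real_normK ?num_real// expr2 mulrA mulrC ler_wpM2l//.
    rewrite mulrC -ler_pdivlMr ?ltr0n ?fact_gt0//.
    near: h; apply: dnbhs0_le; rewrite divr_gt0// ltr0n fact_gt0//.
  split; first by apply/cvg_ex; eexists; exact: h.
  rewrite (@flat0 k.+1)// (@flat0 k.+2)// mulr0 addr0.
  by apply/cvg_lim => //; exact: h.
Unshelve. all: by end_near. Qed.

Definition flat_den (t : R) := flat 0 t + flat 0 (1 - t).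
Definition step (t : R) := flat 0 t / flat_den t.
(** The derivative of step, in a form that makes its sign visible. *)
Definition dstep (t : R) :=
  (flat 2 t * flat 0 (1 - t) + flat 0 t * flat 2 (1 - t)) / flat_den t ^+ 2.

Lemma flat_den_gt t : expR (- 2) <= flat_den t.
Proof.
have h s : 2^-1 <= s -> expR (- 2) <= flat 0 s.
  move=> s2; have s0 : 0 < s by apply: lt_le_trans s2; rewrite invr_gt0.
  rewrite /flat s0 expr0 mul1r ler_expR lerN2 -[leRHS]invrK.
  by rewrite lef_pV2// posrE invr_gt0.
have [t2|t2] := leP 2^-1 t.
  by rewrite -[leLHS]addr0 lerD ?h ?flat_ge0.
rewrite -[leLHS]add0r lerD ?h ?flat_ge0//; lra.
Qed.

Lemma flat_den_gt0 t : 0 < flat_den t.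
Proof. exact: lt_le_trans (expR_gt0 _) (flat_den_gt t). Qed.

Lemma step_ge0 t : 0 <= step t.
Proof. by rewrite divr_ge0 ?flat_ge0// ltW// flat_den_gt0. Qed.

Lemma step_le1 t : step t <= 1.
Proof. by rewrite ler_pdivrMr ?flat_den_gt0// mul1r lerDl flat_ge0. Qed.

Lemma step0 t : t <= 0 -> step t = 0.
Proof. by move=> t0; rewrite /step flat0// mul0r. Qed.

Lemma step1 t : 1 <= t -> step t = 1.
Proof.
move=> t1; have t0 : 1 - t <= 0 by lra.
have := flat_den_gt0 t; rewrite /step /flat_den (flat0 0 t0) addr0 => h.
by rewrite divff// gt_eqF.
Qed.

Lemma dstep_ge0 t : 0 <= dstep t.
Proof.
apply: divr_ge0; last by rewrite sqr_ge0.
by rewrite addr_ge0// mulr_ge0// flat_ge0.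
Qed.

Lemma dstep_gt0 t : 0 < t -> t < 1 -> 0 < dstep t.
Proof.
move=> t0 t1; rewrite divr_gt0 ?exprn_gt0 ?flat_den_gt0//.
by rewrite addr_gt0// mulr_gt0// flat_gt0// subr_gt0.
Qed.

Lemma dstep0 t : t <= 0 \/ 1 <= t -> dstep t = 0.
Proof.
rewrite /dstep => -[t0|t1].
  by rewrite !(flat0 _ t0) !mul0r add0r mul0r.
have t0 : 1 - t <= 0 by lra.
by rewrite !(flat0 _ t0) !mulr0 add0r mul0r.
Qed.

(** Any bound will do: it determines the width of the cutoff of the model, whose
    slope has to be at most 1/2. *)
Lemma dstep_bounded : exists2 L, 0 < L & forall t, dstep t <= L.
Proof.
exists (4 * expR (- 2) ^- 2); first by rewrite mulr_gt0// invr_gt0 exprn_gt0// expR_gt0.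
move=> t; have f2 s : 0 <= flat 2 s <= 2 by rewrite flat_ge0 flat_le.
have f0 s : 0 <= flat 0 s <= 1 by rewrite flat_ge0 flat_le.
apply: ler_pM.
- by rewrite addr_ge0// mulr_ge0// flat_ge0.
- by rewrite invr_ge0 exprn_ge0// ltW// flat_den_gt0.
- have := f2 t; have := f2 (1 - t); have := f0 t; have := f0 (1 - t); nra.
- rewrite lef_pV2 ?posrE ?exprn_gt0 ?flat_den_gt0 ?expR_gt0//.
  by rewrite lerXn2r ?nnegrE ?expR_ge0 ?flat_den_gt// ltW// flat_den_gt0.
Qed.

Lemma derive_flatN k (t : R) : derivable (fun s : R => flat k (1 - s)) t 1 /\
  'D_1 (fun s : R => flat k (1 - s)) t = - 'D_1 (flat k) (1 - t).
Proof.
have dB : derivable (fun t : R => 1 - t) t 1.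
  by apply: derivableB; [exact: derivable_cst|exact: derivable_id].
have [d e] := derive_comp1 dB (derive_flat k (1 - t)).1.
split => //; rewrite e deriveB; [|exact: derivable_cst|exact: derivable_id].
by rewrite derive_cst derive_id sub0r mulrN1.
Qed.

Lemma derive_step (t : R) : derivable step t 1 /\ 'D_1 step t = dstep t.
Proof.
have [d1 e1] := derive_flat 0 t; have [d2 e2] := derive_flatN 0 t.
have [_ e3] := derive_flat 0 (1 - t).
rewrite e3 in e2; rewrite oppr0 mul0r add0r in e1; rewrite oppr0 mul0r add0r in e2.
have dd : derivable flat_den t 1 by exact: (derivableD d1 d2).
have ed : 'D_1 flat_den t = flat 2 t - flat 2 (1 - t).
  by rewrite (deriveD d1 d2) e1 e2.
have d0 : flat_den t != 0 by rewrite gt_eqF// flat_den_gt0.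
have dv := derivableV d0 dd.
split; first exact: (derivableM d1 dv).
rewrite (deriveM d1 dv) (deriveV d0 dd) e1 ed /GRing.scale/= /dstep.
move: d0; rewrite /flat_den; move=> d0; field; exact: d0.
Qed.

Section comp.
Variables (n : nat) (D : set 'rV[R]_n) (oD : open D) (f : 'rV[R]_n -> R).
Hypothesis sf : smooth_on D f.

Lemma smooth_on_flat k : smooth_on D (fun x => flat k (f x)).
Proof.
apply: (@smooth_on_comp _ _ D oD nat (fun k t => flat k t) f sf).
  by move=> {}k x _; exact: (derive_flat k _).1.
move=> {}k; exists (fun x => - k%:R * flat k.+1 (f x) + flat k.+2 (f x)).
  apply: alg_add; last by apply: alg_base; right; exists k.+2.
  apply: alg_mul; last by apply: alg_base; right; exists k.+1.
  by apply: alg_base; left; exact: smooth_on_cst.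
by move=> x _; rewrite (derive_flat k _).2.
Qed.

End comp.

Section comp_step.
Variables (n : nat) (D : set 'rV[R]_n) (oD : open D) (f : 'rV[R]_n -> R).
Hypothesis sf : smooth_on D f.

Let smooth_on_den : smooth_on D (fun x => flat_den (f x)).
Proof.
apply: smooth_onD => //; first exact: smooth_on_flat.
apply: smooth_on_flat => //; apply: smooth_onB => //; exact: smooth_on_cst.
Qed.

Lemma smooth_on_step : smooth_on D (fun x => step (f x)).
Proof.
apply: smooth_onM => //; first exact: smooth_on_flat.
by apply: smooth_onV => // x _; rewrite gt_eqF// flat_den_gt0.
Qed.

Lemma smooth_on_dstep : smooth_on D (fun x => dstep (f x)).
Proof.
have s1 : smooth_on D (fun x => 1 - f x).
  by apply: smooth_onB => //; exact: smooth_on_cst.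
apply: smooth_onM => //.
  by apply: smooth_onD => //; apply: smooth_onM => //; exact: smooth_on_flat.
apply: smooth_onV => // [|x _]; last by rewrite gt_eqF// exprn_gt0// flat_den_gt0.
apply: (@smooth_on_near _ _ _ oD (fun x => flat_den (f x) * flat_den (f x))).
  by move=> x _; rewrite expr2.
exact: smooth_onM.
Qed.

Lemma partial_step x i : D x ->
  partial i (fun x => step (f x)) x = dstep (f x) * partial i f x.
Proof.
move=> Dx; rewrite (partial_comp _ _).2 ?(derive_step _).2//.
  exact: (derive_step _).1.
exact: (smooth_on_derivable sf Dx).
Qed.

End comp_step.
End step.

(** * Dominated convergence and test functions *)

Section dominated.
Context d (T : measurableType d) (R : realType) (mu : {measure set T -> \bar R}).

Lemma Rdominated (D : set T) (f_ : (T -> R)^nat) (f g : T -> R) : measurable D ->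
  (forall m, measurable_fun D (f_ m)) ->
  (forall x, D x -> f_ ^~ x @ \oo --> f x) ->
  mu.-integrable D (EFin \o g) ->
  (forall m x, D x -> `|f_ m x| <= g x) ->
  mu.-integrable D (EFin \o f) /\
  (fun m => \int[mu]_(x in D) f_ m x) @ \oo --> \int[mu]_(x in D) f x.
Proof.
move=> mD mf_ cf ig fg.
have mf : measurable_fun D f by exact: (measurable_fun_cvg mf_ cf).
have [||||intf _ h] := @dominated_convergence _ _ _ mu D mD
  (fun m => EFin \o f_ m) (EFin \o f) (EFin \o g) _ _ _ ig _.
- by move=> m; exact/measurable_EFinP.
- exact/measurable_EFinP.
- by apply: aeW => x Dx; apply: cvg_EFin; [exact: nearW|exact: cf].
- by apply: aeW => x m Dx; rewrite lee_fin; exact: fg.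
split => //.
apply: (@fine_cvg _ _ _ _ (fun m => (\int[mu]_(x in D) (f_ m x)%:E)%E)).
by rewrite fineK//; exact: integrable_fin_num.
Qed.

End dominated.

Section test_functions.
Context {R : realType} {n : nat}.
Notation leb := (@lebesgue_rV R n).
Implicit Types (Omega K : set 'rV[R]_n) (phi : 'rV[R]_n -> R).

Lemma test_function_of Omega K phi : smooth phi -> compact K -> K `<=` Omega ->
  (forall x, ~ K x -> phi x = 0) -> test_function Omega phi.
Proof.
move=> sphi cK KO phi0.
have cl : closure [set x | phi x != 0] `<=` K.
  have clK : closed K by apply: compact_closed => //; exact: norm_hausdorff.
  move/closure_id : clK => ->; apply: closure_subset => x /= /eqP phix.
  by apply: contrapT => /phi0.
split => //; last exact: subset_trans cl KO.
by apply: subclosed_compact cl => //; exact: closed_closure.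
Qed.

Lemma test_function_supp Omega phi : test_function Omega phi ->
  (forall x, ~ Omega x -> phi x = 0) /\
  exists2 r, 0 <= r & forall x, ~ cube 0 r x -> phi x = 0.
Proof.
move=> [_ cphi sub].
have E x : ~ closure [set x | phi x != 0] x -> phi x = 0.
  by move=> h; apply: contrapT => /eqP phix; apply: h; exact: subset_closure.
split => [x Ox|]; first by apply: E => /sub.
have [M [_ hM]] := compact_bounded cphi; exists (`|M| + 1) => // x xM.
apply: E => /(hM (`|M| + 1)) h; apply: xM => i; rewrite mxE subr0.
by apply: le_trans (rV_coord_le _ _) _; apply: h; rewrite ltr_pwDr// ler_norm.
Qed.

Lemma smooth_smooth_on D phi : smooth phi -> smooth_on D phi.
Proof.
move=> sphi; split=> s x _; have [c d] := sphi s.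
by split; [exact: c|move=> i; exact: d].
Qed.

Lemma test_partial_supp Omega phi i : test_function Omega phi -> open Omega ->
  forall x, ~ Omega x -> partial i phi x = 0.
Proof.
move=> [_ cphi sub] oO x Ox.
have [|-> _] := @partial_near _ _ phi (cst 0) x i; last by rewrite /partial derive_cst.
have oC : open (~` closure [set x | phi x != 0]).
  by apply: closed_openC; exact: closed_closure.
apply: filterS (open_nbhs_nbhs (conj oC _)) => [y yC|]; last by move=> /sub.
by apply: contrapT => /eqP phiy; apply: yC; exact: subset_closure.
Qed.

Lemma test_bounded Omega phi : test_function Omega phi ->
  exists2 M, 0 <= M & forall x, `|phi x| <= M.
Proof.
move=> tphi; have [_ [r r0 supp]] := test_function_supp tphi.
by case: tphi => sphi _ _; apply: continuous_supp_bounded supp; have [] := sphi [::].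
Qed.

Lemma test_partial_bounded Omega phi i : test_function Omega phi ->
  exists2 M, 0 <= M & forall x, `|partial i phi x| <= M.
Proof.
move=> tphi; have [_ [r r0 supp]] := test_function_supp tphi.
case: tphi => sphi _ _; apply: continuous_supp_bounded (partial_supp i supp).
by have [] := sphi [:: i].
Qed.

Lemma test_measurable Omega phi D : test_function Omega phi -> measurable_fun D phi.
Proof.
move=> [sphi _ _]; apply: measurable_funTS; apply: continuous_measurable_rV.
by have [] := sphi [::].
Qed.

Lemma test_partial_measurable Omega phi i D : test_function Omega phi ->
  measurable_fun D (partial i phi).
Proof.
move=> [sphi _ _]; apply: measurable_funTS; apply: continuous_measurable_rV.
by have [] := sphi [:: i].
Qed.

Lemma integral_partial_test Omega phi (u : 'rV[R]_n -> R) i : open Omega ->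
  test_function Omega phi -> smooth_on setT u ->
  \int[leb]_(x in Omega) (u x * partial i phi x) =
  - \int[leb]_(x in Omega) (partial i u x * phi x).
Proof.
move=> oO tphi su.
have [supp [r r0 suppr]] := test_function_supp tphi.
have psupp := test_partial_supp i tphi oO.
have ppsupp := partial_supp i suppr.
have sphi : smooth_on setT phi by case: tphi => s _ _; exact: smooth_smooth_on.
have spu : smooth_on setT (fun x => u x * phi x) by apply: smooth_onM => //; exact: openT.
have cont f : smooth_on setT f -> continuous f.
  by move=> sf x; exact: smooth_on_cont sf _.
have ib f : smooth_on setT f -> (forall x, ~ cube 0 r x -> f x = 0) ->
    leb.-integrable setT (EFin \o f).
  move=> /cont cf sf; have [M _ fM] := continuous_supp_bounded cf sf.
  apply: (@bounded_support_integrable _ _ _ _ _ (cube 0 r) M) => //.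
  - exact: measurable_cube.
  - by have /= -> := lebesgue_cube (0 : 'rV[R]_n) r0; rewrite ltry.
  - exact: continuous_measurable_rV.
have s1 : smooth_on setT (fun x => u x * partial i phi x).
  by apply: smooth_onM; [exact: openT|by []|exact: smooth_on_partial].
have s2 : smooth_on setT (fun x => partial i u x * phi x).
  by apply: smooth_onM; [exact: openT|exact: smooth_on_partial|by []].
have mO : measurable Omega by exact: open_measurable_rV.
rewrite Rintegral_mkcond [in RHS]Rintegral_mkcond.
have E (f : 'rV[R]_n -> R) : (forall x, ~ Omega x -> f x = 0) -> f \_ Omega = f.
  by move=> f0; apply/funext => x; rewrite patchE; case: ifPn => // /negP;
     rewrite inE => /f0 ->.
rewrite !E; try by move=> x Ox; rewrite ?(supp x Ox) ?(psupp x Ox) mulr0.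
apply/eqP; rewrite -addr_eq0 -RintegralD//; last 2 first.
- by apply: ib => // x xr; rewrite ppsupp// mulr0.
- by apply: ib => // x xr; rewrite suppr// mulr0.
apply/eqP; rewrite -[RHS](@integral_partial0 _ n i (fun x => u x * phi x) r) //.
- apply: eq_Rintegral => x _; rewrite (partialM (smooth_on_derivable su I)
    (smooth_on_derivable sphi I)).2.
  by congr (_ + _); exact: mulrC.
- by move=> x; exact: smooth_on_derivable spu _.
- apply: cont; exact: smooth_on_partial.
- by move=> x xr; rewrite suppr// mulr0.
Qed.

End test_functions.

(** * Open boxes *)

Section boxes.
Context {R : realType} {n : nat}.
Notation leb := (@lebesgue_rV R n).
Implicit Types (a b x : 'rV[R]_n).

Definition obox a b := [set x : 'rV[R]_n | forall i, a ord0 i < x ord0 i < b ord0 i].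

Lemma oboxE a b : obox a b =
  [set x : 'rV[R]_n | forall i, `]a ord0 i, b ord0 i[%classic (x ord0 i)].
Proof. by apply/seteqP; split => x /= h i; have := h i; rewrite /= in_itv. Qed.

Lemma measurable_obox a b : measurable (obox a b).
Proof.
rewrite oboxE; apply: (@measurable_box _ _ (fun i => `]a ord0 i, b ord0 i[%classic)) => i.
exact: measurable_itv.
Qed.

Lemma open_obox a b : open (obox a b).
Proof.
rewrite openE => x xab; rewrite /interior/=.
have : nbhs x [set y : 'rV[R]_n | forall i, a ord0 i < y ord0 i < b ord0 i].
  apply: (@filter_forall _ _
    (fun i (y : 'rV[R]_n) => is_true (a ord0 i < y ord0 i < b ord0 i)) (nbhs x)).
  move=> i; have : nbhs x [set y : 'rV[R]_n | `]a ord0 i, b ord0 i[%classic (y ord0 i)].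
    apply: (@coord_continuous _ _ _ ord0 i x); apply: open_nbhs_nbhs; split.
      exact: interval_open.
    by rewrite /= in_itv/=; exact: xab.
  by apply: filterS => y; rewrite /= in_itv.
by [].
Qed.

Lemma oboxI a b c d : obox a b `&` obox c d =
  obox (\row_i Num.max (a ord0 i) (c ord0 i)) (\row_i Num.min (b ord0 i) (d ord0 i)).
Proof.
apply/seteqP; split => [x [h1 h2] i|x h].
  rewrite !mxE gt_max lt_min; have /andP[a1 b1] := h1 i.
  by have /andP[c1 d1] := h2 i; rewrite a1 b1 c1 d1.
by split => i; have := h i; rewrite !mxE gt_max lt_min =>
   /andP[/andP[a1 c1] /andP[b1 d1]]; apply/andP.
Qed.

(** Smooth functions exhausting the indicator function of a box. *)
Definition box_bump a b (k : nat) x : R :=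
  \prod_(i < n) (step (k.+1%:R * (x ord0 i - a ord0 i) - 1) *
                 step (k.+1%:R * (b ord0 i - x ord0 i) - 1)).

Lemma box_bump01 a b k x : 0 <= box_bump a b k x <= 1.
Proof.
apply/andP; split; first by apply: prodr_ge0 => i _; rewrite mulr_ge0// step_ge0.
by apply: prodr_ile1 => i _; rewrite mulr_ge0 ?step_ge0//= mulr_ile1 ?step_ge0 ?step_le1.
Qed.

Lemma smooth_box_bump a b k : smooth_on setT (box_bump a b k).
Proof.
have oT := @openT 'rV[R]_n; apply: smooth_on_prod => // i.
have sc (c : R) := smooth_on_cst oT c; have si := smooth_on_coord oT i.
apply: smooth_onM => //; apply: smooth_on_step => //; apply: smooth_onB => //;
  apply: smooth_onM => //; exact: smooth_onB.
Qed.

Lemma box_bump_supp a b k x :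
  ~ (forall i, `[a ord0 i + k.+1%:R^-1, b ord0 i - k.+1%:R^-1]%classic (x ord0 i)) ->
  box_bump a b k x = 0.
Proof.
move=> /existsNP[i]; rewrite /= in_itv/= => /negP h.
rewrite /box_bump (bigD1 i)//= [X in X * _](_ : _ = 0) ?mul0r//.
have k0 : 0 < k.+1%:R :> R by rewrite ltr0n.
move: h; rewrite negb_and -!ltNge => /orP[] h.
  rewrite step0 ?mul0r// subr_le0 -ler_pdivlMl// mulr1; move: (k.+1%:R^-1) h => z; lra.
rewrite [X in _ * X]step0 ?mulr0// subr_le0 -ler_pdivlMl// mulr1; move: (k.+1%:R^-1) h => z; lra.
Qed.

Lemma box_bump_test a b k : test_function (obox a b) (box_bump a b k).
Proof.
apply: (@test_function_of _ _ _ [set x : 'rV[R]_n | forall i,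
    `[a ord0 i + k.+1%:R^-1, b ord0 i - k.+1%:R^-1]%classic (x ord0 i)]).
- by apply: smooth_onT; exact: smooth_box_bump.
- by apply: (@rV_compact _ _ (fun i => `[a ord0 i + k.+1%:R^-1, b ord0 i - k.+1%:R^-1]%classic))
    => i; exact: segment_compact.
- move=> x /= h i; have k0 : 0 < k.+1%:R^-1 :> R by rewrite invr_gt0.
  have /andP[h1 h2] := h i; rewrite bnd_simp in h1; rewrite bnd_simp in h2.
  by rewrite (lt_le_trans _ h1) ?ltrDl//= (le_lt_trans h2)// ltrBlDr ltrDl.
- by move=> x; exact: box_bump_supp.
Qed.

Lemma box_bump_cvg a b x : box_bump a b ^~ x @ \oo --> (\1_(obox a b) x : R).
Proof.
rewrite indicE; have [xab|xab] := pselect (obox a b x); last first.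
  rewrite memNset//; apply: cvg_near_cst; apply: nearW => k.
  have [_ _ sub] := box_bump_test a b k.
  have [-> //] := test_function_supp (box_bump_test a b k).
rewrite mem_set//; apply: cvg_near_cst.
have h : \forall k \near \oo, forall i : 'I_n,
    2 / (x ord0 i - a ord0 i) <= k.+1%:R /\ 2 / (b ord0 i - x ord0 i) <= k.+1%:R.
  apply: filter_forall => i; near=> k; split; apply: (@le_trans _ _ k%:R);
    rewrite ?ler_nat//; near: k; exact: nbhs_infty_ger.
apply: filterS h => k h.
rewrite /box_bump big1// => i _; have [h1 h2] := h i; have /andP[ax xb] := xab i.
rewrite ler_pdivrMr ?subr_gt0// in h1; rewrite ler_pdivrMr ?subr_gt0// in h2.
by rewrite !step1 ?mulr1//; rewrite lerBrDr.
Unshelve. all: by end_near. Qed.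

Lemma compact_le_bounded_obox a b : exists2 r, 0 <= r & obox a b `<=` cube 0 r.
Proof.
exists (`|a| + `|b|) => [|x h i]; first by rewrite addr_ge0.
have /andP[h1 h2] := h i; rewrite mxE subr0 ler_norml.
have := rV_coord_le a i; have := rV_coord_le b i.
have := normr_ge0 a; have := normr_ge0 b; rewrite !ler_norml; lra.
Qed.

Lemma lebesgue_obox_fin a b : (leb (obox a b) < +oo)%E.
Proof.
have [r r0 sub] := compact_le_bounded_obox a b.
apply: (@le_lt_trans _ _ (leb (cube 0 r))).
  by apply: le_measure => //; rewrite inE; [exact: measurable_obox|exact: measurable_cube].
by have /= -> := lebesgue_cube (0 : 'rV[R]_n) r0; rewrite ltry.
Qed.

Definition boxes : set (set 'rV[R]_n) := [set A | exists a b, A = obox a b].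

Lemma boxesI : setI_closed boxes.
Proof.
by move=> _ _ [a [b ->]] [c [d ->]]; rewrite oboxI; eexists; eexists.
Qed.

(** Together with boxesI: boxes are a pi-system generating the measurable sets. *)
Lemma measurable_boxes : (measurable : set (set 'rV[R]_n)) `<=` <<s boxes >>.
Proof.
apply: smallest_sub; first exact: smallest_sigma_algebra.
rewrite -bigcup_seq => A [i _] /= [B mB <-]; rewrite setTI.
have := mB; rewrite measurable_realfun.RGenOpens.measurableE.
suff : <<s @measurable_realfun.RGenOpens.G R >> `<=`
    [set B | <<s boxes >> ((fun x : 'rV[R]_n => x ord0 i) @^-1` B)].
  by apply.
have [s0 sD sU] : sigma_algebra setT (<<s boxes >>) by exact: smallest_sigma_algebra.
apply: smallest_sub; first split => //=.
- by move=> C; rewrite setTD preimage_setC -setTD; exact: sD.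
- by move=> F mF; rewrite preimage_bigcup; exact: sU.
move=> _ [s [t ->]] /=.
rewrite (_ : _ @^-1` _ = \bigcup_k obox
   (\row_j if j == i then s else - k%:R) (\row_j if j == i then t else k%:R)).
  by apply: sU => k; apply: sub_sigma_algebra; eexists; eexists.
apply/seteqP; split => x /=.
  rewrite in_itv/= => h.
  have [k hk] : exists k : nat, `|x| < k%:R.
    by exists (Num.truncn `|x|).+1; rewrite truncnS_gt.
  exists k => // j; rewrite !mxE; case: eqP => [->//|_].
  by rewrite -ltr_norml; apply: le_lt_trans hk; exact: rV_coord_le.
by move=> [k _ /(_ i)]; rewrite !mxE eqxx in_itv.
Qed.

End boxes.

(** * The fundamental lemma of the calculus of variations *)

Section fundamental_lemma.
Context {R : realType} {n : nat}.
Notation leb := (@lebesgue_rV R n).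

Lemma test_functionS (O O' : set 'rV[R]_n) phi : O `<=` O' ->
  test_function O phi -> test_function O' phi.
Proof. by move=> OO [? ? sub]; split => //; exact: subset_trans OO. Qed.

Lemma indic_bounded (A : set 'rV[R]_n) x : `|\1_A x : R| <= 1.
Proof. by rewrite indicE; case: (x \in A); rewrite ?normr1 ?normr0. Qed.

Section fix_h.
Variables (a b : 'rV[R]_n) (h : 'rV[R]_n -> R).
Let Omega := obox a b.
Hypothesis ih : leb.-integrable Omega (EFin \o h).
Hypothesis h0 : forall phi, test_function Omega phi ->
  \int[leb]_(x in Omega) (h x * phi x) = 0.

Let mO : measurable Omega. Proof. exact: measurable_obox. Qed.
Let mh : measurable_fun Omega h.
Proof. by case/integrableP : ih => /measurable_EFinP. Qed.

Let mul_integrable (f : 'rV[R]_n -> R) : measurable_fun Omega f ->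
  (forall x, `|f x| <= 1) -> leb.-integrable Omega (EFin \o (fun x => h x * f x)).
Proof.
move=> mf f1; apply: le_integrable ih => //.
  by apply/measurable_EFinP; exact: measurable_funM.
by move=> x _ /=; rewrite lee_fin normrM ler_piMr.
Qed.

Let I (A : set 'rV[R]_n) := \int[leb]_(x in Omega) (h x * \1_A x).

Let Icvg (f : (('rV[R]_n -> R))^nat) A : (forall k, measurable_fun Omega (f k)) ->
  (forall k x, `|f k x| <= 1) ->
  (forall x, Omega x -> f ^~ x @ \oo --> (\1_A x : R)) ->
  (fun k => \int[leb]_(x in Omega) (h x * f k x)) @ \oo --> I A.
Proof.
move=> mf f1 cf; have [||||_] := @Rdominated _ _ _ leb Omega
  (fun k x => h x * f k x) (fun x => h x * \1_A x) (fun x => `|h x|) mO; last by [].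
- by move=> k; exact: measurable_funM.
- by move=> x Ox; apply: cvgM; [exact: cvg_cst|exact: cf].
- exact: integrable_abse ih.
- by move=> k x _; rewrite normrM ler_piMr.
Qed.

Let I_box c d : I (obox c d `&` Omega) = 0.
Proof.
rewrite oboxI; set c' := (X in obox X _); set d' := (X in obox _ X).
have sub : obox c' d' `<=` Omega by rewrite -oboxI; exact: subIsetr.
have := @Icvg (box_bump c' d') (obox c' d').
set F := (X in X @ \oo --> _); move=> cv.
have F0 : F = fun=> 0.
  apply/funext => k; apply: h0; exact: test_functionS sub (box_bump_test _ _ _).
have {}cv : F @ \oo --> I (obox c' d').
  apply: cv.
  - by move=> k; exact: test_measurable (box_bump_test c' d' k).
  - by move=> k x; have /andP[p1 p2] := box_bump01 c' d' k x; rewrite ger0_norm.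
  - by move=> x _; exact: box_bump_cvg.
have : F @ \oo --> (0 : R) by rewrite F0; exact: cvg_cst.
by move/(cvg_unique (@Rhausdorff R) cv).
Qed.

Let I_in A B : (forall x, Omega x -> A x <-> B x) -> I A = I B.
Proof.
move=> AB; apply: eq_Rintegral => x; rewrite inE => /AB ABx.
rewrite !indicE; congr (_ * _%:R); congr nat_of_bool.
by apply/idP/idP; rewrite !inE => /ABx.
Qed.

Let measurable_indic_O A : measurable A -> measurable_fun Omega (\1_A : 'rV[R]_n -> R).
Proof. by move=> mA; apply: measurable_indic. Qed.

Let I_measurable A : measurable A -> I A = 0.
Proof.
move=> /measurable_boxes.
pose H := [set A : set 'rV[R]_n | measurable A /\ I A = 0].
suff : <<s boxes >> `<=` H by move=> sub /sub[].
apply: (@lambda_system_subset _ _ (@boxesI R n) setT) => //.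
- split => //.
  + split; first exact: measurableT.
    by rewrite -(I_box a b); apply: I_in => x Ox; split.
  + move=> C B BA [mA A0] [mB B0]; split; first exact: measurableD.
    have -> : 0 = I C - I B by rewrite A0 B0 subrr.
    rewrite /I -RintegralB//.
    * apply: eq_Rintegral => x _; rewrite -mulrBr; congr (_ * _).
      rewrite !indicE in_setD.
      case: (boolP (x \in B)); case: (boolP (x \in C)); rewrite ?subrr ?subr0//=.
      by move=> /negP + xB; rewrite inE in xB; rewrite inE => /(_ (BA _ xB)).
    * by apply: mul_integrable => [|x]; [exact: measurable_indic_O|exact: indic_bounded].
    * by apply: mul_integrable => [|x]; [exact: measurable_indic_O|exact: indic_bounded].
  + move=> F ndF HF; have mF k : measurable (F k) by case: (HF k).
    split; first exact: bigcupT_measurable.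
    have cv : (fun k => I (F k)) @ \oo --> I (\bigcup_k F k).
      apply: Icvg => [k|k x|x _]; [exact: measurable_indic_O|exact: indic_bounded|].
      apply: cvg_near_cst; have [[k _ Fkx]|nF] := pselect ((\bigcup_k F k) x).
        exists k => // m /= km; rewrite !indicE !mem_set//; first by exists k.
        by have /subsetPset := ndF _ _ km; apply.
      apply: nearW => k; rewrite !indicE !memNset// => Fkx; apply: nF; by exists k.
    have : (fun k => I (F k)) @ \oo --> (0 : R).
      by rewrite (_ : (fun k => _) = fun=> 0); [exact: cvg_cst|apply/funext => k; case: (HF k)].
    by move/(cvg_unique (@Rhausdorff R) cv).
- move=> _ [c [d ->]]; split; first exact: measurable_obox.
  by rewrite -(I_box c d); apply: I_in => x Ox; split=> [|[]].
Qed.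

(** The integral of h over a box is the limit of its integrals against bumps, so
    it vanishes; by a monotone class argument the same holds for all measurable
    sets, in particular for the set where h is nonnegative and its complement. *)
Lemma fundamental_lemma : {ae leb, forall x, Omega x -> h x = 0}.
Proof.
pose A := Omega `&` [set x | 0 <= h x].
have mA : measurable A.
  have := mh mO (measurable_itv `[0, +oo[); congr measurable.
  by apply/seteqP; split => x [Ox hx]; split => //; move: hx; rewrite /= in_itv/= ?andbT.
have mAC : measurable (~` A) by exact: measurableC.
have abs0 : \int[leb]_(x in Omega) `|h x| = 0.
  have -> : 0 = I A - I (~` A) by rewrite !I_measurable// subrr.
  rewrite /I -RintegralB//.
  - apply: eq_Rintegral => x; rewrite inE => Ox; rewrite -mulrBr !indicE in_setC.
    case: (boolP (x \in A)) => /=.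
      by rewrite inE => -[_ /= hx]; rewrite subr0 mulr1 ger0_norm.
    move=> /negP; rewrite inE => xA; rewrite sub0r mulrN1 ltr0_norm//.
    by rewrite ltNge; apply/negP => hx; apply: xA.
  - by apply: mul_integrable => [|x]; [exact: measurable_indic_O|exact: indic_bounded].
  - by apply: mul_integrable => [|x]; [exact: measurable_indic_O|exact: indic_bounded].
have /(ae_eq_integral_abs leb mO) : (\int[leb]_(x in Omega) `|(EFin \o h) x| = 0)%E.
  rewrite -[LHS]fineK; first by rewrite -[RHS]/(0%:E) -abs0.
  apply: integrable_fin_num => //; exact: integrable_abse ih.
move=> /(_ _)/wrap[]; first exact/measurable_EFinP.
by apply: filterS => x /= hx Ox; have := hx Ox; case.
Qed.

End fix_h.
End fundamental_lemma.

(** * Functions with a vanishing weak partial derivative *)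

Section constancy.
Context {R : realType} {n : nat}.
Notation leb := (@lebesgue_rV R n).

Implicit Types (c d x : 'rV[R]_n).

Lemma partial_indep (f : 'rV[R]_n -> R) i x :
  (forall h : R, f (h *: basis_vec i + x) = f x) -> partial i f x = 0.
Proof.
move=> fh; rewrite /partial (@derive_along _ _ _ f (fun _ : R => f x) x (basis_vec i) 0 1 _).1//.
exact: derive_cst.
Qed.

(** A smooth bump in the cube of side e with lower corner c. As a product of
    derivatives of steps, it differs from a translate in a coordinate direction by
    a multiple of the derivative of a test function in this direction
    (partial_phi). *)
Definition corner_bump (e : R) (c x : 'rV[R]_n) : R :=
  \prod_(j < n) dstep ((x ord0 j - c ord0 j) / e).

Section fix_e.
Variables (e : R) (e0 : 0 < e).

Lemma corner_bump_ge0 c x : 0 <= corner_bump e c x.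
Proof. by apply: prodr_ge0 => j _; exact: dstep_ge0. Qed.

Lemma corner_bump_gt0 c x : (forall j, c ord0 j < x ord0 j < c ord0 j + e) ->
  0 < corner_bump e c x.
Proof.
move=> cx; apply: prodr_gt0 => j _; have /andP[h1 h2] := cx j; apply: dstep_gt0.
  by rewrite divr_gt0// subr_gt0.
by rewrite ltr_pdivrMr// mul1r ltrBlDl.
Qed.

Lemma corner_bump_supp c x :
  ~ (forall j, `[c ord0 j, c ord0 j + e]%classic (x ord0 j)) -> corner_bump e c x = 0.
Proof.
move=> /existsNP[j]; rewrite /= in_itv/= => /negP h.
rewrite /corner_bump (bigD1 j)//= dstep0 ?mul0r//.
move: h; rewrite negb_and -!ltNge => /orP[] h; [left|right].
  by rewrite pmulr_lle0 ?invr_gt0// subr_le0 ltW.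
by rewrite ler_pdivlMr// mul1r lerBrDl ltW.
Qed.

Let oT := @openT 'rV[R]_n.

Lemma smooth_corner_coord (c : 'rV[R]_n) j :
  smooth_on setT (fun x : 'rV[R]_n => (x ord0 j - c ord0 j) / e).
Proof.
apply: smooth_onM => //; last exact: smooth_on_cst.
by apply: smooth_onB => //; [exact: smooth_on_coord|exact: smooth_on_cst].
Qed.

Lemma smooth_corner_bump c : smooth_on setT (corner_bump e c).
Proof.
by apply: smooth_on_prod => // j; apply: smooth_on_dstep => //; exact: smooth_corner_coord.
Qed.

Lemma partial_corner_coord (c : 'rV[R]_n) i x :
  partial i (fun x : 'rV[R]_n => (x ord0 i - c ord0 i) / e) x = e^-1.
Proof.
have [d1 e1] := derive_coord i i x; have dc := derivable_cst (c ord0 i) x (basis_vec i).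
have d2 : derivable (fun x : 'rV[R]_n => x ord0 i - c ord0 i) x (basis_vec i).
  exact: (derivableB d1 dc).
have e2 : partial i (fun x : 'rV[R]_n => x ord0 i - c ord0 i) x = 1.
  rewrite /partial (deriveB d1 dc) [X in X - _]e1 eqxx.
  by rewrite (_ : 'D_(basis_vec i) _ x = 0) ?subr0//; exact: derive_cst.
rewrite (partialM d2 (derivable_cst e^-1 x (basis_vec i))).2 e2 mulr1.
by rewrite /partial derive_cst mulr0 add0r.
Qed.

(* difference of two steps in direction i, localised in the other directions *)
Let phi (c d : 'rV[R]_n) i x :=
  (step ((x ord0 i - c ord0 i) / e) - step ((x ord0 i - d ord0 i) / e)) *
  \prod_(j < n | j != i) dstep ((x ord0 j - c ord0 j) / e).

Let smooth_phi c d i : smooth_on setT (phi c d i).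
Proof.
apply: smooth_onM => //.
  by apply: smooth_onB => //; apply: smooth_on_step => //; exact: smooth_corner_coord.
rewrite (_ : (fun x => _) = (fun x : 'rV[R]_n =>
    \prod_(j <- enum [pred j | j != i]) dstep ((x ord0 j - c ord0 j) / e))).
  apply: smooth_on_prod => // j; apply: smooth_on_dstep => //.
  exact: smooth_corner_coord.
by apply/funext => x; rewrite big_enum.
Qed.

Lemma partial_phi c d i : (forall j, j != i -> c ord0 j = d ord0 j) -> forall x,
  partial i (phi c d i) x = e^-1 * (corner_bump e c x - corner_bump e d x).
Proof.
move=> cd x; set P := fun x : 'rV[R]_n =>
  \prod_(j < n | j != i) dstep ((x ord0 j - c ord0 j) / e).
have sP : smooth_on setT P.
  rewrite (_ : P = (fun x : 'rV[R]_n =>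
    \prod_(j <- enum [pred j | j != i]) dstep ((x ord0 j - c ord0 j) / e))).
    apply: smooth_on_prod => // j; apply: smooth_on_dstep => //.
    exact: smooth_corner_coord.
  by apply/funext => y; rewrite big_enum.
have s1 c' : smooth_on setT (fun x : 'rV[R]_n => step ((x ord0 i - c' ord0 i) / e)).
  by apply: smooth_on_step => //; exact: smooth_corner_coord.
have s2 : smooth_on setT (fun x : 'rV[R]_n => step ((x ord0 i - c ord0 i) / e) -
    step ((x ord0 i - d ord0 i) / e)) by exact: smooth_onB.
rewrite (partialM (smooth_on_derivable s2 I) (smooth_on_derivable sP I)).2.
have -> : partial i P x = 0.
  apply: partial_indep => h; apply: eq_bigr => j ji.
  by rewrite !mxE eqxx/= (negbTE ji) mulr0 add0r.
rewrite mulr0 add0r {1}/partial deriveB; try exact: smooth_on_derivable (s1 _) I.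
have E c' : 'D_(basis_vec i) (fun x : 'rV[R]_n => step ((x ord0 i - c' ord0 i) / e)) x =
    dstep ((x ord0 i - c' ord0 i) / e) * e^-1.
  by rewrite -[LHS]/(partial i _ x) (partial_step (smooth_corner_coord c' i))//
    partial_corner_coord.
rewrite !E -mulrBl mulrA mulrC; congr (_ * _).
rewrite /corner_bump (bigD1 i)//= [in X in _ = _ - X](bigD1 i)//= mulrBr.
rewrite mulrC; congr (_ - _); rewrite mulrC; congr (_ * _).
by apply: eq_bigr => j ji; rewrite cd.
Qed.

Lemma phi_test c d i (Omega : set 'rV[R]_n) :
  (forall j, j != i -> c ord0 j = d ord0 j) ->
  (forall x : 'rV[R]_n, (forall j, `[Num.min (c ord0 j) (d ord0 j),
    Num.max (c ord0 j) (d ord0 j) + e]%classic (x ord0 j)) -> Omega x) ->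
  test_function Omega (phi c d i).
Proof.
move=> cd sub; apply: (@test_function_of _ _ _ [set x : 'rV[R]_n | forall j,
  `[Num.min (c ord0 j) (d ord0 j), Num.max (c ord0 j) (d ord0 j) + e]%classic (x ord0 j)]) => //.
- exact: smooth_onT.
- by apply: (@rV_compact _ _ (fun j => `[Num.min (c ord0 j) (d ord0 j),
    Num.max (c ord0 j) (d ord0 j) + e]%classic)) => j; exact: segment_compact.
move=> x /existsNP[j]; rewrite /= in_itv/= => /negP h; rewrite /phi.
have [ji|ji] := eqVneq j i.
  rewrite -ji; move: h; rewrite negb_and -!ltNge => /orP[].
    rewrite lt_min => /andP[h1 h2].
    by rewrite !step0 ?subrr ?mul0r// pmulr_lle0 ?invr_gt0// subr_le0 ltW.
  move=> h; have [h1 h2] : c ord0 j + e < x ord0 j /\ d ord0 j + e < x ord0 j.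
    by split; apply: le_lt_trans h; rewrite lerD2r le_max lexx ?orbT.
  by rewrite !step1 ?subrr ?mul0r// ler_pdivlMr// mul1r lerBrDl ltW.
rewrite (bigD1 j)//= dstep0 ?mul0r ?mulr0//.
move: h; rewrite -(cd j ji) minxx maxxx negb_and -!ltNge => /orP[] h; [left|right].
  by rewrite pmulr_lle0 ?invr_gt0// subr_le0 ltW.
by rewrite ler_pdivlMr// mul1r lerBrDl ltW.
Qed.

Lemma corner_bump_test c (Omega : set 'rV[R]_n) :
  (forall x : 'rV[R]_n, (forall j, `[c ord0 j, c ord0 j + e]%classic (x ord0 j)) -> Omega x) ->
  test_function Omega (corner_bump e c).
Proof.
move=> sub; apply: (@test_function_of _ _ _ [set x : 'rV[R]_n | forall j,
  `[c ord0 j, c ord0 j + e]%classic (x ord0 j)]) => //.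
- exact/smooth_onT/smooth_corner_bump.
- by apply: (@rV_compact _ _ (fun j => `[c ord0 j, c ord0 j + e]%classic)) => j;
    exact: segment_compact.
- exact: corner_bump_supp.
Qed.

Let divided_difference_eq0 (u v : R) : e^-1 * (u - v) = 0 -> u = v.
Proof. by move=> /eqP; rewrite mulf_eq0 invr_eq0 (gt_eqF e0) subr_eq0 => /eqP. Qed.

Lemma phi_partialE (a b : 'rV[R]_n) (z : 'rV[R]_n -> R) c d i :
  (forall j, j != i -> c ord0 j = d ord0 j) ->
  (forall x : 'rV[R]_n, (forall j, `[Num.min (c ord0 j) (d ord0 j),
    Num.max (c ord0 j) (d ord0 j) + e]%classic (x ord0 j)) -> obox a b x) ->
  leb.-integrable (obox a b) (EFin \o z) ->
  (forall phi, test_function (obox a b) phi ->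
    \int[leb]_(x in obox a b) (z x * partial i phi x) = 0) ->
  \int[leb]_(x in obox a b) (z x * corner_bump e c x) =
  \int[leb]_(x in obox a b) (z x * corner_bump e d x).
Proof.
move=> cd sub iz z0; have tphi := phi_test cd sub.
have mO := measurable_obox a b.
have ib c' : (forall x : 'rV[R]_n, (forall j, `[c' ord0 j, c' ord0 j + e]%classic (x ord0 j)) -> obox a b x) ->
    leb.-integrable (obox a b) (EFin \o (fun x => z x * corner_bump e c' x)).
  move=> sub'; have tc := corner_bump_test sub'.
  have [M M0 hM] := test_bounded tc.
  have mz : measurable_fun (obox a b) z by case/integrableP : iz => /measurable_EFinP.
  apply: (@le_integrable _ _ _ _ _ mO _ (EFin \o (fun x => M * z x))).
  - by apply/measurable_EFinP; apply: measurable_funM => //; exact: test_measurable tc.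
  - by move=> x _ /=; rewrite lee_fin !normrM (ger0_norm M0) mulrC ler_wpM2r.
  - have := @integrableZl _ _ _ leb _ mO M _ iz; congr (integrable _ _ _).
have := z0 _ tphi.
under eq_Rintegral do rewrite (partial_phi cd) mulrCA mulrBr.
have i1 : leb.-integrable (obox a b) (EFin \o (fun x => z x * corner_bump e c x)).
  apply: ib => x hx; apply: sub => j; have := hx j; rewrite /= !in_itv/= ge_min.
  move=> /andP[-> h]; apply: (le_trans h); by rewrite lerD2r le_max lexx.
have i2 : leb.-integrable (obox a b) (EFin \o (fun x => z x * corner_bump e d x)).
  apply: ib => x hx; apply: sub => j; have := hx j; rewrite /= !in_itv/= ge_min.
  move=> /andP[-> h]; rewrite orbT; apply: (le_trans h); by rewrite lerD2r le_max lexx orbT.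
rewrite (RintegralZl e^-1 mO (integrableB mO i1 i2)) (RintegralB mO i1 i2).
exact: divided_difference_eq0.
Qed.

Lemma corner_bump_mass a b c :
  (forall x : 'rV[R]_n, (forall j, `[c ord0 j, c ord0 j + e]%classic (x ord0 j)) ->
    obox a b x) ->
  0 < \int[leb]_(x in obox a b) corner_bump e c x.
Proof.
move=> sub; have mO := measurable_obox a b; have tc := corner_bump_test sub.
rewrite lt_neqAle Rintegral_ge0 ?andbT; last by move=> x _; exact: corner_bump_ge0.
apply/eqP => /esym m0.
have mb : measurable_fun (obox a b) (corner_bump e c) by exact: test_measurable tc.
have [M M0 hM] := test_bounded tc.
have ib : leb.-integrable (obox a b) (EFin \o corner_bump e c).
  apply: measurable_bounded_integrable => //; first exact: lebesgue_obox_fin.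
  by exists M; split; [exact: num_real|move=> y My x _; exact: le_trans (hM x) (ltW My)].
have /(ae_eq_integral_abs leb mO) : (\int[leb]_(x in obox a b) `|(EFin \o corner_bump e c) x| = 0)%E.
  rewrite -[LHS]fineK; last first.
    by apply: integrable_fin_num => //; exact: integrable_abse ib.
  congr EFin; rewrite -[RHS]m0; apply: eq_Rintegral => x _.
  by rewrite ger0_norm// corner_bump_ge0.
move=> /(_ _)/wrap[]; first exact/measurable_EFinP.
move=> [N [mN N0 sN]].
pose C := obox c (\row_j (c ord0 j + e)).
have : (leb C <= leb N)%E.
  apply: le_measure; rewrite ?inE//; first exact: measurable_obox.
  move=> x Cx; apply: sN => /= /(_ _)/wrap[].
    apply: sub => j; have /andP[h1] := Cx j; rewrite mxE => h2.
    by rewrite /= in_itv/= !ltW.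
  move=> [E0]; have : 0 < corner_bump e c x.
    by apply: corner_bump_gt0 => j; have := Cx j; rewrite mxE.
  by rewrite E0 ltxx.
rewrite N0 leNgt => /negP; apply.
rewrite /C oboxE (@lebesgue_rV_prod _ _ (fun i => `]c ord0 i,
  (\row_j (c ord0 j + e)) ord0 i[%classic)); last by move=> i; exact: measurable_itv.
rewrite (eq_bigr (fun=> e%:E)); last first.
  by move=> i _; rewrite lebesgue_measure_itv/= mxE lte_fin ltrDl e0 -EFinD addrAC subrr add0r.
by rewrite prodEFin big_const_ord iter_mulr_1 lte_fin exprn_gt0.
Qed.

Lemma corner_bump_average a b (z : 'rV[R]_n -> R) c (eta : R) :
  (forall x : 'rV[R]_n, (forall j, `[c ord0 j, c ord0 j + e]%classic (x ord0 j)) ->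
    obox a b x /\ `|z x - z c| <= eta) ->
  leb.-integrable (obox a b) (EFin \o z) ->
  `|\int[leb]_(x in obox a b) (z x * corner_bump e c x) -
    z c * \int[leb]_(x in obox a b) corner_bump e c x| <=
  eta * \int[leb]_(x in obox a b) corner_bump e c x.
Proof.
move=> sub iz; have mO := measurable_obox a b.
have tc := @corner_bump_test c (obox a b) (fun x h => (sub x h).1).
have [M M0 hM] := test_bounded tc.
have mb : measurable_fun (obox a b) (corner_bump e c) by exact: test_measurable tc.
have mz : measurable_fun (obox a b) z by case/integrableP : iz => /measurable_EFinP.
have ib : leb.-integrable (obox a b) (EFin \o corner_bump e c).
  apply: measurable_bounded_integrable => //; first exact: lebesgue_obox_fin.
  by exists M; split; [exact: num_real|move=> y My x _; exact: le_trans (hM x) (ltW My)].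
have izb : leb.-integrable (obox a b) (EFin \o (fun x => z x * corner_bump e c x)).
  apply: (@le_integrable _ _ _ _ _ mO _ (EFin \o (fun x => M * z x))).
  - by apply/measurable_EFinP; exact: measurable_funM.
  - by move=> x _ /=; rewrite lee_fin !normrM (ger0_norm M0) mulrC ler_wpM2r.
  - have := @integrableZl _ _ _ leb _ mO M _ iz; congr (integrable _ _ _).
have icb k : leb.-integrable (obox a b) (EFin \o (fun x => k * corner_bump e c x)).
  have := @integrableZl _ _ _ leb _ mO k _ ib; congr (integrable _ _ _).
rewrite -!RintegralZl// -RintegralB//.
apply: le_trans (le_normr_Rintegral mO _) _; first exact: (integrableB mO izb (icb _)).
apply: le_Rintegral => //; first exact: integrable_abse (integrableB mO izb (icb _)).
move=> x _; rewrite -mulrBl normrM (ger0_norm (corner_bump_ge0 _ _)).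
have [h|h] := pselect (forall j, `[c ord0 j, c ord0 j + e]%classic (x ord0 j)).
  by rewrite ler_wpM2r ?corner_bump_ge0//; exact: (sub x h).2.
by rewrite corner_bump_supp// !mulr0.
Qed.

End fix_e.

(** A continuous function on a box whose weak derivative in one coordinate
    direction vanishes is constant along segments in that direction: test with
    the difference of two steps, whose derivative is the difference of two
    small bumps of equal mass. *)
Lemma weak_constant a b (z : 'rV[R]_n -> R) c d i :
  obox a b c -> obox a b d -> (forall j, j != i -> c ord0 j = d ord0 j) ->
  leb.-integrable (obox a b) (EFin \o z) ->
  {for c, continuous z} -> {for d, continuous z} ->
  (forall phi, test_function (obox a b) phi ->
    \int[leb]_(x in obox a b) (z x * partial i phi x) = 0) ->
  z c = z d.
Proof.
move=> Oc Od cd iz cc cdd z0.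
apply/eqP; rewrite -subr_eq0 -normr_le0; apply/ler_addgt0Pr => eta eta0.
rewrite add0r.
pose m : 'rV[R]_n := \row_j Num.max (c ord0 j) (d ord0 j).
have Om : obox a b m.
  move=> j; rewrite mxE lt_max gt_max.
  by have /andP[-> ->] := Oc j; have /andP[_ ->] := Od j.
have eta2 : 0 < eta / 2 by rewrite divr_gt0.
have [e1 /= e10 h1] : exists2 e1 : R, 0 < e1 &
    forall x, (forall j, `|c ord0 j - x ord0 j| < e1) -> `|z x - z c| <= eta / 2.
  have /nbhs_ballP[e1 e10 h1] : nbhs c [set x | `|z c - z x| <= eta / 2].
    by move/cvgrPdist_le : cc => /(_ _ eta2).
  exists e1 => // x xc; rewrite distrC; apply: h1; rewrite mx_norm_ball /ball_/=.
  by apply/rV_norm_lt => // j; rewrite !mxE.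
have [e2 /= e20 h2] : exists2 e1 : R, 0 < e1 &
    forall x, (forall j, `|d ord0 j - x ord0 j| < e1) -> `|z x - z d| <= eta / 2.
  have /nbhs_ballP[e2 e20 h2] : nbhs d [set x | `|z d - z x| <= eta / 2].
    by move/cvgrPdist_le : cdd => /(_ _ eta2).
  exists e2 => // x xc; rewrite distrC; apply: h2; rewrite mx_norm_ball /ball_/=.
  by apply/rV_norm_lt => // j; rewrite !mxE.
have [e3 /= e30 h3] : exists2 e3 : R, 0 < e3 &
    forall x : 'rV[R]_n, (forall j, `|m ord0 j - x ord0 j| < e3) -> obox a b x.
  have /nbhs_ballP[e3 e30 h3] := open_nbhs_nbhs (conj (@open_obox R n a b) Om).
  exists e3 => // x xc; apply: h3; rewrite mx_norm_ball /ball_/=.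
  by apply/rV_norm_lt => // j; have := xc j; rewrite !mxE.
pose e := Num.min e1 (Num.min e2 e3) / 2.
have e0 : 0 < e by rewrite divr_gt0// !lt_min e10 e20 e30.
have [ee1 ee2 ee3] : [/\ e < e1, e < e2 & e < e3].
  have : e < Num.min e1 (Num.min e2 e3).
    by rewrite /e ltr_pdivrMr// ltr_pMr ?ltr1n// !lt_min e10 e20 e30.
  by rewrite !lt_min => /and3P[].
have me j : m ord0 j + e < b ord0 j.
  have /(_ j)/andP[_] : obox a b (\row_j (m ord0 j + e)).
    by apply: h3 => k; rewrite [X in _ - X]mxE opprD addrA subrr add0r normrN gtr0_norm.
  by rewrite mxE.
have sub (x : 'rV[R]_n) : (forall j, `[Num.min (c ord0 j) (d ord0 j),
    Num.max (c ord0 j) (d ord0 j) + e]%classic (x ord0 j)) -> obox a b x.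
  move=> hx j; have := hx j; rewrite /= in_itv/= => /andP[x1 x2]; apply/andP; split.
    apply: lt_le_trans x1; rewrite lt_min.
    by have /andP[-> _] := Oc j; have /andP[-> _] := Od j.
  by apply: le_lt_trans x2 _; have := me j; rewrite mxE.
have subc (x : 'rV[R]_n) : (forall j, `[c ord0 j, c ord0 j + e]%classic (x ord0 j)) ->
    obox a b x /\ `|z x - z c| <= eta / 2.
  move=> hx; split.
    apply: sub => j; have := hx j; rewrite /= !in_itv/= ge_min => /andP[-> h].
    by apply: (le_trans h); rewrite lerD2r le_max lexx.
  apply: h1 => j; have := hx j; rewrite /= in_itv/= => /andP[x1 x2].
  by apply: le_lt_trans ee1; rewrite ler_norml; apply/andP; split; lra.
have subd (x : 'rV[R]_n) : (forall j, `[d ord0 j, d ord0 j + e]%classic (x ord0 j)) ->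
    obox a b x /\ `|z x - z d| <= eta / 2.
  move=> hx; split.
    apply: sub => j; have := hx j; rewrite /= !in_itv/= ge_min => /andP[-> h].
    by rewrite orbT; apply: (le_trans h); rewrite lerD2r le_max lexx orbT.
  apply: h2 => j; have := hx j; rewrite /= in_itv/= => /andP[x1 x2].
  by apply: le_lt_trans ee2; rewrite ler_norml; apply/andP; split; lra.
have M0 := corner_bump_mass e0 (fun x h => (subc x h).1).
have zz := phi_partialE e0 cd sub iz z0.
have MM : \int[leb]_(x in obox a b) corner_bump e c x =
          \int[leb]_(x in obox a b) corner_bump e d x.
  have := phi_partialE e0 cd sub (z := fun=> 1).
  under eq_Rintegral do rewrite mul1r.
  under [X in _ -> _ -> _ = X]eq_Rintegral do rewrite mul1r.
  apply.
    apply: measurable_bounded_integrable.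
    - exact: measurable_obox.
    - exact: lebesgue_obox_fin.
    - exact: measurable_cst.
    by exists 1; split; [exact: num_real|move=> y /ltW y1 x _; rewrite /= normr1].
  move=> phi tphi; rewrite (integral_partial_test _ (@open_obox R n a b) tphi); last first.
    by apply: smooth_on_cst; exact: openT.
  under eq_Rintegral do rewrite /partial derive_cst mul0r.
  by rewrite (Rintegral_cst _ (measurable_obox a b) 0) mul0r oppr0.
have A1 := corner_bump_average e0 subc iz; have A2 := corner_bump_average e0 subd iz.
rewrite -zz -MM in A2.
move: A1 A2 M0; set J := \int[_]_(x in _) (_ * _); set M := \int[_]_(x in _) _.
move=> A1 A2 M0; rewrite -(ler_pM2r M0) -{1}(gtr0_norm M0) -normrM.
have -> : (z c - z d) * M = (J - z d * M) - (J - z c * M) by ring.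
apply: le_trans (ler_normB _ _) _; apply: le_trans (lerD A2 A1) _.
by rewrite -mulrDl -splitr.
Qed.

End constancy.

(** * Essentially bounded functions and the convexity of the integrand *)

Section essentially_bounded.
Context d (T : measurableType d) (R : realType) (mu : {measure set T -> \bar R}).
Variables (D : set T) (mD : measurable D).

Lemma ae_bounded_mul_integrable (f g : T -> R) M : 0 <= M ->
  mu.-integrable D (EFin \o f) -> measurable_fun D g ->
  {ae mu, forall x, D x -> `|g x| <= M} ->
  mu.-integrable D (EFin \o (fun x => f x * g x)).
Proof.
move=> M0 intf mg gM; have mf : measurable_fun D f.
  by case/integrableP : intf => /measurable_EFinP.
apply/integrableP; split; first by apply/measurable_EFinP; exact: measurable_funM.
have : mu.-integrable D (EFin \o (fun x => M * f x)).
  by have := @integrableZl _ _ _ mu _ mD M _ intf; congr (integrable _ _ _).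
move=> /integrableP[_]; apply: le_lt_trans; apply: ae_ge0_le_integral => //.
- by apply: measurableT_comp => //; apply/measurable_EFinP; exact: measurable_funM.
- by apply: measurableT_comp => //; apply/measurable_EFinP; exact: measurable_funM.
apply: filterS gM => x gM Dx /=.
by rewrite lee_fin !normrM mulrC ler_wpM2r// (ger0_norm M0) gM.
Qed.

Lemma ae_bounded_integrable (g : T -> R) M : (mu D < +oo)%E -> 0 <= M ->
  measurable_fun D g -> {ae mu, forall x, D x -> `|g x| <= M} ->
  mu.-integrable D (EFin \o g).
Proof.
move=> Dfin M0 mg gM.
have i1 : mu.-integrable D (EFin \o (fun=> 1 : R)).
  apply: measurable_bounded_integrable => //.
  by exists 1; split; [exact: num_real|move=> y /ltW y1 x _; rewrite /= normr1].
have := ae_bounded_mul_integrable M0 i1 mg gM.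
by congr (integrable _ _ _); apply/funext => x /=; rewrite mul1r.
Qed.

Lemma ge0_Rintegral_eq0 (f : T -> R) : mu.-integrable D (EFin \o f) ->
  {ae mu, forall x, D x -> 0 <= f x} -> 0 <= \int[mu]_(x in D) f x /\
  (\int[mu]_(x in D) f x <= 0 -> {ae mu, forall x, D x -> f x = 0}).
Proof.
move=> intf f0.
have mf : measurable_fun D (EFin \o f) by case/integrableP : intf.
have E : (\int[mu]_(x in D) (f x)%:E = \int[mu]_(x in D) `|(f x)%:E|)%E.
  apply: ae_eq_integral => //; first exact: measurableT_comp.
  by apply: filterS f0 => x f0 Dx /=; rewrite ger0_norm ?f0.
have I0 : (0 <= \int[mu]_(x in D) (f x)%:E)%E by rewrite E; exact: integral_ge0.
split; first exact: fine_ge0.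
move=> h; have : (\int[mu]_(x in D) `|(EFin \o f) x| = 0)%E.
  rewrite -[LHS]/(\int[mu]_(x in D) `|(f x)%:E|)%E -E.
  rewrite -[LHS]fineK; last exact: (integrable_fin_num mD intf).
  by congr EFin; apply/eqP; rewrite eq_le h fine_ge0.
move/(ae_eq_integral_abs mu mD mf); apply: filterS => x h' Dx.
by have [] := h' Dx.
Qed.

End essentially_bounded.

Section Lp.
Context {R : realType} {n : nat}.
Notation leb := (@lebesgue_rV R n).

Lemma lebesgue_rV_setT_gt0 : (0 < leb [set: 'rV[R]_n])%E.
Proof.
apply: (@lt_le_trans _ _ (leb (cube 0 1))).
  by have /= -> := lebesgue_cube (0 : 'rV[R]_n) (@ler01 R); rewrite lte_fin exprn_gt0// mulr1.
by apply: le_measure; rewrite ?inE//; exact: measurable_cube.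
Qed.

Lemma Lnorm_oo (f : 'rV[R]_n -> R) M :
  ('N[leb]_+oo[EFin \o f] <= M%:E)%E <-> {ae leb, forall x, `|f x| <= M}.
Proof.
rewrite unlock /= lebesgue_rV_setT_gt0; split => [/ess_supP|h].
  by apply: filterS => x; rewrite lee_fin.
by apply/ess_supP; apply: filterS h => x; rewrite lee_fin.
Qed.

Lemma in_LooP (O : set 'rV[R]_n) (f : 'rV[R]_n -> R) :
  in_Lp O +oo%E f <-> measurable_fun O f /\
    exists2 M, 0 <= M & {ae leb, forall x, O x -> `|f x| <= M}.
Proof.
split => -[mf h]; split => //.
  have N0 : (0 <= 'N[leb]_+oo[EFin \o (f \_ O)])%E by exact: Lnorm_ge0.
  exists (fine 'N[leb]_+oo[EFin \o (f \_ O)]); first exact: fine_ge0.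
  have : ('N[leb]_+oo[EFin \o (f \_ O)] <= (fine 'N[leb]_+oo[EFin \o (f \_ O)])%:E)%E.
    by rewrite fineK// ge0_fin_numE.
  by move/Lnorm_oo; apply: filterS => x + Ox; rewrite patchE mem_set.
have [M M0 hM] := h; rewrite /finite_norm; apply: (@le_lt_trans _ _ M%:E).
  apply/Lnorm_oo; apply: filterS hM => x hM; rewrite patchE.
  by case: ifPn => [|_]; [rewrite inE|rewrite normr0].
exact: ltry.
Qed.

Lemma in_L1P (O : set 'rV[R]_n) (f : 'rV[R]_n -> R) : measurable O ->
  in_Lp O 1%E f <-> leb.-integrable O (EFin \o f).
Proof.
move=> mO.
have E : ('N[leb]_1[EFin \o (f \_ O)] = \int[leb]_(x in O) `|(EFin \o f) x|)%E.
  rewrite Lnorm1 [RHS]integral_mkcond; apply: eq_integral => x _.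
  by rewrite /= !patchE; case: ifPn; rewrite ?normr0.
split=> [[mf h]|/integrableP[/measurable_EFinP mf h]].
  by apply/integrableP; split; [exact/measurable_EFinP|rewrite -E].
by split => //; rewrite /finite_norm E.
Qed.

End Lp.

Section convexity.
Context {R : realType} {n : nat}.
Implicit Types p q v : 'rV[R]_n.

Lemma enorm_sqr p : enorm p ^+ 2 = \sum_i p ord0 i ^+ 2.
Proof. by rewrite sqr_sqrtr// sumr_ge0// => i _; exact: sqr_ge0. Qed.

Lemma enorm_ge0 p : 0 <= enorm p. Proof. exact: sqrtr_ge0. Qed.

(** Uniform convexity of p |-> 1 - sqrt (1 - |p|^2) on the closed unit ball:
    with a, b the square roots at p and q, the identity
    1 - <p, q> - a b = (|p - q|^2 + (a - b)^2) / 2 replaces Cauchy-Schwarz. *)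
Lemma lorentz_convex p q v : enorm p <= 1 -> enorm q < 1 ->
  (forall i, v ord0 i * Num.sqrt (1 - enorm q ^+ 2) = q ord0 i) ->
  2^-1 * \sum_i (p ord0 i - q ord0 i) ^+ 2 <=
  (1 - Num.sqrt (1 - enorm p ^+ 2)) - (1 - Num.sqrt (1 - enorm q ^+ 2))
  - \sum_i v ord0 i * p ord0 i + \sum_i v ord0 i * q ord0 i.
Proof.
move=> p1 q1 vq.
have q21 : 0 < 1 - enorm q ^+ 2.
  by rewrite subr_gt0 -[ltRHS](expr1n _ 2) ltrXn2r// ?nnegrE ?enorm_ge0.
have p21 : 0 <= 1 - enorm p ^+ 2.
  by rewrite subr_ge0 -[leRHS](expr1n _ 2) lerXn2r// ?nnegrE ?enorm_ge0.
set a := Num.sqrt (1 - enorm p ^+ 2); set b := Num.sqrt (1 - enorm q ^+ 2).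
have b0 : 0 < b by rewrite sqrtr_gt0.
have a0 : 0 <= a by exact: sqrtr_ge0.
have a2 : a ^+ 2 = 1 - enorm p ^+ 2 by rewrite sqr_sqrtr.
have b2 : b ^+ 2 = 1 - enorm q ^+ 2 by rewrite sqr_sqrtr// ltW.
have b1 : b <= 1 by rewrite /b -[leRHS]sqrtr1 ler_wsqrtr// gerBl sqr_ge0.
rewrite enorm_sqr in a2; rewrite enorm_sqr in b2.
set PP := \sum_i _ in a2; set QQ := \sum_i _ in b2.
pose PQ := \sum_i p ord0 i * q ord0 i.
have D : \sum_i (p ord0 i - q ord0 i) ^+ 2 = PP - 2 * PQ + QQ.
  rewrite /PP /PQ /QQ mulr_sumr -sumrB -big_split/=; apply: eq_bigr => i _; ring.
have D0 : 0 <= PP - 2 * PQ + QQ by rewrite -D sumr_ge0// => i _; exact: sqr_ge0.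
have vp : (\sum_i v ord0 i * p ord0 i) * b = PQ.
  by rewrite mulr_suml; apply: eq_bigr => i _; rewrite mulrAC vq mulrC.
have vqq : (\sum_i v ord0 i * q ord0 i) * b = QQ.
  by rewrite mulr_suml; apply: eq_bigr => i _; rewrite mulrAC vq -expr2.
rewrite D -(ler_pM2r b0).
move: vp vqq; set S1 := \sum_i _; set S2 := \sum_i _ => vp vqq.
have -> : (1 - a - (1 - b) - S1 + S2) * b = b * b - a * b - PQ + QQ.
  by rewrite -vp -vqq; ring.
have : 2^-1 * (PP - 2 * PQ + QQ) * b <= 2^-1 * (PP - 2 * PQ + QQ).
  by rewrite ler_piMr// mulr_ge0.
have : 0 <= (a - b) ^+ 2 by exact: sqr_ge0.
move: (2^-1 * _ * b) => z; have -> : (2^-1 : R) = 1 / 2 by rewrite mul1r.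
nra.
Qed.

End convexity.

(** * Calibrations, minimality and uniqueness *)

Section weak_gradients.
Context {R : realType} {n : nat}.
Notation leb := (@lebesgue_rV R n).
Variables (a b : 'rV[R]_n).
Let Omega := obox a b.
Let mO : measurable Omega. Proof. exact: measurable_obox. Qed.
Let finO : (leb Omega < +oo)%E. Proof. exact: lebesgue_obox_fin. Qed.

Lemma Loo_integrable f : in_Lp Omega +oo%E f -> leb.-integrable Omega (EFin \o f).
Proof. by move=> /in_LooP[mf [M M0 fM]]; apply: ae_bounded_integrable fM. Qed.

Lemma Loo_mul_integrable f g : leb.-integrable Omega (EFin \o f) ->
  in_Lp Omega +oo%E g -> leb.-integrable Omega (EFin \o (fun x => f x * g x)).
Proof. by move=> intf /in_LooP[mg [M M0 gM]]; apply: ae_bounded_mul_integrable gM. Qed.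

Lemma test_Loo phi : test_function Omega phi -> in_Lp Omega +oo%E phi.
Proof.
move=> tphi; apply/in_LooP; split; first exact: test_measurable tphi.
by have [M M0 hM] := test_bounded tphi; exists M => //; exact: aeW.
Qed.

Lemma test_partial_Loo phi i : test_function Omega phi ->
  in_Lp Omega +oo%E (partial i phi).
Proof.
move=> tphi; apply/in_LooP; split; first exact: test_partial_measurable tphi.
by have [M M0 hM] := test_partial_bounded i tphi; exists M => //; exact: aeW.
Qed.

Lemma weak_gradient_ae_unique u g g' : Linfty_weak_gradient Omega u g ->
  Linfty_weak_gradient Omega u g' ->
  {ae leb, forall x, Omega x -> g x = g' x}.
Proof.
move=> [Lg wg] [Lg' wg'].
have h i : {ae leb, forall x, Omega x -> g x ord0 i - g' x ord0 i = 0}.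
  apply: fundamental_lemma.
    exact: (integrableB mO (Loo_integrable (Lg i)) (Loo_integrable (Lg' i))).
  move=> phi tphi; under eq_Rintegral do rewrite mulrBl.
  rewrite RintegralB//.
  - by apply/eqP; rewrite subr_eq0 -eqr_opp -(wg i phi tphi) -(wg' i phi tphi).
  - exact: (Loo_mul_integrable (Loo_integrable (Lg i)) (test_Loo tphi)).
  - exact: (Loo_mul_integrable (Loo_integrable (Lg' i)) (test_Loo tphi)).
have : {ae leb, forall x, forall i, Omega x -> g x ord0 i - g' x ord0 i = 0}.
  exact: filter_forall.
by apply: filterS => x hx Ox; apply/rowP => i; apply/eqP; rewrite -subr_eq0 hx.
Qed.

Lemma weak_gradientP u : W1infty Omega u ->
  Linfty_weak_gradient Omega u (weak_gradient Omega u).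
Proof. by move=> [_ ex]; exact: (xgetPex (fun=> 0) ex). Qed.

Lemma measurable_enorm (g : 'rV[R]_n -> 'rV[R]_n) D :
  (forall i, measurable_fun D (fun x => g x ord0 i)) ->
  measurable_fun D (fun x => enorm (g x)).
Proof.
move=> mg; rewrite /enorm; apply: measurableT_comp.
  by apply: continuous_measurable_fun; exact: sqrt_continuous.
by apply: measurable_sum => i; exact: measurable_funX.
Qed.

Lemma competitor_enorm u0 w : competitor Omega u0 w ->
  {ae leb, forall x, Omega x -> enorm (weak_gradient Omega w x) <= 1}.
Proof.
move=> [_ _ N1 _]; move/(@Lnorm_oo R n (fun x => ((enorm \o weak_gradient Omega w) \_ Omega) x) 1) : N1.
apply: filterS => x + Ox; rewrite patchE mem_set//=.
by rewrite ger0_norm// enorm_ge0.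
Qed.

(** The weak form of - div V = mu. The functions w need not vanish on the
    boundary, so V has no flux through it either. *)
Definition calibrates (mu : 'rV[R]_n -> R) (V : 'rV[R]_n -> 'rV[R]_n) :=
  forall w g, in_Lp Omega +oo%E w -> Linfty_weak_gradient Omega w g ->
    \int[leb]_(x in Omega) (\sum_i V x ord0 i * g x ord0 i) =
    \int[leb]_(x in Omega) (mu x * w x).

Definition lagrangian (g : 'rV[R]_n -> 'rV[R]_n) x := 1 - Num.sqrt (1 - enorm (g x) ^+ 2).

Lemma lagrangian_integrable (g : 'rV[R]_n -> 'rV[R]_n) : (forall i, measurable_fun Omega (fun x => g x ord0 i)) ->
  leb.-integrable Omega (EFin \o lagrangian g).
Proof.
move=> mg; apply: (@ae_bounded_integrable _ _ _ leb _ mO _ 1) => //.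
  apply: measurable_funB => //; apply: measurableT_comp.
    by apply: continuous_measurable_fun; exact: sqrt_continuous.
  apply: measurable_funB => //; apply: measurable_funX; exact: measurable_enorm.
apply: aeW => x _; rewrite /lagrangian ger0_norm; last first.
  by rewrite subr_ge0 -[leRHS]sqrtr1 ler_wsqrtr// gerBl sqr_ge0.
by rewrite gerBl sqrtr_ge0.
Qed.

(** A vector field V that is dual to the gradient of u and has divergence -mu
    turns the uniform convexity of the integrand into minimality. *)
Lemma calibrated_energy u0 mu u (G V : 'rV[R]_n -> 'rV[R]_n) w :
  competitor Omega u0 u -> competitor Omega u0 w -> in_Lp Omega 1%E mu ->
  Linfty_weak_gradient Omega u G ->
  {ae leb, forall x, Omega x -> enorm (G x) < 1 /\
     forall i, V x ord0 i * Num.sqrt (1 - enorm (G x) ^+ 2) = G x ord0 i} ->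
  (forall i, leb.-integrable Omega (EFin \o (fun x => V x ord0 i))) ->
  calibrates mu V ->
  energy Omega mu u <= energy Omega mu w /\
  (energy Omega mu w <= energy Omega mu u ->
   {ae leb, forall x, Omega x -> weak_gradient Omega w x = weak_gradient Omega u x}).
Proof.
move=> cu cw /(in_L1P _ mO) imu LG GV iV cal.
have [Wu _ _ _] := cu; have [Ww _ _ _] := cw.
have Lu := weak_gradientP Wu; have Lw := weak_gradientP Ww.
set q := weak_gradient Omega u in Lu *; set p := weak_gradient Omega w in Lw *.
have qG := weak_gradient_ae_unique Lu LG; have p1 := competitor_enorm cw.
have mq i : measurable_fun Omega (fun x => q x ord0 i) by have [+ _] := Lu.1 i.
have mp i : measurable_fun Omega (fun x => p x ord0 i) by have [+ _] := Lw.1 i.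
have iS (g : 'rV[R]_n -> 'rV[R]_n) : (forall i, in_Lp Omega +oo%E (fun x => g x ord0 i)) ->
    leb.-integrable Omega (EFin \o (fun x => \sum_i V x ord0 i * g x ord0 i)).
  move=> Lg; rewrite (_ : EFin \o _ = (fun x => \sum_i (V x ord0 i * g x ord0 i)%:E)%E).
    by apply: integrable_sum => // i _; exact: (Loo_mul_integrable (iV i) (Lg i)).
  by apply/funext => x /=; rewrite sumEFin.
pose T x := lagrangian p x - lagrangian q x - \sum_i V x ord0 i * p x ord0 i +
  \sum_i V x ord0 i * q x ord0 i.
have iLp := lagrangian_integrable mp; have iLq := lagrangian_integrable mq.
have iSp := iS _ Lw.1; have iSq := iS _ Lu.1.
have i1 : leb.-integrable Omega (EFin \o (fun x => lagrangian p x - lagrangian q x)).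
  exact: (integrableB mO iLp iLq).
have i2 : leb.-integrable Omega (EFin \o (fun x => lagrangian p x - lagrangian q x -
    \sum_i V x ord0 i * p x ord0 i)) by exact: (integrableB mO i1 iSp).
have iT : leb.-integrable Omega (EFin \o T) by exact: (integrableD mO i2 iSq).
have ET : \int[leb]_(x in Omega) T x = energy Omega mu w - energy Omega mu u.
  rewrite /T (RintegralD mO i2 iSq) (RintegralB mO i1 iSp) (RintegralB mO iLp iLq).
  have -> : energy Omega mu w = \int[leb]_(x in Omega) lagrangian p x -
    \int[leb]_(x in Omega) (mu x * w x) by [].
  have -> : energy Omega mu u = \int[leb]_(x in Omega) lagrangian q x -
    \int[leb]_(x in Omega) (mu x * u x) by [].
  move: (cal w p Ww.1 Lw) (cal u q Wu.1 Lu) => -> ->.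
  have gen (A B C D : R) : A - B - C + D = (A - C) - (B - D) by ring.
  exact: gen.
have conv : {ae leb, forall x, Omega x ->
    2^-1 * \sum_i (p x ord0 i - q x ord0 i) ^+ 2 <= T x}.
  apply: filterS3 qG p1 GV => x qGx p1x GVx Ox.
  have [G1 VG] := GVx Ox; rewrite -(qGx Ox) in G1 VG.
  exact: lorentz_convex (p1x Ox) G1 VG.
have sq0 x : 0 <= 2^-1 * \sum_i (p x ord0 i - q x ord0 i) ^+ 2.
  by rewrite mulr_ge0 ?invr_ge0// sumr_ge0// => i _; exact: sqr_ge0.
have T0 : {ae leb, forall x, Omega x -> 0 <= T x}.
  by apply: filterS conv => x h Ox; exact: le_trans (sq0 x) (h Ox).
have [ET0 ETle] := ge0_Rintegral_eq0 mO iT T0.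
split; first by rewrite -subr_ge0 -ET.
move=> h; have /ETle TE : \int[leb]_(x in Omega) T x <= 0 by rewrite ET subr_le0.
apply: filterS2 conv TE => x cx Tx Ox; apply/rowP => i.
have h1 := cx Ox; rewrite (Tx Ox) in h1.
have /eqP := le_anti (introT andP (conj h1 (sq0 x))).
rewrite mulf_eq0 invr_eq0 pnatr_eq0/= psumr_eq0 => [|j _]; last exact: sqr_ge0.
by move=> /allP/(_ i (mem_index_enum _)); rewrite sqrf_eq0 subr_eq0 => /eqP.
Qed.

Lemma segment_adherent (x y : 'rV[R]_n) B : nbhs x B ->
  exists2 z, open_segment x y z & B z.
Proof.
move=> nB; have : \forall t \near (0 : R)^'+, B (x + t *: (y - x)).
  have c : (fun t : R => x + t *: (y - x)) @ 0^'+ --> x.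
    rewrite -[X in _ --> X]addr0 -(scale0r (y - x)).
    by apply: cvg_at_right_filter; apply: cvgD; [exact: cvg_cst|exact: scalel_continuous].
  exact: c.
have t1 : \forall t \near (0 : R)^'+, t < 1 by exact: nbhs_right_lt.
have t0 : \forall t \near (0 : R)^'+, 0 < t by exact: nbhs_right_gt.
move=> h; have [t [t0' [t1' Bt]]] := filter_ex (filterI t0 (filterI t1 h)).
by exists (x + t *: (y - x)) => //; exists t => //; rewrite /= in_itv/= t0'.
Qed.

Lemma locally_lipschitz_continuous u x : locally_lipschitz Omega u -> Omega x ->
  {for x, continuous u}.
Proof.
move=> lip Ox; have [V nV uV] := lip x Ox.
have Vx : V x := nbhs_singleton nV.
have [M [_ hM]] := uV.
have {}hM y : V y -> `|u x - u y| <= (`|M| + 1) * `|x - y|.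
  move=> Vy; have := hM (`|M| + 1) _ (x, y); rewrite /=; apply.
    by rewrite ltr_pwDr// ler_norm.
  by split.
apply: (iffRL (@cvgrPdist_le _ _ _ (nbhs x) _ _ _)) => e e0.
have M0 : 0 < `|M| + 1 by rewrite ltr_pwDr.
have d0 : 0 < (`|M| + 1)^-1 * e by rewrite mulr_gt0// invr_gt0.
have nb : nbhs x [set y | `|x - y| < (`|M| + 1)^-1 * e].
  by apply/nbhs_ballP; exists ((`|M| + 1)^-1 * e) => //= y; rewrite mx_norm_ball.
apply: filterS (filterI nV nb) => y [Vy /ltW yx].
by apply: le_trans (hM y Vy) _; rewrite -ler_pdivlMl.
Qed.

(** The difference of the two functions is continuous with weak gradient 0, hence
    constant along a line in direction i0, and it tends to 0 where this line
    leaves the box. *)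
Lemma equal_weak_gradients_eq u0 u w (i0 : 'I_n) :
  competitor Omega u0 u -> competitor Omega u0 w ->
  {ae leb, forall x, Omega x -> weak_gradient Omega w x = weak_gradient Omega u x} ->
  forall x, Omega x -> w x = u x.
Proof.
move=> [Wu lu _ bu] [Ww lw _ bw] wu x Ox.
have [Lu wgu] := weak_gradientP Wu; have [Lw wgw] := weak_gradientP Ww.
pose z y := w y - u y.
have iz : leb.-integrable Omega (EFin \o z).
  exact: (integrableB mO (Loo_integrable Ww.1) (Loo_integrable Wu.1)).
have cz y : Omega y -> {for y, continuous z}.
  by move=> Oy; apply: continuousB; exact: locally_lipschitz_continuous.
have zphi phi : test_function Omega phi ->
    \int[leb]_(y in Omega) (z y * partial i0 phi y) = 0.
  move=> tphi; under eq_Rintegral do rewrite mulrBl.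
  have iw := Loo_mul_integrable (Loo_integrable Ww.1) (test_partial_Loo i0 tphi).
  have iu := Loo_mul_integrable (Loo_integrable Wu.1) (test_partial_Loo i0 tphi).
  have same : \int[leb]_(y in Omega) (weak_gradient Omega w y ord0 i0 * phi y) =
      \int[leb]_(y in Omega) (weak_gradient Omega u y ord0 i0 * phi y).
    rewrite /Rintegral; apply: (congr1 (@fine R)); apply: ae_eq_integral.
    - exact: mO.
    - by have /integrableP[] := Loo_mul_integrable (Loo_integrable (Lw i0)) (test_Loo tphi).
    - by have /integrableP[] := Loo_mul_integrable (Loo_integrable (Lu i0)) (test_Loo tphi).
    - by apply: filterS wu => y wuy Oy; rewrite wuy.
  by rewrite (RintegralB mO iw iu) (wgu i0 phi tphi) (wgw i0 phi tphi) same subrr.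
(* the point where the line through x in direction i0 leaves the box *)
pose x0 : 'rV[R]_n := \row_j if j == i0 then b ord0 i0 else x ord0 j.
have seg : open_segment x0 x `<=` Omega.
  move=> _ [t /= + <-] j; rewrite in_itv/= => /andP[t0 t1]; rewrite !mxE.
  have /andP[ax xb] := Ox j; case: eqP => [ji|_]; last by rewrite subrr mulr0 addr0 ax.
  rewrite ji in ax xb *; apply/andP; split; nra.
have bx0 : boundary Omega x0.
  split=> [B nB|].
    by have [y sy By] := segment_adherent x nB; exists y; split => //; exact: seg.
  by move/interior_subset/(_ i0); rewrite mxE eqxx ltxx andbF.
have segz y : open_segment x0 x y -> z y = z x.
  move=> sy; have Oy := seg _ sy.
  apply: (weak_constant (i := i0) Oy Ox _ iz (cz _ Oy) (cz _ Ox) zphi).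
  move=> j ji; case: sy => t _ <-; rewrite !mxE (negbTE ji).
  by rewrite subrr mulr0 addr0.
have cvz : z @ within (open_segment x0 x) (nbhs x0) --> u0 x0 - u0 x0.
  exact: (cvgB (bw _ _ bx0 seg) (bu _ _ bx0 seg)).
apply/eqP; rewrite -subr_eq0 -normr_le0; apply/ler_addgt0Pr => e e0; rewrite add0r.
rewrite subrr in cvz; move/cvgrPdist_le : cvz => /(_ e e0) nz.
have [y sy] := segment_adherent x nz.
by move=> /(_ sy); rewrite sub0r normrN segz.
Qed.

End weak_gradients.

(** * Hausdorff measure and null sets *)

Section hausdorff_lebesgue.
Context {R : realType} {n : nat}.
Notation leb := (@lebesgue_rV R n.+1).

Lemma rV_coord_enorm (x : 'rV[R]_n.+1) i : `|x ord0 i| <= enorm x.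
Proof.
rewrite -sqrtr_sqr /enorm ler_wsqrtr// (bigD1 i)//= lerDl.
by apply: sumr_ge0 => j _; exact: sqr_ge0.
Qed.

Lemma diam_pow_ge0 s (U : set 'rV[R]_n.+1) : (0 <= diam_pow s U)%E.
Proof. by rewrite /diam_pow; case: asboolP => _ //; exact: poweR_ge0. Qed.

(** A set of diameter d is contained in a cube of side 2d, and d^(n+1) <= d^s for
    d <= 1 and s <= n + 1. *)
Lemma diam_pow_cube s (U : set 'rV[R]_n.+1) : 0 <= s -> s <= n.+1%:R ->
  (ediam U <= 1%:E)%E -> exists C, [/\ measurable C, U `<=` C &
    (leb C <= (2 ^+ n.+1)%:E * diam_pow s U)%E].
Proof.
move=> s0 sn U1; have [->|/eqP/set0P[x Ux]] := pselect (U = set0).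
  exists set0; split => //; by rewrite measure0 mule_ge0 ?diam_pow_ge0// lee_fin exprn_ge0.
have d0 : (0 <= ediam U)%E.
  apply: (@le_trans _ _ (enorm (x - x))%:E); first by rewrite lee_fin enorm_ge0.
  by apply: ereal_sup_ubound; exists (x, x).
have [d dE] : exists d, ediam U = d%:E.
  move: d0 U1; case: (ediam U) => [d _ _| |]//; by exists d.
rewrite dE !lee_fin in d0 U1.
exists (cube x d); split; first exact: measurable_cube.
- move=> y Uy i; apply: le_trans (_ : enorm (y - x) <= _).
    by have := rV_coord_enorm (y - x) i; rewrite !mxE.
  rewrite -lee_fin -dE; apply: ereal_sup_ubound; by exists (y, x).
have /= -> := lebesgue_cube x d0; rewrite /diam_pow asboolF; last first.
  by move=> U0; rewrite U0 in Ux.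
rewrite dE /= -EFinM lee_fin exprMn ler_pM2l ?exprn_gt0//.
have [->|dn0] := eqVneq d 0; first by rewrite expr0n/= powR_ge0.
rewrite -powR_mulrn//; apply: ger_powR => //.
by rewrite U1 lt_neqAle eq_sym dn0 d0.
Qed.

(** Covers of small Hausdorff content yield covers by cubes of small volume. *)
Lemma hausdorff_null s (A : set 'rV[R]_n.+1) : 0 <= s -> s <= n.+1%:R ->
  measurable A -> hausdorff_measure s A = 0%E -> leb A = 0%E.
Proof.
move=> s0 sn mA HA; apply/eqP; rewrite eq_le measure_ge0 andbT.
have pre : (hausdorff_premeasure 1 s A <= 0)%E.
  by rewrite -HA; apply: ereal_sup_ubound; exists 1 => //=.
apply/lee_addgt0Pr => e e0; rewrite add0e.
pose e' := e / 2 ^+ n.+1.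
have e'0 : 0 < e' by rewrite divr_gt0// exprn_gt0.
have : (hausdorff_premeasure 1 s A < e'%:E)%E by apply: le_lt_trans pre _; rewrite lte_fin.
move=> /ereal_inf_lt[_ [U [AU U1] <-] Ue].
have /choice[C hC] : forall k, exists C, [/\ measurable C, U k `<=` C &
    (leb C <= (2 ^+ n.+1)%:E * diam_pow s (U k))%E].
  by move=> k; exact: diam_pow_cube.
have dp0 k : (0 <= diam_pow s (U k))%E by exact: diam_pow_ge0.
apply: (@le_trans _ _ (\sum_(k <oo) leb (C k))%E).
  apply: measure_sigma_subadditive => //; first by move=> k; have [] := hC k.
  by apply: subset_trans AU _; apply: subset_bigcup => k _; have [] := hC k.
apply: (@le_trans _ _ (\sum_(k <oo) (2 ^+ n.+1)%:E * diam_pow s (U k))%E).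
  by apply: lee_nneseries => // k _; have [] := hC k.
rewrite nneseriesZl//.
apply: (@le_trans _ _ ((2 ^+ n.+1)%:E * e'%:E)%E).
  by apply: lee_wpmul2l; [rewrite lee_fin exprn_ge0|exact: ltW].
by rewrite -EFinM lee_fin /e' mulrC divfK// expf_neq0.
Qed.

End hausdorff_lebesgue.

(** * A packing by cubes with a fat set of centres *)

Section packing.
Context {R : realType} {n : nat}.
Notation rV := 'rV[R]_n.+1.
Notation leb := (@lebesgue_rV R n.+1).

Lemma cube_center (c : rV) s : 0 <= s -> cube c s c.
Proof. by move=> s0 i; rewrite subrr normr0. Qed.

Lemma cube_seq_small (B : nat -> set rV) : (forall j, measurable (B j)) ->
  (forall j, (leb (B j) <= (1 / (2 ^ j.+1)%:R)%:E)%E) ->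
  (leb (\bigcup_j B j) <= 1)%E.
Proof.
move=> mB hB; apply: (@le_trans _ _ (\sum_(j <oo) leb (B j))%E).
  exact: (measure_sigma_subadditive leb mB (bigcupT_measurable _ mB) (@subset_refl _ _)).
apply: le_trans (epsilon_trick0 xpredT (@ler01 R)).
by apply: lee_nneseries => // j _; exact: hB.
Qed.

Lemma cube_small_volume (c : rV) s (j : nat) : 0 <= s -> s <= ((2 ^ j.+2)%:R)^-1 ->
  (leb (cube c s) <= (1 / (2 ^ j.+1)%:R)%:E)%E.
Proof.
move=> s0 sj; have /= -> := lebesgue_cube c s0; rewrite lee_fin div1r.
have P0 : 0 < ((2 ^ j.+1)%:R : R) by rewrite ltr0n expn_gt0.
have h : 2 * s <= ((2 ^ j.+1)%:R)^-1.
  rewrite mulrC -ler_pdivlMr// -invfM; apply: le_trans sj _.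
  by rewrite expnS natrM mulrC lexx.
apply: le_trans h; rewrite exprS ler_piMr ?mulr_ge0// exprn_ile1 ?mulr_ge0//.
rewrite mulrC -ler_pdivlMr// div1r; apply: le_trans sj _.
by rewrite lef_pV2 ?posrE ?ltr0n ?expn_gt0// ler_nat -{1}(expn1 2) leq_exp2l.
Qed.

Lemma dense_in_unit_cube : exists q : nat -> rV, (forall k, cube 0 1 (q k)) /\
  forall x e, cube 0 1 x -> 0 < e -> exists k, forall i, `|x ord0 i - q k ord0 i| <= e.
Proof.
pose f (v : option 'rV[rat]_n.+1) : rV :=
  if v is Some v then
    if `[< cube 0 1 (map_mx ratr v : rV) >] then map_mx ratr v else 0
  else 0.
have c0 : cube 0 1 (0 : rV) by exact: cube_center.
exists (fun k => f (unpickle k)); split.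
  by move=> k; rewrite /f; case: (unpickle k) => // v; case: asboolP.
move=> x e xc e0.
have h i : {r : rat | `|ratr r : R| <= 1 /\ `|x ord0 i - ratr r| <= e}.
  have := xc i; rewrite mxE subr0 ler_norml => /andP[x1 x2].
  have lt : Num.max (-1) (x ord0 i - e) < Num.min 1 (x ord0 i + e).
    rewrite gt_max !lt_min; apply/andP; split; apply/andP; split; lra.
  apply: cid; have [r] := rat_in_itvoo lt; rewrite in_itv/= gt_max lt_min.
  move=> /andP[/andP[r1 r2] /andP[r3 r4]]; exists r; move: (ratr r) r1 r2 r3 r4 => z *.
  by rewrite !ler_norml; split; apply/andP; split; lra.
exists (pickle (\row_i sval (h i) : 'rV[rat]_n.+1)) => i.
rewrite pickleK /f asboolT; last by move=> j; rewrite !mxE subr0; have [] := svalP (h j).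
by rewrite !mxE; have [] := svalP (h i).
Qed.

Notation pt := (rV * R)%type.

(** The cube with centre p.1 and half-side p.2 may be added to the list l when the
    point q of the dense sequence is processed: unless q is covered already, it
    is centred at q. *)
Definition fresh (l : seq pt) (q : rV) (p : pt) :=
  [/\ 0 < p.2, p.2 <= ((2 ^ (size l).+2)%:R)^-1, cube 0 1 p.1,
    (forall p', p' \in l -> forall x, cube p.1 p.2 x -> cube p'.1 p'.2 x -> False) &
    ((forall p', p' \in l -> ~ cube p'.1 p'.2 q) -> p.1 = q)].

Lemma cubes_separated (l : seq pt) (c : rV) :
  (forall p', p' \in l -> ~ cube p'.1 p'.2 c) ->
  exists2 e, 0 < e & forall p', p' \in l -> forall x,
    cube c e x -> cube p'.1 p'.2 x -> False.
Proof.
elim: l => [|p' l IH] cl; first by exists 1.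
have [p'' pl|e e0 he] := IH; first by apply: cl; rewrite inE pl orbT.
have /nbhs_ballP[e' /= e'0 he'] : nbhs c (~` cube p'.1 p'.2).
  apply: open_nbhs_nbhs; split; first by apply: closed_openC; exact: closed_cube.
  by apply: cl; rewrite inE eqxx.
exists (Num.min e (e' / 2)); first by rewrite lt_min e0 divr_gt0.
move=> p''; rewrite inE => /predU1P[->|pl] x xc xp.
  apply: (he' x) => //; rewrite mx_norm_ball /ball_/=; apply/rV_norm_lt => // i.
  rewrite !mxE distrC; apply: le_lt_trans (xc i) _; rewrite gt_min; apply/orP; right; lra.
apply: (he p'' pl x) => // i; apply: le_trans (xc i) _; by rewrite ge_min lexx.
Qed.

Lemma fresh_center (l : seq pt) (q c : rV) : cube 0 1 c ->
  (forall p', p' \in l -> ~ cube p'.1 p'.2 c) ->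
  ((forall p', p' \in l -> ~ cube p'.1 p'.2 q) -> c = q) ->
  exists p, fresh l q p.
Proof.
move=> c1 cl cq.
have [e /= e0 he] := cubes_separated cl.
have d0 : 0 < ((2 ^ (size l).+2)%:R)^-1 :> R by rewrite invr_gt0 ltr0n expn_gt0.
exists (c, Num.min e ((2 ^ (size l).+2)%:R)^-1); split => //=.
- by rewrite lt_min e0 d0.
- by rewrite ge_min lexx orbT.
- move=> p' pl x xc; apply: (he p' pl) => i; apply: le_trans (xc i) _.
  by rewrite ge_min lexx.
Qed.

(** Disjoint cubes, of total volume less than that of the unit cube, whose
    centres accumulate at every point that the cubes leave uncovered: the
    k-th cube is centred at the k-th point of a dense sequence whenever
    this point is still uncovered. *)
Lemma cube_packing : exists (c : nat -> rV) (s : nat -> R),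
  [/\ forall k, 0 < s k <= ((2 ^ k.+2)%:R)^-1, forall k, cube 0 1 (c k),
    forall j k x, cube (c j) (s j) x -> cube (c k) (s k) x -> j = k &
    (0 < leb (closure (range c)))%E].
Proof.
have [q [q1 qd]] := dense_in_unit_cube.
pose next l q := xget ((0 : rV), (0 : R)) (fresh l q).
pose fix L k := if k is k'.+1 then rcons (L k') (next (L k') (q k')) else [::].
pose p k := next (L k) (q k).
have LE k : L k = mkseq p k by elim: k => //= k IH; rewrite mkseqS -IH.
have pin j k : (j < k)%N -> p j \in L k.
  by move=> jk; rewrite LE; apply/mapP; exists j => //; rewrite mem_iota.
have inp k p' : p' \in L k -> exists2 j, (j < k)%N & p' = p j.
  by rewrite LE => /mapP[j]; rewrite mem_iota => /= jk ->; exists j.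
have sL k : size (L k) = k by rewrite LE size_mkseq.
have leb1 : leb (cube 0 1) = (2 ^+ n.+1)%:E.
  by have /= -> := lebesgue_cube (0 : rV) (@ler01 R); rewrite mulr1.
have fr k : fresh (L k) (q k) (p k).
  elim/ltn_ind: k => k IH; rewrite /p /next; apply: xgetPex.
  have [h|h] := pselect (forall p', p' \in L k -> ~ cube p'.1 p'.2 (q k)).
    exact: (@fresh_center _ _ (q k)).
  pose B j := if (j < k)%N then cube (p j).1 (p j).2 else set0.
  have : (leb (\bigcup_j B j) <= 1)%E.
    apply: cube_seq_small => j; rewrite /B; case: ifP => jk //.
    - exact: measurable_cube.
    - have [p0 p1 _ _ _] := IH j jk; rewrite sL in p1.
      by apply: cube_small_volume => //; exact: ltW.
    - by rewrite measure0 lee_fin divr_ge0.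
  move=> B1; have [c c1 cB] : exists2 c, cube 0 1 c & ~ (\bigcup_j B j) c.
    apply: contrapT => hc; have : (leb (cube 0 1) <= leb (\bigcup_j B j))%E.
      apply: le_measure; rewrite ?inE.
      - exact: measurable_cube.
      - apply: bigcupT_measurable => j; rewrite /B; case: ifP => // _.
        exact: measurable_cube.
      - by move=> x x1; apply: contrapT => xB; apply: hc; exists x.
    rewrite leb1 => /le_trans/(_ B1); rewrite lee_fin leNgt => /negP; apply.
    by rewrite exprn_egt1// ltr1n.
  apply: (@fresh_center _ _ c) => //.
  move=> p' /inp[j jk ->] pc; apply: cB; exists j => //; by rewrite /B jk.
exists (fun k => (p k).1), (fun k => (p k).2); split.
- by move=> k; have [-> + _ _ _] := fr k; rewrite sL => ->.
- by move=> k; have [] := fr k.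
- move=> j k x xj xk; have [jk|kj|//] := ltngtP j k.
    by have [_ _ _ d _] := fr k; have [] := d _ (pin _ _ jk) x xk xj.
  by have [_ _ _ d _] := fr j; have [] := d _ (pin _ _ kj) x xj xk.
pose B j := cube (p j).1 (p j).2.
have mB j : measurable (B j) by exact: measurable_cube.
have mUB : measurable (\bigcup_j B j) by exact: bigcupT_measurable.
have UB1 : (leb (\bigcup_j B j) <= 1)%E.
  apply: cube_seq_small => // j.
  have [p0 p1 _ _ _] := fr j; rewrite sL in p1.
  by apply: cube_small_volume => //; exact: ltW.
set A := cube 0 1 `\` \bigcup_j B j.
have mA : measurable A by apply: measurableD => //; exact: measurable_cube.
apply: (@lt_le_trans _ _ (leb A)).
  rewrite lt_neqAle measure_ge0 andbT; apply/eqP => /esym A0.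
  have : (leb (cube 0 1) <= leb (A `|` \bigcup_j B j))%E.
    apply: le_measure; rewrite ?inE.
    - exact: measurable_cube.
    - exact: measurableU.
    - by move=> x x1; have [xB|xB] := pselect ((\bigcup_j B j) x); [right|left].
  move=> /le_trans/(_ (measureU2 leb mA mUB)).
  rewrite [X in (X + _)%E]A0 add0e leb1 => /le_trans/(_ UB1).
  rewrite lee_fin leNgt => /negP; apply; by rewrite exprn_egt1// ltr1n.
apply: le_measure; rewrite ?inE//.
  by apply: closed_measurable_rV; exact: closed_closure.
move=> x [x1 xB] U /nbhs_ballP[e /= e0 xU].
have [m me] : exists m : nat, forall j, (m <= j)%N -> (p j).2 <= e / 4.
  have [m hm] : exists m : nat, ((2 ^ m)%:R)^-1 < e / 4.
    have [m] := @ltr_add_invr R 0 (e / 4) ltac:(by rewrite divr_gt0).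
    rewrite add0r => hm; exists m; apply: le_lt_trans hm.
    by rewrite lef_pV2 ?posrE ?ltr0n ?expn_gt0// ler_nat ltn_expl.
  exists m => j mj; have [_ + _ _ _] := fr j; rewrite sL => /le_trans; apply.
  apply/ltW/(le_lt_trans _ hm); rewrite lef_pV2 ?posrE ?ltr0n ?expn_gt0// ler_nat.
  by rewrite leq_exp2l// (leq_trans mj)// (leq_trans (leqnSn _)).
have [e' /= e'0 he'] : exists2 e', 0 < e' & forall j, (j < m)%N -> forall y,
    cube x e' y -> B j y -> False.
  have [|e' e'0 he'] := @cubes_separated (L m) x.
    by move=> p' /inp[j jm ->] px; apply: xB; exists j.
  by exists e' => // j jm y xy; apply: he' xy; exact: pin.
pose e2 := Num.min e' (e / 4).
have e20 : 0 < e2 by rewrite lt_min e'0 divr_gt0.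
have [k hk] := qd x e2 x1 e20.
have [j Bj] : exists j, B j (q k).
  have [_ _ _ _ E] := fr k.
  have [h|h] := pselect (forall p', p' \in L k -> ~ cube p'.1 p'.2 (q k)).
    by exists k; rewrite /B (E h); apply: cube_center; apply: ltW; have [] := fr k.
  move/existsNP : h => [p' /not_implyP[/inp[j _ ->] /contrapT h]].
  by exists j.
have mj : (m <= j)%N.
  rewrite leqNgt; apply/negP => jm; apply: (he' j jm (q k)) => // i.
  by rewrite distrC; apply: le_trans (hk i) _; rewrite ge_min lexx.
exists (p j).1; split; first by exists j.
apply: xU; rewrite mx_norm_ball /ball_/=; apply/rV_norm_lt => // i.
have := hk i; have := Bj i; have := me j mj; rewrite !mxE => h1 h2 h3.
have {}h3 : `|x ord0 i - q k ord0 i| <= e / 4.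
  by apply: le_trans h3 _; rewrite ge_min lexx orbT.
rewrite -(subrK (q k ord0 i) (x ord0 i)) -addrA.
apply: le_lt_trans (ler_normD _ _) _; lra.
Qed.

End packing.

(** * Two poles: plane algebra *)

Section bipolar_algebra.
Context {R : realFieldType}.
Variables (X r a b : R).
Hypotheses (r0 : 0 <= r) (a0 : 0 <= a) (b0 : 0 <= b)
  (a2 : a ^+ 2 = (X + 1) ^+ 2 + r) (b2 : b ^+ 2 = (X - 1) ^+ 2 + r).
Let P := X ^+ 2 - 1 + r.

Lemma bipolar_prod : (a * b) ^+ 2 = P ^+ 2 + 4 * r.
Proof. by rewrite exprMn a2 b2 /P; ring. Qed.

Lemma bipolar_inner : - (a * b) <= P <= a * b.
Proof.
have ab0 : 0 <= a * b by rewrite mulr_ge0.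
have h := bipolar_prod; rewrite -ler_norml -(ler_pXn2r (n := 2)) ?nnegrE//.
by rewrite real_normK ?num_real// h lerDl mulr_ge0.
Qed.

Lemma bipolar_sum : (a + b) ^+ 2 = 2 * P + 4 + 2 * (a * b).
Proof. rewrite sqrrD a2 b2 /P; ring. Qed.

Lemma bipolar_diff : (a - b) ^+ 2 = 2 * P + 4 - 2 * (a * b).
Proof. rewrite sqrrB a2 b2 /P; ring. Qed.

Lemma bipolar_sum_ge2 : 2 <= a + b.
Proof.
have /andP[h _] := bipolar_inner.
rewrite -(ler_pXn2r (n := 2)) ?nnegrE ?addr_ge0// bipolar_sum; nra.
Qed.

Lemma bipolar_diff_le2 : `|a - b| <= 2.
Proof.
have /andP[_ h] := bipolar_inner.
rewrite -(ler_pXn2r (n := 2)) ?nnegrE// real_normK ?num_real// bipolar_diff; nra.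
Qed.

Lemma bipolar_norm : X ^+ 2 + r <= ((a + b) / 2) ^+ 2.
Proof.
have /andP[_ h] := bipolar_inner; rewrite exprMn bipolar_sum exprVn.
rewrite ler_pdivlMr ?exprn_gt0//; move: h; rewrite /P; nra.
Qed.

Lemma bipolar_axis : r <= a * b * (((a + b) / 2) ^+ 2 - 1).
Proof.
have /andP[h1 h2] := bipolar_inner; have h3 := bipolar_prod.
have ab0 : 0 <= a * b by rewrite mulr_ge0.
have -> : ((a + b) / 2) ^+ 2 - 1 = (P + a * b) / 2.
  by rewrite exprMn bipolar_sum exprVn; field.
have : 4 * r = (a * b + P) * (a * b - P) by ring: h3.
by move: P h1 h2 h3 => Q h1 h2 h3 h4; nra.
Qed.

Lemma bipolar_pos : 2 < a + b -> 0 < a /\ 0 < b.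
Proof.
move=> ab; rewrite !lt_neqAle a0 b0 !andbT; split; apply/negP => /eqP.
  move=> a00; move: a2; rewrite -a00 expr0n/= => h.
  have hX : X + 1 = 0 by apply/eqP; rewrite -sqrf_eq0 eq_le sqr_ge0 andbT [leRHS]h lerDl.
  have hr : r = 0 by move: h; rewrite hX expr0n/= add0r => <-.
  have X1 : X = -1 by lra.
  have bb : b ^+ 2 = 2 ^+ 2 by rewrite b2 hr addr0 X1; ring.
  move/eqP : bb; rewrite eqrXn2// => /eqP b22; lra.
move=> b00; move: b2; rewrite -b00 expr0n/= => h.
have hX : X - 1 = 0 by apply/eqP; rewrite -sqrf_eq0 eq_le sqr_ge0 andbT [leRHS]h lerDl.
have hr : r = 0 by move: h; rewrite hX expr0n/= add0r => <-.
have X1 : X = 1 by lra.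
have bb : a ^+ 2 = 2 ^+ 2 by rewrite a2 hr addr0 X1; ring.
move/eqP : bb; rewrite eqrXn2// => /eqP b22; lra.
Qed.

End bipolar_algebra.

(** * Two poles: distances and the model potential *)

Section bipolar.
Context {R : realType} {n : nat}.
Notation rV := 'rV[R]_n.+1.
Implicit Types (x : rV) (e d : R).

(** Coordinates relative to the pole e *: basis_vec ord0, for e = 1 or e = -1. *)
Definition shf e x (i : 'I_n.+1) : R := x ord0 i - e * (i == ord0)%:R.
(** Squared distance to a pole, regularized by d: for d > 0 the functions built
    from it are smooth everywhere, and d = 0 is the case of interest. *)
Definition dist2 e d x : R := \sum_i shf e x i ^+ 2 + d.
Definition dst e d x : R := Num.sqrt (dist2 e d x).
Definition dir e d x i : R := shf e x i / dst e d x.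
Definition axis2 x : R := \sum_(j < n) x ord0 (lift ord0 j) ^+ 2.

Lemma axis2_ge0 x : 0 <= axis2 x.
Proof. by apply: sumr_ge0 => j _; exact: sqr_ge0. Qed.

Lemma dist2E e d x : dist2 e d x = (x ord0 ord0 - e) ^+ 2 + (axis2 x + d).
Proof.
rewrite /dist2 big_ord_recl /shf eqxx mulr1 -addrA; congr (_ + (_ + _)).
by apply: eq_bigr => j _; rewrite mulr0 subr0.
Qed.

Lemma dist2_ge0 e d x : 0 <= d -> 0 <= dist2 e d x.
Proof. by move=> d0; rewrite dist2E !addr_ge0 ?sqr_ge0 ?axis2_ge0. Qed.

Lemma dst_ge0 e d x : 0 <= dst e d x. Proof. exact: sqrtr_ge0. Qed.

Lemma dst_sqr e d x : 0 <= d ->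
  dst e d x ^+ 2 = (x ord0 ord0 - e) ^+ 2 + (axis2 x + d).
Proof. by move=> d0; rewrite sqr_sqrtr ?dist2E// -dist2E dist2_ge0. Qed.

(** The elliptic coordinates sig and tau with respect to the two poles. For d = 0
    the level sets of sig are confocal ellipsoids, and on the segment between the
    poles sig is 1 and tau is the coordinate ord0. *)
Definition sig d x : R := (dst (-1) d x + dst 1 d x) / 2.
Definition tau d x : R := (dst (-1) d x - dst 1 d x) / 2.

Section facts.
Variables (d : R) (d0 : 0 <= d) (x : rV).
Let r0 : 0 <= axis2 x + d. Proof. by rewrite addr_ge0 ?axis2_ge0. Qed.
Let a2 : dst (-1) d x ^+ 2 = (x ord0 ord0 + 1) ^+ 2 + (axis2 x + d).
Proof. by rewrite dst_sqr// opprK. Qed.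
Let b2 := dst_sqr 1 x d0.
Let a0 := dst_ge0 (-1) d x.
Let b0 := dst_ge0 1 d x.

Lemma sig_ge1 : 1 <= sig d x.
Proof. by rewrite /sig ler_pdivlMr// mul1r; exact: (bipolar_sum_ge2 r0 a0 b0 a2 b2). Qed.

Lemma tau_le1 : `|tau d x| <= 1.
Proof.
rewrite /tau normrM normfV [`|2|]ger0_norm// ler_pdivrMr// mul1r.
exact: (bipolar_diff_le2 r0 a0 b0 a2 b2).
Qed.

Lemma coord_le_sig i : `|x ord0 i| <= sig d x.
Proof.
have s0 : 0 <= sig d x := le_trans ler01 sig_ge1.
rewrite -(ler_pXn2r (n := 2)) ?nnegrE// real_normK ?num_real//.
apply: le_trans (bipolar_norm r0 a0 b0 a2 b2); case: (unliftP ord0 i) => [j|] ->.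
  rewrite ler_wpDl ?sqr_ge0// ler_wpDr//.
  by rewrite /axis2 (bigD1 j)//= lerDl; apply: sumr_ge0 => k _; exact: sqr_ge0.
by rewrite lerDl.
Qed.

Lemma axis_le : axis2 x + d <= dst (-1) d x * dst 1 d x * (sig d x ^+ 2 - 1).
Proof. exact: (bipolar_axis r0 a0 b0 a2 b2). Qed.

Lemma dst_gt0 : 1 < sig d x -> 0 < dst (-1) d x /\ 0 < dst 1 d x.
Proof.
rewrite /sig ltr_pdivlMr// mul1r => h; exact: (bipolar_pos r0 a0 b0 a2 b2).
Qed.

Lemma dst_prod_le : dst (-1) d x * dst 1 d x <= sig d x ^+ 2.
Proof. by rewrite /sig exprMn exprVn ler_pdivlMr ?exprn_gt0//; have := sqr_ge0 (dst (-1) d x - dst 1 d x); nra. Qed.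

End facts.

Section smoothness.
Variables (d : R) (D : set rV) (oD : open D).

Lemma smooth_on_shf e i : smooth_on D (fun x => shf e x i).
Proof.
by apply: smooth_onB => //; [exact: smooth_on_coord|exact: smooth_on_cst].
Qed.

Lemma partial_shf e i j x : partial i (fun x => shf e x j) x = (i == j)%:R.
Proof.
have [d1 e1] := derive_coord i j x.
rewrite /partial /shf (deriveB d1 (derivable_cst (e * (j == ord0)%:R) x (basis_vec i))).
by rewrite [X in X - _]e1 (_ : 'D_(basis_vec i) _ x = 0) ?subr0//; exact: derive_cst.
Qed.

Lemma smooth_on_dist2 e : smooth_on D (dist2 e d).
Proof.
apply: smooth_onD => //; last exact: smooth_on_cst.
rewrite (_ : (fun x => _) = (fun x => \sum_(i < n.+1) shf e x i * shf e x i)).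
  by apply: smooth_on_sum => // i; apply: smooth_onM => //; exact: smooth_on_shf.
by apply/funext => x; apply: eq_bigr => i _; rewrite expr2.
Qed.

Lemma partial_dist2 e i x : D x -> partial i (dist2 e d) x = 2 * shf e x i.
Proof.
move=> Dx; have dsh j : derivable (fun x => shf e x j) x (basis_vec i).
  exact: (smooth_on_derivable (smooth_on_shf e j) Dx).
have sj (r : seq 'I_n.+1) : derivable (fun x => \sum_(j <- r) shf e x j ^+ 2) x (basis_vec i) /\
  partial i (fun x => \sum_(j <- r) shf e x j ^+ 2) x = \sum_(j <- r) 2 * shf e x j * (i == j)%:R.
  elim: r => [|j r [IH1 IH2]].
    rewrite (_ : (fun x => _) = cst 0); last by apply/funext => y; rewrite big_nil.
    by split; [exact: derivable_cst|rewrite /partial derive_cst big_nil].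
  rewrite (_ : (fun x => _) = (fun x => shf e x j * shf e x j + \sum_(j <- r) shf e x j ^+ 2)); last first.
    by apply/funext => y; rewrite big_cons expr2.
  have [h1 h2] := partialM (dsh j) (dsh j); have [h3 h4] := partialD h1 IH1.
  by split => //; rewrite h4 h2 IH2 big_cons partial_shf; congr (_ + _); ring.
have [h1 h2] := sj (index_enum _); have [_ h4] := partialD h1 (derivable_cst d x (basis_vec i)).
rewrite [LHS]h4 h2 (_ : partial i _ x = 0) ?addr0; last exact: derive_cst.
rewrite (bigD1 i)//= eqxx mulr1 big1 ?addr0// => j ji.
by rewrite eq_sym (negbTE ji) mulr0.
Qed.

Hypothesis pos : forall e x, e = 1 \/ e = -1 -> D x -> 0 < dist2 e d x.
Let p1 x : D x -> 0 < dist2 1 d x. Proof. by apply: pos; left. Qed.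
Lemma smooth_on_dst e : e = 1 \/ e = -1 -> smooth_on D (dst e d).
Proof. by move=> e1; apply: smooth_on_sqrt => //; [exact: smooth_on_dist2|move=> x; exact: pos]. Qed.

Lemma partial_dst e i x : e = 1 \/ e = -1 -> D x -> partial i (dst e d) x = dir e d x i.
Proof.
move=> e1 Dx; have [h1 h2] := derive_sqrtr (pos e1 Dx).
rewrite (partial_comp h1 _).2; last exact: (smooth_on_derivable (smooth_on_dist2 e) Dx).
rewrite h2 partial_dist2// /dir -/(dst e d x) [RHS]mulrC mulrACA mulVf ?mul1r// mulrC.
Qed.

Let h1 : (1 : R) = 1 \/ (1 : R) = -1. Proof. by left. Qed.
Let hN1 : (-1 : R) = 1 \/ (-1 : R) = -1. Proof. by right. Qed.

Lemma smooth_on_sig : smooth_on D (sig d).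
Proof.
apply: smooth_onM => //; last exact: smooth_on_cst.
by apply: smooth_onD => //; exact: smooth_on_dst.
Qed.

Lemma smooth_on_tau : smooth_on D (tau d).
Proof.
apply: smooth_onM => //; last exact: smooth_on_cst.
by apply: smooth_onB => //; exact: smooth_on_dst.
Qed.

Lemma partialZr (f : rV -> R) k i x : derivable f x (basis_vec i) ->
  partial i (fun x => f x * k) x = partial i f x * k.
Proof.
move=> df; rewrite (partialM df (derivable_cst k x (basis_vec i))).2.
by rewrite (_ : partial i _ x = 0) ?mulr0 ?add0r 1?mulrC//; exact: derive_cst.
Qed.

Lemma partial_sig i x : D x -> partial i (sig d) x = (dir (-1) d x i + dir 1 d x i) / 2.
Proof.
move=> Dx; have da := smooth_on_derivable (i := i) (smooth_on_dst hN1) Dx.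
have db := smooth_on_derivable (i := i) (smooth_on_dst h1) Dx.
have [dd ed] := partialD da db.
by rewrite [LHS](partialZr _ dd) ed !partial_dst.
Qed.

Lemma partial_tau i x : D x -> partial i (tau d) x = (dir (-1) d x i - dir 1 d x i) / 2.
Proof.
move=> Dx; have da := smooth_on_derivable (i := i) (smooth_on_dst hN1) Dx.
have db := smooth_on_derivable (i := i) (smooth_on_dst h1) Dx.
have dd := derivableB da db; have ed := deriveB da db.
rewrite [LHS](partialZr _ dd) [X in X * _]ed.
by congr ((_ - _) * _); exact: partial_dst.
Qed.

Variable l : R.
Definition cutoff (t : R) := 1 - step ((t - 2) / l).
Definition dcutoff (t : R) := - (dstep ((t - 2) / l) / l).

Lemma derive_cutoff t : derivable cutoff t 1 /\ 'D_1 cutoff t = dcutoff t.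
Proof.
have d1 : derivable (fun s : R => s - 2) t 1.
  by apply: derivableB; [exact: derivable_id|exact: derivable_cst].
have e1 : 'D_1 (fun s : R => s - 2) t = 1.
  rewrite deriveB; [|exact: derivable_id|exact: derivable_cst].
  by rewrite derive_id derive_cst subr0.
have d2 : derivable (fun s : R => (s - 2) / l) t 1.
  exact: (derivableM d1 (derivable_cst _ _ _)).
have e2 : 'D_1 (fun s : R => (s - 2) / l) t = l^-1.
  rewrite (deriveM d1 (derivable_cst _ _ _)) derive_cst e1 /GRing.scale/=.
  by rewrite mulr0 add0r mulr1.
have [d3 e3] := derive_comp1 d2 (derive_step ((t - 2) / l)).1.
split; first exact: (derivableB (derivable_cst _ _ _) d3).
rewrite (deriveB (derivable_cst _ _ _) d3).
by rewrite derive_cst e3 (derive_step _).2 e2 sub0r.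
Qed.

Lemma smooth_on_cutoff (f : rV -> R) : smooth_on D f -> smooth_on D (fun x => cutoff (f x)).
Proof.
move=> sf; apply: smooth_onB => //; first exact: smooth_on_cst.
apply: smooth_on_step => //; apply: smooth_onM => //; last exact: smooth_on_cst.
by apply: smooth_onB => //; exact: smooth_on_cst.
Qed.

(** The model potential is tau for sig <= 2 and vanishes for sig >= 2 + l. *)
Definition pot x := tau d x * cutoff (sig d x).
Definition gpot x i := (dir (-1) d x i - dir 1 d x i) / 2 * cutoff (sig d x) +
   tau d x * dcutoff (sig d x) * ((dir (-1) d x i + dir 1 d x i) / 2).

Lemma smooth_on_pot : smooth_on D pot.
Proof. by apply: smooth_onM => //; [exact: smooth_on_tau|exact/smooth_on_cutoff/smooth_on_sig]. Qed.

Lemma partial_pot i x : D x -> partial i pot x = gpot x i.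
Proof.
move=> Dx; have dt := smooth_on_derivable (i := i) smooth_on_tau Dx.
have ds := smooth_on_derivable (i := i) smooth_on_sig Dx.
have [dc ec] := partial_comp (derive_cutoff (sig d x)).1 ds.
rewrite [LHS](partialM dt dc).2 ec (derive_cutoff _).2 partial_sig// partial_tau//.
by rewrite /gpot addrC [X in X + _]mulrC -!mulrA.
Qed.

Lemma smooth_on_gpot i : smooth_on D (fun x => gpot x i).
Proof.
apply: (@smooth_on_near _ _ _ oD (partial i pot)); first by move=> x; exact: partial_pot.
exact/smooth_on_partial/smooth_on_pot.
Qed.

End smoothness.
End bipolar.

(** * The gradient and the dual field of the model *)

Section has_partial.
Context {R : realType} {n : nat}.
Implicit Types (f g : 'rV[R]_n -> R) (x : 'rV[R]_n).

Definition has_partial i f x (v : R) :=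
  derivable f x (basis_vec i) /\ partial i f x = v.

Lemma has_partialM i f g x u v : has_partial i f x u -> has_partial i g x v ->
  has_partial i (fun y => f y * g y) x (f x * v + g x * u).
Proof. by move=> [df <-] [dg <-]; exact: partialM. Qed.

Lemma has_partialB i f g x u v : has_partial i f x u -> has_partial i g x v ->
  has_partial i (fun y => f y - g y) x (u - v).
Proof. by move=> [df <-] [dg <-]; split; [exact: derivableB|exact: deriveB]. Qed.

Lemma has_partial_cst i (c : R) x : has_partial i (fun=> c) x 0.
Proof. by split; [exact: derivable_cst|exact: derive_cst]. Qed.

Lemma has_partialV i f x u : f x != 0 -> has_partial i f x u ->
  has_partial i (fun y => (f y)^-1) x (- (u / f x ^+ 2)).
Proof.
move=> f0 [df <-]; split; first exact: derivableV.
by rewrite /partial deriveV// /GRing.scale/= mulNr mulrC.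
Qed.

Lemma has_partial_sqrt i f x u : 0 < f x -> has_partial i f x u ->
  has_partial i (fun y => Num.sqrt (f y)) x (u / (2 * Num.sqrt (f x))).
Proof.
move=> f0 [df <-]; have [h1 h2] := derive_sqrtr f0.
have [h3 h4] := partial_comp h1 df; split => //; rewrite h4 h2.
by rewrite invfM mulrC.
Qed.

Lemma has_partial_smooth D i f x : smooth_on D f -> D x ->
  has_partial i f x (partial i f x).
Proof. by move=> sf Dx; split => //; exact: smooth_on_derivable sf Dx. Qed.

End has_partial.

Section model.
Context {R : realType} {n : nat}.
Notation rV := 'rV[R]_n.+1.
Implicit Types (x y : rV).
Variables (l : R) (l0 : 0 < l) (dl : forall t : R, dstep t <= l / 2).

Notation a := (dst (-1) 0).
Notation b := (dst 1 0).
Notation p := (dir (-1) 0).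
Notation q := (dir 1 0).
Notation sg := (sig 0).
Notation ta := (tau 0).
Notation gp := (gpot 0 l).

Lemma cutoff1 (t : R) : t <= 2 -> cutoff l t = 1.
Proof.
by move=> t2; rewrite /cutoff step0 ?subr0// pmulr_lle0 ?invr_gt0// subr_le0.
Qed.

Lemma cutoff0 (t : R) : 2 + l <= t -> cutoff l t = 0.
Proof.
by move=> t2; rewrite /cutoff step1 ?subrr// ler_pdivlMr// mul1r lerBrDl.
Qed.

Lemma cutoff_ge0 t : 0 <= cutoff l t. Proof. by rewrite subr_ge0 step_le1. Qed.
Lemma cutoff_le1 t : cutoff l t <= 1. Proof. by rewrite gerBl step_ge0. Qed.

Lemma dcutoff0 (t : R) : t <= 2 \/ 2 + l <= t -> dcutoff l t = 0.
Proof.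
move=> h; rewrite /dcutoff dstep0 ?mul0r ?oppr0//; case: h => h; [left|right].
  by rewrite pmulr_lle0 ?invr_gt0// subr_le0.
by rewrite ler_pdivlMr// mul1r lerBrDl.
Qed.

Lemma dcutoff_le t : `|dcutoff l t| <= 2^-1.
Proof.
have h : 0 <= dstep ((t - 2) / l) / l by rewrite divr_ge0 ?dstep_ge0// ltW.
rewrite normrN (ger0_norm h) ler_pdivrMr// [leRHS]mulrC.
exact: dl.
Qed.

(** The complement of the segment between the poles. *)
Definition off_core : set rV := [set x | 1 < sg x].

Lemma dist2_continuous e d : continuous (@dist2 R n e d).
Proof.
move=> x; apply: (@smooth_on_cont _ _ setT) => //.
by apply: smooth_on_dist2; exact: openT.
Qed.

Lemma dst_continuous e d : continuous (@dst R n e d).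
Proof.
by move=> x; apply: continuous_comp; [exact: dist2_continuous|exact: sqrt_continuous].
Qed.

Lemma sig_continuous d : continuous (@sig R n d).
Proof.
move=> x; apply: (@continuousM _ _ (fun x => dst (-1) d x + dst 1 d x) (cst 2^-1)).
  by apply: (@continuousD _ _ _ (dst (-1) d) (dst 1 d)); exact: dst_continuous.
exact: cst_continuous.
Qed.

Lemma open_sig_gt t : open [set x : rV | t < sg x].
Proof.
rewrite (_ : [set x | _] = sg @^-1` `]t, +oo[%classic).
  by apply: open_comp; [move=> x _; exact: sig_continuous|exact: interval_open].
by apply/seteqP; split => x; rewrite /= in_itv/= andbT.
Qed.

Lemma open_sig_lt t : open [set x : rV | sg x < t].
Proof.
rewrite (_ : [set x | _] = sg @^-1` `]-oo, t[%classic).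
  by apply: open_comp; [move=> x _; exact: sig_continuous|exact: interval_open].
by apply/seteqP; split => x; rewrite /= in_itv.
Qed.

Lemma open_off_core : open off_core. Proof. exact: open_sig_gt. Qed.

Lemma off_core_pos e x : e = 1 \/ e = -1 -> off_core x -> 0 < @dist2 R n e 0 x.
Proof.
by move=> e1 Dx; have [] := dst_gt0 (lexx 0) Dx; rewrite !sqrtr_gt0; case: e1 => ->.
Qed.

Let oC := open_off_core.

(** The squared cosine of half the angle between the directions from the two poles
    to x. It vanishes at the points between the poles, where the directions are
    opposite. *)
Definition cos2_half x : R := (1 + \sum_i p x i * q x i) / 2.

Lemma dir_sqr e x : 0 < dst e 0 x -> \sum_i dir e 0 x i ^+ 2 = 1.
Proof.
move=> e0; under eq_bigr do rewrite exprMn.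
rewrite -mulr_suml exprVn -[X in _ / X](_ : \sum_i shf e x i ^+ 2 = _) ?divff//.
  by rewrite -[X in X != 0]addr0 -/(dist2 e 0 x) gt_eqF// -sqrtr_gt0.
by rewrite sqr_sqrtr ?dist2_ge0// /dist2 addr0.
Qed.

Lemma cos2_halfE x : off_core x -> a x * b x * cos2_half x = sg x ^+ 2 - 1.
Proof.
move=> Cx; have [a0 b0] := dst_gt0 (lexx 0) Cx.
have h : a x * b x * \sum_i p x i * q x i = x ord0 ord0 ^+ 2 - 1 + axis2 x.
  rewrite mulr_sumr (eq_bigr (fun i => shf (-1) x i * shf 1 x i)); last first.
    by move=> i _; rewrite /dir; field; rewrite !gt_eqF.
  rewrite big_ord_recl /shf eqxx !mulr1; congr (_ + _); first ring.
  by apply: eq_bigr => j _; rewrite !mulr0 !subr0 expr2.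
have a2 := dst_sqr (-1) x (lexx 0); have b2 := dst_sqr 1 x (lexx 0).
rewrite /cos2_half mulrA mulrDr mulr1 h /sig exprMn exprVn sqrrD a2 b2; by field.
Qed.

Lemma cos2_half_gt0 x : off_core x -> 0 < cos2_half x.
Proof.
move=> Cx; have [a0 b0] := dst_gt0 (lexx 0) Cx.
rewrite -(pmulr_rgt0 _ (mulr_gt0 a0 b0)) cos2_halfE// subr_gt0.
by rewrite -[ltLHS](expr1n _ 2) ltrXn2r// nnegrE; exact: le_trans (ltW Cx).
Qed.

Lemma axis_cos2_half x : off_core x -> axis2 x <= (a x * b x) ^+ 2 * cos2_half x.
Proof.
move=> Cx; rewrite expr2 -mulrA cos2_halfE//.
by apply: le_trans (axis_le (lexx 0) x); rewrite addr0.
Qed.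

Definition gap x : R := 1 - \sum_i gp x i ^+ 2.

(** Since p and q are unit vectors, (p - q) / 2 and (p + q) / 2 are orthogonal, with
    squared lengths 1 - cos2_half and cos2_half. *)
Lemma gapE x : off_core x -> gap x =
  1 - (cutoff l (sg x) ^+ 2 * (1 - cos2_half x) +
       (ta x * dcutoff l (sg x)) ^+ 2 * cos2_half x).
Proof.
move=> Cx; have [a0 b0] := dst_gt0 (lexx 0) Cx.
have pp := dir_sqr a0; have qq := dir_sqr b0.
congr (1 - _); rewrite /gpot.
set h := cutoff _ _; set k := ta x * _.
transitivity (\sum_i ((h ^+ 2 + k ^+ 2) / 4 * (p x i ^+ 2) +
   (h ^+ 2 + k ^+ 2) / 4 * (q x i ^+ 2) +
   ((k ^+ 2 - h ^+ 2) / 2 * (p x i * q x i) + h * k / 2 * (p x i ^+ 2) - h * k / 2 * (q x i ^+ 2)))).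
  by apply: eq_bigr => i _; field.
by rewrite !big_split/= sumrN -!mulr_sumr pp qq /cos2_half; field.
Qed.

(** The squared length of the gradient of tau falls short of 1 by cos2_half; a cutoff
    of slope at most 1/2 uses up at most a quarter of this. *)
Lemma gap_ge x : off_core x -> 3 / 4 * cos2_half x <= gap x.
Proof.
move=> Cx; rewrite gapE//; have c0 := cos2_half_gt0 Cx.
have c1 : cos2_half x <= 1.
  have [a0 b0] := dst_gt0 (lexx 0) Cx.
  have : 0 <= \sum_i ((p x i - q x i) / 2) ^+ 2 by apply: sumr_ge0 => i _; exact: sqr_ge0.
  rewrite (eq_bigr (fun i => 1/4 * p x i ^+ 2 + 1/4 * q x i ^+ 2 - 1/2 * (p x i * q x i))).
    by rewrite sumrB big_split/= -!mulr_sumr (dir_sqr a0) (dir_sqr b0) /cos2_half; lra.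
  by move=> i _; field.
have h2 : cutoff l (sg x) ^+ 2 <= 1 by rewrite exprn_ile1 ?cutoff_ge0 ?cutoff_le1.
have k2 : (ta x * dcutoff l (sg x)) ^+ 2 <= 1 / 4.
  rewrite -real_normK ?num_real// normrM.
  have -> : 1 / 4 = (1 * 2^-1) ^+ 2 :> R by field.
  by rewrite lerXn2r ?nnegrE ?mulr_ge0// ler_pM ?dcutoff_le ?tau_le1.
move: (cutoff _ _ ^+ 2) h2 ((_ * _) ^+ 2) k2 => h h1 k k1; nra.
Qed.

Lemma gap_gt0 x : off_core x -> 0 < gap x.
Proof. by move=> Cx; apply: lt_le_trans (gap_ge Cx); rewrite mulr_gt0 ?cos2_half_gt0. Qed.

(** The field dual to the gradient G of the potential: G / sqrt (1 - |G|^2). *)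
Definition flux x i : R := gp x i / Num.sqrt (gap x).

Lemma smooth_on_gp i : smooth_on off_core (fun x => gp x i).
Proof. by apply: smooth_on_gpot => // e x; exact: off_core_pos. Qed.

Lemma smooth_on_flux i : smooth_on off_core (fun x => flux x i).
Proof.
apply: smooth_onM => //; first exact: smooth_on_gp.
have sgap : smooth_on off_core gap.
  apply: smooth_onB => //; first exact: smooth_on_cst.
  rewrite (_ : (fun x => _) = (fun x => \sum_i gp x i * gp x i)).
    by apply: smooth_on_sum => // j; apply: smooth_onM => //; exact: smooth_on_gp.
  by apply/funext => x; apply: eq_bigr => j _; rewrite expr2.
apply: smooth_onV => //; first by apply: smooth_on_sqrt => // x; exact: gap_gt0.
by move=> x Cx; rewrite gt_eqF// sqrtr_gt0 gap_gt0.
Qed.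

(** The gradient, the dual field and the charge of the model, with value 0 on the
    segment, which is a null set. *)
Definition mG x : rV := \row_i (if 1 < sg x then gp x i else 0).
Definition mV x : rV := \row_i (if 1 < sg x then flux x i else 0).
Definition mM x : R :=
  if 1 < sg x then - \sum_i partial i (fun y => flux y i) x else 0.

Lemma mG_enorm x : off_core x -> enorm (mG x) ^+ 2 = 1 - gap x.
Proof.
move=> Cx; rewrite enorm_sqr /gap opprB addrC subrK.
by apply: eq_bigr => i _; rewrite mxE Cx.
Qed.

Lemma mG_lt1 x : off_core x -> enorm (mG x) < 1.
Proof.
move=> Cx; rewrite -(ltr_pXn2r (n := 2)) ?nnegrE ?enorm_ge0// mG_enorm// expr1n.
by rewrite gtrBl gap_gt0.
Qed.

Lemma mG_dual x i : off_core x ->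
  mV x ord0 i * Num.sqrt (1 - enorm (mG x) ^+ 2) = mG x ord0 i.
Proof.
move=> Cx; rewrite mG_enorm// opprB addrC subrK !mxE Cx /flux divfK//.
by rewrite gt_eqF// sqrtr_gt0 gap_gt0.
Qed.

Lemma gp_far x i : 2 + l <= sg x -> gp x i = 0.
Proof. by move=> h; rewrite /gpot cutoff0// dcutoff0 ?mulr0 ?mul0r ?addr0//; right. Qed.

Lemma pot_far x : 2 + l <= sg x -> pot 0 l x = 0.
Proof. by move=> h; rewrite /pot cutoff0// mulr0. Qed.

Lemma sig_far x : ~ cube 0 (2 + l) x -> 2 + l <= sg x.
Proof.
move=> /existsNP[i]; rewrite mxE subr0 => /negP; rewrite -ltNge => /ltW h.
by apply: le_trans h _; exact: coord_le_sig.
Qed.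

Lemma mG_norm_le1 x i : `|mG x ord0 i| <= 1.
Proof.
have [Cx|nCx] := boolP (1 < sg x); last by rewrite mxE (negbTE nCx) normr0.
apply: le_trans (ltW (mG_lt1 Cx)); rewrite -sqrtr_sqr /enorm ler_wsqrtr//.
by rewrite (bigD1 i)//= lerDl; apply: sumr_ge0 => j _; exact: sqr_ge0.
Qed.

Lemma coord_axis2 x j : x ord0 (lift ord0 j) ^+ 2 <= axis2 x.
Proof.
by rewrite /axis2 (bigD1 j)//= lerDl; apply: sumr_ge0 => k _; exact: sqr_ge0.
Qed.

(** The field V is at most of order 1 / sqrt (cos2_half), and axis_cos2_half bounds
    the distance to the axis by a * b * sqrt (cos2_half). *)
Lemma mV_bound x i j : `|mV x ord0 i| * `|x ord0 (lift ord0 j)| <= 2 * (2 + l) ^+ 2.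
Proof.
have B0 : 0 <= 2 * (2 + l) ^+ 2 by rewrite mulr_ge0// sqr_ge0.
have [Cx|nCx] := boolP (1 < sg x); last by rewrite mxE (negbTE nCx) normr0 mul0r.
have [h|h] := leP (2 + l) (sg x).
  by rewrite mxE Cx /flux gp_far// mul0r normr0 mul0r.
have [a0 b0] := dst_gt0 (lexx 0) Cx.
have ab0 : 0 < a x * b x by rewrite mulr_gt0.
have abl : a x * b x <= (2 + l) ^+ 2.
  apply: le_trans (dst_prod_le 0 x) _.
  have s0 : 0 < sg x by exact: lt_trans Cx.
  have l20 : 0 < 2 + l by rewrite addr_gt0.
  by rewrite lerXn2r ?nnegrE// ltW.
apply: le_trans (_ : 2 * (a x * b x) <= _); last by rewrite ler_pM2l.
have ab2 : 0 <= 2 * (a x * b x) by rewrite mulr_ge0// ltW.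
rewrite -normrM -(ler_pXn2r (n := 2)) ?nnegrE// real_normK ?num_real//.
rewrite exprMn mxE Cx /flux exprMn exprVn sqr_sqrtr; last exact: ltW (gap_gt0 Cx).
have g1 : gp x i ^+ 2 <= 1.
  have := mG_norm_le1 x i; rewrite mxE Cx => g1.
  by rewrite -real_normK ?num_real// exprn_ile1.
have w := gap_ge Cx; have w0 := gap_gt0 Cx; have c0 := cos2_half_gt0 Cx.
have ax := axis_cos2_half Cx; have xj := coord_axis2 x j.
rewrite mulrAC ler_pdivrMr//.
apply: (@le_trans _ _ (x ord0 (lift ord0 j) ^+ 2)); first by rewrite ler_piMl// sqr_ge0.
apply: (le_trans xj); apply: (le_trans ax); rewrite exprMn -mulrA mulrCA.
have : 0 < (a x * b x) ^+ 2 by rewrite exprn_gt0.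
move: ((a x * b x) ^+ 2) => z z0; nra.
Qed.

End model.

(** * The divergence of the dual field *)

Section divergence.
Context {R : realType} {n : nat}.
Notation rV := 'rV[R]_n.+1.
Implicit Types (x y : rV).
Variables (l : R) (l0 : 0 < l) (dl : forall t : R, dstep t <= l / 2).

Notation a := (dst (-1) 0).
Notation b := (dst 1 0).
Notation p := (dir (-1) 0).
Notation q := (dir 1 0).
Notation sg := (sig 0).
Notation ta := (tau 0).
Notation gp := (gpot 0 l).
Notation off_core := (@off_core R n).
Notation flux := (flux l).
Notation mM := (mM l).
Let oC : open off_core := open_off_core.
Let cpos := @off_core_pos R n.
Let h1 : (1 : R) = 1 \/ (1 : R) = -1. Proof. by left. Qed.
Let hN1 : (-1 : R) = 1 \/ (-1 : R) = -1. Proof. by right. Qed.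

Lemma flux_near y i : off_core y -> sg y <= 2 -> flux y i =
  (p y i - q y i) / 2 * (Num.sqrt ((sg y * sg y - 1) / (a y * b y)))^-1.
Proof.
move=> Cy y2; have [a0 b0] := dst_gt0 (lexx 0) Cy.
rewrite /flux gapE// /gpot (cutoff1 l0 y2) (dcutoff0 l0 (or_introl y2)).
rewrite !mulr0 mul0r addr0 !mulr1; congr (_ * (Num.sqrt _)^-1).
rewrite -expr2 -(cos2_halfE Cy); by field; rewrite !gt_eqF.
Qed.

Lemma has_partial_dst e i x : e = 1 \/ e = -1 -> off_core x ->
  has_partial i (dst e 0) x (dir e 0 x i).
Proof.
move=> e1 Cx; split; last exact: (partial_dst oC cpos i e1 Cx).
exact: (smooth_on_derivable (smooth_on_dst oC cpos e1) Cx).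
Qed.

Lemma has_partial_dir e i x : e = 1 \/ e = -1 -> off_core x ->
  has_partial i (fun y => dir e 0 y i) x ((dst e 0 x)^-1 - dir e 0 x i ^+ 2 / dst e 0 x).
Proof.
move=> e1 Cx; have e0 : dst e 0 x != 0 by rewrite gt_eqF// sqrtr_gt0 cpos.
have [d1 e1'] := has_partialM
  (conj (smooth_on_derivable (i := i) (smooth_on_shf oC e i) Cx) (partial_shf e i i x))
  (has_partialV e0 (has_partial_dst i e1 Cx)).
split => //; rewrite [LHS]e1' eqxx mulr1 addrC; congr (_ + _).
by rewrite /dir; field.
Qed.

(** Only the factor 1 / (a * b * sqrt (cos2_half)) is singular; by axis_cos2_half it is
    at most the inverse of the distance to the axis. *)
Lemma div_flux x : off_core x -> sg x < 2 -> \sum_i partial i (fun y => flux y i) x =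
  (b x - a x) / (a x * b x * Num.sqrt (cos2_half x)) *
  (n%:R / 2 + (1 - \sum_i p x i * q x i) / 4).
Proof.
move=> Cx x2; have [a0 b0] := dst_gt0 (lexx 0) Cx.
have c0 := cos2_half_gt0 Cx.
have cE : (sg x * sg x - 1) / (a x * b x) = cos2_half x.
  by rewrite -expr2 -(cos2_halfE Cx); field; rewrite !gt_eqF.
have SE : sg x * sg x = 1 + a x * b x * cos2_half x.
  by rewrite cos2_halfE// -expr2 addrC subrK.
set s := \sum_i _; set K := Num.sqrt (cos2_half x).
have K0 : 0 < K by rewrite sqrtr_gt0.
have K2 : cos2_half x = K ^+ 2 by rewrite sqr_sqrtr// ltW.
have Ei i : partial i (fun y => flux y i) x =
    - (4 * K ^+ 3)^-1 * (sg x / (a x * b x) * (p x i ^+ 2 - q x i ^+ 2) -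
      K ^+ 2 / (a x * b x) * (b x * p x i ^+ 2 - a x * q x i ^+ 2 + (a x - b x) * (p x i * q x i)))
    + (2 * K)^-1 * ((a x)^-1 - (b x)^-1 - p x i ^+ 2 / a x + q x i ^+ 2 / b x).
  have nf : \forall y \near x, flux y i =
      (p y i - q y i) / 2 * (Num.sqrt ((sg y * sg y - 1) / (a y * b y)))^-1.
    apply: (@near_open _ _ (off_core `&` [set y : rV | sg y < 2])) => //.
      by apply: openI => //; exact: open_sig_lt.
    by move=> y [Cy /ltW y2]; exact: flux_near.
  rewrite (partial_near i nf).1.
  have hs : has_partial i sg x ((p x i + q x i) / 2).
    split; last exact: (partial_sig oC cpos i Cx).
    exact: (smooth_on_derivable (smooth_on_sig oC cpos) Cx).
  have ha := has_partial_dst i hN1 Cx; have hb := has_partial_dst i h1 Cx.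
  have ab0 : a x * b x != 0 by rewrite mulf_neq0// gt_eqF.
  have hc := has_partialM (has_partialB (has_partialM hs hs) (has_partial_cst i 1 x))
    (has_partialV ab0 (has_partialM ha hb)).
  have c0' : 0 < (sg x * sg x - 1) / (a x * b x) by rewrite cE.
  have sc0 : Num.sqrt ((sg x * sg x - 1) / (a x * b x)) != 0.
    by rewrite gt_eqF// sqrtr_gt0.
  have hk := has_partialV sc0 (has_partial_sqrt c0' hc).
  have hpq := has_partialM (has_partialB (has_partial_dir i hN1 Cx)
    (has_partial_dir i h1 Cx)) (has_partial_cst i 2^-1 x).
  have [_ ->] := has_partialM hpq hk.
  rewrite cE -/K SE K2; by field; rewrite !gt_eqF.
pose m := (4 * K ^+ 3)^-1; pose u := sg x / (a x * b x); pose w := K ^+ 2 / (a x * b x).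
transitivity (\sum_i (((a x)^-1 - (b x)^-1) / (2 * K) +
   (m * (w * b x - u) - (2 * K * a x)^-1) * p x i ^+ 2 +
   (m * (u - w * a x) + (2 * K * b x)^-1) * q x i ^+ 2 +
   m * w * (a x - b x) * (p x i * q x i))).
  apply: eq_bigr => i _; rewrite Ei /m /u /w; field.
  by rewrite !gt_eqF.
rewrite !big_split/= -!mulr_sumr (dir_sqr a0) (dir_sqr b0) -/s.
rewrite sumr_const card_ord -mulr_natl -natr1 /m /u /w; field.
by rewrite !gt_eqF.
Qed.

Lemma mM_near_bound x j : off_core x -> sg x < 2 ->
  `|mM x| * `|x ord0 (lift ord0 j)| <= n.+1%:R.
Proof.
move=> Cx x2; have [a0 b0] := dst_gt0 (lexx 0) Cx.
have c0 := cos2_half_gt0 Cx; have ax := axis_cos2_half Cx; have xj := coord_axis2 x j.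
have c1 : cos2_half x <= 1.
  have := gap_ge l0 dl Cx; have : gap l x <= 1.
    by rewrite gerBl sumr_ge0// => i _; exact: sqr_ge0.
  rewrite gapE// (cutoff1 l0 (ltW x2)) (dcutoff0 l0 (or_introl (ltW x2))).
  by rewrite mulr0 expr0n/= mul0r addr0 expr1n mul1r; lra.
rewrite /mM [1 < _]Cx normrN div_flux//.
set s := \sum_i _.
have s1 : s <= 1 by move: c1; rewrite /cos2_half -/s ler_pdivrMr//; lra.
have sN1 : -1 < s by move: c0; rewrite /cos2_half -/s ltr_pdivlMr// mul0r; lra.
have ab0 : 0 < a x * b x by rewrite mulr_gt0.
have K0 : 0 < Num.sqrt (cos2_half x) by rewrite sqrtr_gt0.
have d0 : 0 < a x * b x * Num.sqrt (cos2_half x) by rewrite mulr_gt0.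
have xb : `|x ord0 (lift ord0 j)| <= a x * b x * Num.sqrt (cos2_half x).
  rewrite -(ler_pXn2r (n := 2)) ?nnegrE ?(ltW d0)// real_normK ?num_real//.
  by rewrite exprMn sqr_sqrtr ?(ltW c0)//; exact: le_trans xj ax.
have ba : `|b x - a x| <= 2.
  by have := tau_le1 (lexx 0) x; rewrite /tau normrM normfV (ger0_norm (ler0n R 2))
    ler_pdivrMr// mul1r distrC.
rewrite normrM normrM normfV (gtr0_norm d0).
have t0 : 0 <= n%:R / 2 + (1 - s) / 4.
  by rewrite addr_ge0 ?divr_ge0 ?subr_ge0.
rewrite (ger0_norm t0).
have t1 : 2 * (n%:R / 2 + (1 - s) / 4) <= n.+1%:R.
  have -> : 2 * (n%:R / 2 + (1 - s) / 4) = n%:R + (1 - s) / 2 by field.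
  by rewrite -[n.+1%:R]natr1 lerD2l ler_pdivrMr// mul1r; lra.
have m1 : `|x ord0 (lift ord0 j)| / (a x * b x * Num.sqrt (cos2_half x)) <= 1.
  by rewrite ler_pdivrMr// mul1r.
rewrite mulrAC [X in X * _]mulrAC -[X in X * _]mulrA -mulrA [X in _ * X]mulrC mulrA.
apply: le_trans t1; rewrite -[leRHS]mulr1; apply: ler_pM => //.
- by rewrite mulr_ge0.
- by rewrite divr_ge0// ltW.
- exact: ler_wpM2r.
Qed.

End divergence.

(** * Bounds on the charge and smooth approximations of the dual field *)

Section fields.
Context {R : realType} {n : nat}.
Notation rV := 'rV[R]_n.+1.
Implicit Types (x y : rV).
Variables (l : R) (l0 : 0 < l) (dl : forall t : R, dstep t <= l / 2).

Notation p := (dir (-1) 0).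
Notation q := (dir 1 0).
Notation sg := (sig 0).
Notation off_core := (@off_core R n).
Notation flux := (flux l).
Notation mM := (mM l).
Notation mV := (mV l).
Let oC : open off_core := open_off_core.
Let cpos := @off_core_pos R n.

(** Close to the segment this is mM_near_bound; on the shell 3/2 <= sig <= 2 + l the
    charge is continuous, and outside it vanishes. *)
Lemma mM_bound : exists2 C, 0 <= C &
  forall x j, `|mM x| * `|x ord0 (lift ord0 j)| <= C.
Proof.
pose K1 : set rV := [set x | 3 / 2 <= sg x <= 2 + l].
have K1c : K1 `<=` off_core.
  by move=> x /andP[h _]; rewrite /off_core/=; apply: lt_le_trans h; lra.
have cK1 : compact K1.
  apply: (@subclosed_compact _ K1 (cube 0 (2 + l))).
  - rewrite (_ : K1 = sg @^-1` `[3 / 2, 2 + l]%classic).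
      by apply: preimage_closed; [move=> x _; exact: sig_continuous|exact: interval_closed].
    by apply/seteqP; split => x; rewrite /= in_itv.
  - exact: compact_cube.
  - move=> x /andP[_ h] i; rewrite mxE subr0; apply: le_trans h.
    exact: (coord_le_sig (lexx 0)).
have sF : smooth_on off_core (fun x => \sum_i partial i (fun y => flux y i) x).
  by apply: smooth_on_sum => // i; apply: smooth_on_partial; exact: smooth_on_flux.
have [M M0 hM] : exists2 M, 0 <= M & forall x, K1 x ->
    `|\sum_i partial i (fun y => flux y i) x| <= M.
  apply: compact_continuous_bounded => //; apply: continuous_in_subspaceT => x.
  by rewrite inE => /K1c; exact: smooth_on_cont.
exists (n.+1%:R + M * (2 + l)).
  by rewrite addr_ge0// mulr_ge0// addr_ge0// ltW.
move=> x j; have [Cx|nCx] := boolP (1 < sg x); last first.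
  by rewrite /mM (negbTE nCx) normr0 mul0r addr_ge0// mulr_ge0// addr_ge0// ltW.
have [x2|x2] := ltP (sg x) 2.
  apply: le_trans (mM_near_bound l0 dl j Cx x2) _.
  by rewrite lerDl mulr_ge0// addr_ge0// ltW.
have [xl|xl] := leP (sg x) (2 + l).
  apply: le_trans (_ : M * (2 + l) <= _); last by rewrite lerDr.
  apply: ler_pM => //.
    rewrite /mM Cx normrN; apply: hM; rewrite /K1/= xl andbT; apply: le_trans x2; lra.
  by apply: le_trans xl; exact: (coord_le_sig (lexx 0)).
rewrite /mM Cx (_ : \sum_i _ = 0) ?oppr0 ?normr0 ?mul0r.
  by rewrite addr_ge0// mulr_ge0// addr_ge0// ltW.
rewrite big1// => i _.
have [|-> _] := @partial_near _ _ (fun y => flux y i) (cst 0) x i; last exact: derive_cst.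
apply: (@near_open _ _ [set y : rV | 2 + l < sg y]) => //; first exact: open_sig_gt.
by move=> y /= /ltW yl; rewrite /flux gp_far// mul0r.
Qed.

(** A cutoff that removes a neighbourhood of the segment and depends on sig only. *)
Definition eta (k : nat) x : R := step (k.+3%:R * (sg x - 1) - 1).
Definition mPhi k i x : R := eta k x * flux x i.

Lemma eta01 k x : 0 <= eta k x <= 1. Proof. by rewrite step_ge0 step_le1. Qed.

Lemma eta_off k x : ~ off_core x -> eta k x = 0.
Proof.
move=> /negP; rewrite -leNgt => h; rewrite /eta step0// subr_le0.
apply: (@le_trans _ _ 0) => //; rewrite pmulr_rle0 ?ltr0n//; lra.
Qed.

Lemma mPhiE k i x : mPhi k i x = eta k x * mV x ord0 i.
Proof.
rewrite /mPhi mxE; case: ifPn => // /negP h.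
by rewrite (eta_off _ h) !mul0r.
Qed.

Lemma eta_cvg x : off_core x -> (fun k => eta k x) @ \oo --> (1 : R).
Proof.
move=> Cx; apply: cvg_near_cst.
have d0 : 0 < sg x - 1 by rewrite subr_gt0.
near=> k; rewrite /eta step1// lerBrDr -ler_pdivrMr//.
apply: (@le_trans _ _ k%:R); last by rewrite ler_nat; do 3 apply: leqW.
by near: k; exact: nbhs_infty_ger.
Unshelve. all: by end_near. Qed.

Lemma mPhi_cvg i x : (fun k => mPhi k i x) @ \oo --> mV x ord0 i.
Proof.
under eq_fun do rewrite mPhiE.
have [Cx|nCx] := pselect (off_core x).
  suff : (fun k => eta k x * mV x ord0 i) @ \oo --> 1 * mV x ord0 i by rewrite mul1r.
  by apply: cvgM; [exact: eta_cvg|exact: cvg_cst].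
rewrite mxE ifN; last exact/negP.
by under eq_fun do rewrite mulr0; exact: cvg_cst.
Qed.

Lemma eta_zero k x : sg x < 1 + k.+3%:R^-1 -> eta k x = 0.
Proof.
move=> h; rewrite /eta step0// subr_le0 -ler_pdivlMl ?ltr0n// mulr1.
by rewrite lerBlDl ltW.
Qed.

Let smooth_eta_arg k : smooth_on off_core (fun x => k.+3%:R * (sg x - 1) - 1).
Proof.
apply: smooth_onB => //; last exact: smooth_on_cst.
apply: smooth_onM => //; first exact: smooth_on_cst.
by apply: smooth_onB => //; [exact: smooth_on_sig|exact: smooth_on_cst].
Qed.

Lemma smooth_mPhi k i : smooth_on setT (mPhi k i).
Proof.
have -> : setT = off_core `|` [set x : rV | sg x < 1 + k.+3%:R^-1].
  apply/seteqP; split => // x _; have [h|h] := ltP 1 (sg x); [by left|right].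
  by apply: le_lt_trans h _; rewrite ltrDl invr_gt0.
apply: smooth_onU.
  apply: smooth_onM => //; last exact: smooth_on_flux.
  by apply: smooth_on_step.
apply: (@smooth_on_near _ _ _ _ (fun=> 0)); first exact: open_sig_lt.
  by move=> x /eta_zero h; rewrite /mPhi h mul0r.
by apply: smooth_on_cst; exact: open_sig_lt.
Qed.

(** The derivative of the cutoff does not contribute: where it is not 0, the field
    is parallel to the gradient of tau, hence orthogonal to that of sig. So the
    segment carries no charge in the limit. *)
Lemma div_mPhi k x : \sum_i partial i (mPhi k i) x = - (eta k x * mM x).
Proof.
have [Cx|nCx] := pselect (off_core x); last first.
  rewrite eta_off// mul0r oppr0 big1// => i _.
  have [|-> _] := @partial_near _ _ (mPhi k i) (cst 0) x i; last exact: derive_cst.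
  apply: (@near_open _ _ [set x : rV | sg x < 1 + k.+3%:R^-1]).
  - exact: open_sig_lt.
  - move/negP : nCx; rewrite -leNgt /= => /le_lt_trans; apply.
    by rewrite ltrDl invr_gt0.
  - by move=> y /eta_zero h; rewrite /mPhi h mul0r.
have [a0 b0] := dst_gt0 (lexx 0) Cx.
pose t := k.+3%:R * (sg x - 1) - 1.
have he i : has_partial i (eta k) x (dstep t * (k.+3%:R * ((p x i + q x i) / 2))).
  have hs : has_partial i sg x ((p x i + q x i) / 2).
    split; last exact: (partial_sig oC cpos i Cx).
    exact: (smooth_on_derivable (smooth_on_sig oC cpos) Cx).
  have ht := has_partialB (has_partialM (has_partial_cst i k.+3%:R x)
    (has_partialB hs (has_partial_cst i 1 x))) (has_partial_cst i 1 x).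
  have [d1 e1] := partial_comp (derive_step t).1 ht.1.
  split => //; rewrite e1 (derive_step _).2 ht.2.
  by rewrite !subr0 mulr0 addr0.
have hP i : partial i (mPhi k i) x = eta k x * partial i (fun y => flux y i) x +
    flux x i * (dstep t * (k.+3%:R * ((p x i + q x i) / 2))).
  exact: (has_partialM (he i) (has_partial_smooth i (smooth_on_flux l0 dl i) Cx)).2.
rewrite (eq_bigr _ (fun i _ => hP i)) big_split/= -mulr_sumr /mM [1 < _]Cx mulrN opprK.
rewrite [X in _ + X](_ : _ = 0) ?addr0//.
have [x2|x2] := leP (sg x) 2.
  transitivity (\sum_i ((dstep t * k.+3%:R * (Num.sqrt ((sg x * sg x - 1) /
     (dst (-1) 0 x * dst 1 0 x)))^-1 / 4) * (p x i ^+ 2 - q x i ^+ 2))).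
    apply: eq_bigr => i _; rewrite flux_near//.
    by move: ((Num.sqrt _)^-1) (dstep t) => z w; field.
  by rewrite -mulr_sumr sumrB (dir_sqr a0) (dir_sqr b0) subrr mulr0.
rewrite big1// => i _; rewrite dstep0 ?mul0r ?mulr0//; right.
rewrite /t lerBrDr; apply: (@le_trans _ _ k.+3%:R); first by rewrite (ler_nat R 2).
by rewrite ler_peMr//; lra.
Qed.

Lemma mPhi_supp k i x : ~ cube 0 (2 + l) x -> mPhi k i x = 0.
Proof.
by move=> /sig_far h; rewrite /mPhi /flux gp_far// mul0r mulr0.
Qed.

End fields.

(** * Rescaling and Lipschitz bounds *)

Section rescaling.
Context {R : realType} {n : nat}.
Implicit Types (c x : 'rV[R]_n) (r : R).

Definition rescale c r x : 'rV[R]_n := r^-1 *: (x - c).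

Lemma rescaleE c r x i : rescale c r x ord0 i = (x ord0 i - c ord0 i) / r.
Proof. by rewrite !mxE mulrC. Qed.

Lemma rescale_continuous c r : continuous (rescale c r).
Proof.
move=> x; apply: (@continuous_comp _ _ _ (fun x => x - c) ( *:%R r^-1)).
  by apply: continuousB; [exact: cvg_id|exact: cst_continuous].
exact: scaler_continuous.
Qed.

Lemma partial_rescale c r (f : 'rV[R]_n -> R) i x :
  derivable f (rescale c r x) (basis_vec i) ->
  has_partial i (fun y => f (rescale c r y)) x (r^-1 * partial i f (rescale c r x)).
Proof.
move=> df; pose F (h : R) := f (h *: basis_vec i + rescale c r x).
have [e1 d1] : 'D_(basis_vec i) f (rescale c r x) = 'D_1 F 0 /\
    (derivable f (rescale c r x) (basis_vec i) <-> derivable F 0 1).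
  by apply: derive_along => h; rewrite /F addr0 /GRing.scale/= mulr1.
have [e2 d2] : 'D_(basis_vec i) (fun y => f (rescale c r y)) x =
    'D_1 (fun h : R => F (h * r^-1)) 0 /\
    (derivable (fun y => f (rescale c r y)) x (basis_vec i) <->
     derivable (fun h : R => F (h * r^-1)) 0 1).
  apply: derive_along => h; rewrite /F addr0 /GRing.scale/= mulr1; congr f.
  by rewrite /rescale -addrA scalerDr scalerA [r^-1 * h]mulrC.
have did : derivable (@id R) (0 : R) 1 by exact: derivable_id.
have dcst : derivable (cst r^-1) (0 : R) 1 by exact: derivable_cst.
have dm : derivable (fun h : R => h * r^-1) 0 1 by exact: (derivableM did dcst).
have em : 'D_1 (fun h : R => h * r^-1) (0 : R) = r^-1.
  rewrite (deriveM did dcst).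
  by rewrite derive_cst derive_id /GRing.scale/= mulr0 add0r mulr1.
have dF : derivable F (0 * r^-1) 1 by rewrite mul0r; exact: (d1.1 df).
have [d3 e3] := derive_comp1 dm dF.
by split; [apply/d2|rewrite [LHS]e2 e3 mul0r -e1 em mulrC].
Qed.

Lemma smooth_rescale c r (f : 'rV[R]_n -> R) : smooth_on setT f ->
  smooth_on setT (fun x => f (rescale c r x)).
Proof.
move=> sf.
apply: (@smooth_on_coind _ _ (fun g => exists k f, smooth_on setT f /\
   g = fun x => k * f (rescale c r x))).
- exact: openT.
- move=> g x [k [{sf}f [sf ->]]] _.
  have cf : {for rescale c r x, continuous f} by exact: smooth_on_cont sf _.
  split.
    have cfT : {for x, continuous (fun x => f (rescale c r x))}.
      exact: (continuous_comp (@rescale_continuous c r x) cf).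
    exact: (continuousM (@cst_continuous _ _ k x) cfT).
  move=> i; have df : derivable f (rescale c r x) (basis_vec i).
    exact: smooth_on_derivable sf _.
  exact: (has_partialM (has_partial_cst i k x) (partial_rescale df)).1.
- move=> g i [k [{sf}f [sf ->]]].
  exists (fun x => (k * r^-1) * partial i f (rescale c r x)).
    by exists (k * r^-1), (partial i f); split => //; exact: smooth_on_partial.
  move=> x _; have df : derivable f (rescale c r x) (basis_vec i).
    exact: smooth_on_derivable sf _.
  rewrite (has_partialM (has_partial_cst i k x) (partial_rescale df)).2.
  by rewrite mulr0 addr0 mulrA.
- by exists 1, f; split => //; apply/funext => x; rewrite mul1r.
Qed.

Lemma hyperplane_null (r t : R) (j : 'I_n) : 0 <= r ->
  {ae (@lebesgue_rV R n), forall x, cube 0 r x -> x ord0 j != t}.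
Proof.
move=> r0; pose A (i : 'I_n) : set R := if i == j then [set t] else `[- r, r]%classic.
have mA i : measurable (A i).
  by rewrite /A; case: ifP => _; [exact: measurable_set1|exact: measurable_itv].
exists [set x : 'rV[R]_n | forall i, A i (x ord0 i)]; split.
- exact: measurable_box.
- rewrite lebesgue_rV_prod// (eq_bigr (fun i => (if i == j then 0 else 2 * r)%:E)).
    by rewrite prodEFin (bigD1 j)//= eqxx mul0r.
  move=> i _; rewrite /A; case: ifP => _; first by rewrite lebesgue_measure_set1.
  rewrite lebesgue_measure_itv/= lte_fin -EFinD; case: ifPn => [_|].
    by congr EFin; ring.
  by rewrite -leNgt => h; congr EFin; lra.
- move=> x /= /not_implyP[xr /negP]; rewrite negbK => /eqP xt i.
  rewrite /A; case: eqP => [->//|_] /=; rewrite in_itv/= -ler_norml.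
  by have := xr i; rewrite mxE subr0.
Qed.

End rescaling.

Section potential.
Context {R : realType} {n : nat}.
Notation rV := 'rV[R]_n.+1.
Notation leb := (@lebesgue_rV R n.+1).
Implicit Types (x y : rV).
Variables (l : R) (l0 : 0 < l) (dl : forall t : R, dstep t <= l / 2).
Notation off_core := (@off_core R n).

Lemma shf_le_dst e d x i : 0 <= d -> `|shf e x i| <= dst e d x.
Proof.
move=> d0; rewrite -sqrtr_sqr /dst ler_wsqrtr// /dist2 (bigD1 i)//= -addrA lerDl.
by rewrite addr_ge0// sumr_ge0// => j _; exact: sqr_ge0.
Qed.

Lemma dir_le1 e d x i : 0 <= d -> `|dir e d x i| <= 1.
Proof.
move=> d0; rewrite /dir normrM normfV (ger0_norm (dst_ge0 e d x)).
have [->|h] := eqVneq (dst e d x) 0; first by rewrite invr0 mulr0.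
by rewrite ler_pdivrMr ?mul1r ?shf_le_dst// lt_neqAle eq_sym h dst_ge0.
Qed.

Lemma dst_lipschitz e x y : `|dst e 0 x - dst e 0 y| <= n.+1%:R * `|x - y|.
Proof.
set A := dst e 0 x; set B := dst e 0 y.
have A0 : 0 <= A by exact: dst_ge0. have B0 : 0 <= B by exact: dst_ge0.
have [AB|AB] := eqVneq (A + B) 0.
  have [-> ->] : A = 0 /\ B = 0 by split; lra.
  by rewrite subrr normr0 mulr_ge0.
have AB0 : 0 < A + B by rewrite lt_neqAle eq_sym AB addr_ge0.
rewrite -(ler_pM2r AB0) -{1}(gtr0_norm AB0) -normrM -subr_sqr.
have E e' z : dst e' 0 z ^+ 2 = \sum_i shf e' z i ^+ 2.
  by rewrite sqr_sqrtr ?dist2_ge0// /dist2 addr0.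
rewrite !E -sumrB; apply: le_trans (ler_norm_sum _ _ _) _.
apply: (@le_trans _ _ (\sum_(i < n.+1) `|x - y| * (A + B))).
  apply: ler_sum => i _; rewrite subr_sqr normrM; apply: ler_pM => //.
    rewrite /shf opprB addrA subrK; apply: le_trans (rV_coord_le (x - y) i).
    by rewrite !mxE.
  by apply: le_trans (ler_normD _ _) _; rewrite lerD ?shf_le_dst.
by rewrite sumr_const card_ord -[leLHS]mulr_natl mulrA.
Qed.

Lemma cutoff_lipschitz s t : `|cutoff l s - cutoff l t| <= 2^-1 * `|s - t|.
Proof.
wlog st : s t / s <= t => [h|].
  have [st|/ltW ts] := leP s t; first exact: h.
  by rewrite distrC [X in _ * X]distrC; exact: h.
have [||c _ E] := @MVT_segment R (cutoff l) (dcutoff l) s t st.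
- by move=> u _; have [h1 h2] := derive_cutoff l u; split.
- apply: continuous_subspaceT => u.
  exact: derivable1_continuous (derive_cutoff l u).1.
by rewrite distrC E normrM [X in _ * X <= _]distrC ler_wpM2r// dcutoff_le.
Qed.

Lemma pot_lipschitz x y : `|pot 0 l x - pot 0 l y| <= (2 * n.+1%:R) * `|x - y|.
Proof.
have ha := dst_lipschitz (-1) x y; have hb := dst_lipschitz 1 x y.
set N := n.+1%:R * _ in ha hb.
have N0 : 0 <= N by exact: le_trans ha.
have hs : `|sig 0 x - sig 0 y| <= N.
  have -> : sig 0 x - sig 0 y = ((dst (-1) 0 x - dst (-1) 0 y) + (dst 1 0 x - dst 1 0 y)) / 2.
    by rewrite /sig; field.
  rewrite normrM normfV (ger0_norm (ler0n R 2)) ler_pdivrMr//.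
  by apply: le_trans (ler_normD _ _) _; lra.
have ht : `|tau 0 x - tau 0 y| <= N.
  have -> : tau 0 x - tau 0 y = ((dst (-1) 0 x - dst (-1) 0 y) - (dst 1 0 x - dst 1 0 y)) / 2.
    by rewrite /tau; field.
  rewrite normrM normfV (ger0_norm (ler0n R 2)) ler_pdivrMr//.
  by apply: le_trans (ler_normB _ _) _; lra.
have -> : pot 0 l x - pot 0 l y = tau 0 x * (cutoff l (sig 0 x) - cutoff l (sig 0 y)) +
   (tau 0 x - tau 0 y) * cutoff l (sig 0 y) by rewrite /pot; ring.
have -> : 2 * n.+1%:R * `|x - y| = 1 * N + N * 1 by rewrite /N; ring.
have gen (t u t' u' : R) : `|t| <= 1 -> `|u| <= N -> `|t'| <= N -> `|u'| <= 1 ->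
    `|t * u + t' * u'| <= 1 * N + N * 1.
  move=> *; apply: le_trans (ler_normD _ _) _; rewrite !normrM.
  by apply: lerD; apply: ler_pM.
apply: gen => //.
- exact: (tau_le1 (lexx 0)).
- apply: le_trans (cutoff_lipschitz _ _) _.
  by rewrite mulrC ler_pdivrMr// (le_trans hs)//; lra.
- by rewrite ger0_norm ?cutoff_ge0// cutoff_le1.
Qed.

Lemma pot_le1 d x : 0 <= d -> `|pot d l x| <= 1.
Proof.
move=> d0; rewrite /pot normrM mulr_ile1//; first exact: tau_le1.
by rewrite ger0_norm ?cutoff_ge0// cutoff_le1.
Qed.

Lemma gpot_le2 d x i : 0 <= d -> `|gpot d l x i| <= 2.
Proof.
move=> d0; have pq := dir_le1 (-1) x i d0; have qq := dir_le1 1 x i d0.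
have gen (t u t' u' v : R) : `|t| <= 1 -> `|u| <= 1 -> `|t'| <= 1 -> `|u'| <= 1 ->
    `|v| <= 1 -> `|t * u + t' * u' * v| <= 2.
  move=> *; apply: le_trans (ler_normD _ _) _; rewrite !normrM.
  have -> : (2 : R) = 1 * 1 + 1 * 1 * 1 by ring.
  apply: lerD; first exact: ler_pM.
  by apply: ler_pM => //; exact: ler_pM.
have half (s t : R) : `|s| <= 1 -> `|t| <= 1 -> `|(s + t) / 2| <= 1.
  move=> hs ht; rewrite normrM normfV (ger0_norm (ler0n R 2)) ler_pdivrMr// mul1r.
  by apply: le_trans (ler_normD _ _) _; lra.
apply: gen.
- by apply: half; rewrite ?normrN.
- by rewrite ger0_norm ?cutoff_ge0// cutoff_le1.
- exact: tau_le1.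
- by apply: le_trans (dcutoff_le l0 dl _) _; rewrite invf_le1// ler1n.
- exact: half.
Qed.

Lemma pot_focus (e : R) : e = 1 \/ e = -1 -> pot 0 l (e *: basis_vec ord0 : rV) = e.
Proof.
have ax e' : axis2 (e' *: basis_vec ord0 : rV) = 0.
  by rewrite /axis2 big1// => j _; rewrite !mxE/= mulr0 expr0n.
have D e' e'' : dst e' 0 (e'' *: basis_vec ord0 : rV) = `|e'' - e'|.
  by rewrite /dst dist2E ax !addr0 !mxE !eqxx mulr1 sqrtr_sqr.
have n2 : `|1 + 1 : R| = 2 by rewrite ger0_norm.
have nn2 : `|-1 - 1 : R| = 2 by rewrite -opprD normrN.
move=> [->|->]; rewrite /pot /tau /sig !D ?opprK ?subrr ?normr0 ?addNr ?normr0 ?n2 ?nn2.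
  by rewrite subr0 addr0 divff// cutoff1// ?mulr1// ler1n.
by rewrite sub0r add0r mulNr divff// cutoff1// ?mulr1// ler1n.
Qed.

Lemma off_axis_off_core x (j : 'I_n) : x ord0 (lift ord0 j) != 0 -> off_core x.
Proof.
move=> xj; rewrite /off_core/= lt_neqAle sig_ge1// andbT; apply/eqP => s1.
have := axis_le (lexx 0) x; rewrite -s1 expr1n subrr mulr0 addr0 => h.
have := coord_axis2 x j; rewrite leNgt => /negP; apply; apply: le_lt_trans h _.
by rewrite lt_neqAle eq_sym sqrf_eq0 xj sqr_ge0.
Qed.

Lemma measurable_on_off_core (f : rV -> R) : smooth_on off_core f ->
  measurable_fun [set: rV] (fun x => if 1 < sig 0 x then f x else 0).
Proof.
move=> sf; have mc : measurable off_core by apply: open_measurable_rV; exact: open_off_core.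
have -> : (fun x => if 1 < sig 0 x then f x else 0) = f \_ off_core.
  by apply/funext => x; rewrite patchE; case: ifPn => h;
    [rewrite mem_set|rewrite memNset//; exact/negP].
apply/(measurable_restrictT f mc).
apply: continuous_open_measurable_rV; first exact: open_off_core.
by move=> x; exact: smooth_on_cont.
Qed.

Lemma measurable_mG i : measurable_fun [set: rV] (fun x => mG l x ord0 i).
Proof. by under eq_fun do rewrite mxE; apply: measurable_on_off_core; exact: smooth_on_gp. Qed.

Lemma measurable_mV i : measurable_fun [set: rV] (fun x => mV l x ord0 i).
Proof. by under eq_fun do rewrite mxE; apply: measurable_on_off_core; exact: smooth_on_flux. Qed.

Lemma measurable_mM : measurable_fun [set: rV] (mM l).
Proof.
have oC := @open_off_core R n.
apply: (@measurable_on_off_core (fun x => - \sum_i partial i (fun y => flux l y i) x)).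
apply: smooth_onN => //; apply: smooth_on_sum => // i.
by apply: smooth_on_partial; exact: smooth_on_flux.
Qed.

Lemma measurable_rescale (f : rV -> R) c r : measurable_fun [set: rV] f ->
  measurable_fun [set: rV] (fun x => f (rescale c r x)).
Proof.
move=> mf; apply: (measurableT_comp mf); apply: measurable_fun_rV => i.
apply: continuous_measurable_rV => x.
apply: (@continuous_comp _ _ _ (rescale c r) (fun y : rV => y ord0 i)).
  exact: rescale_continuous.
exact: coord_continuous.
Qed.

End potential.

(** * The weak gradient of the model *)

Section dominated_ae.
Context d (T : measurableType d) (R : realType) (mu : {measure set T -> \bar R}).

Lemma Rdominated_ae (D : set T) (f_ : (T -> R)^nat) (f g : T -> R) : measurable D ->
  (forall m, measurable_fun D (f_ m)) -> measurable_fun D f ->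
  {ae mu, forall x, D x -> f_ ^~ x @ \oo --> f x} ->
  mu.-integrable D (EFin \o g) ->
  (forall m x, D x -> `|f_ m x| <= g x) ->
  (fun m => \int[mu]_(x in D) f_ m x) @ \oo --> \int[mu]_(x in D) f x.
Proof.
move=> mD mf_ mf cf ig fg.
have [||||intf _ h] := @dominated_convergence _ _ _ mu D mD
  (fun m => EFin \o f_ m) (EFin \o f) (EFin \o g) _ _ _ ig _.
- by move=> m; exact/measurable_EFinP.
- exact/measurable_EFinP.
- by apply: filterS cf => x cf Dx; apply: cvg_EFin; [exact: nearW|exact: cf].
- by apply: aeW => x m Dx; rewrite lee_fin; exact: fg.
apply: (@fine_cvg _ _ _ _ (fun m => (\int[mu]_(x in D) (f_ m x)%:E)%E)).
by rewrite fineK//; exact: integrable_fin_num.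
Qed.

End dominated_ae.

Section regularisation.
Context {R : realType} {n : nat}.
Notation rV := 'rV[R]_n.+1.
Notation leb := (@lebesgue_rV R n.+1).
Implicit Types (x y : rV).
Variables (l : R) (l0 : 0 < l) (dl : forall t : R, dstep t <= l / 2).
Notation off_core := (@off_core R n).

Lemma flat_continuous k : continuous (@flat R k).
Proof. by move=> t; apply: derivable1_continuous (derive_flat k t).1. Qed.

Lemma flatN_continuous k : continuous (fun t : R => flat k (1 - t)).
Proof. by move=> t; apply: derivable1_continuous (derive_flatN k t).1. Qed.

Lemma dstep_continuous : continuous (@dstep R).
Proof.
move=> t; have d0 : flat_den t ^+ 2 != 0 by rewrite expf_neq0// gt_eqF// flat_den_gt0.
have cd : flat_den s @[s --> t] --> flat_den t.
  by apply: cvgD; [exact: flat_continuous|exact: flatN_continuous].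
apply: cvgM.
  by apply: cvgD; apply: cvgM; (exact: flat_continuous || exact: flatN_continuous).
apply: cvgV => //; rewrite expr2; under eq_fun do rewrite expr2.
exact: cvgM.
Qed.

Lemma dcutoff_continuous : continuous (@dcutoff R l).
Proof.
move=> t; apply: cvgN; apply: cvgM; last exact: cvg_cst.
apply: (@continuous_cvg _ _ _ _ _ (fun t : R => (t - 2) / l) (@dstep R)).
  exact: dstep_continuous.
by apply: cvgM; [apply: cvgB; [exact: cvg_id|exact: cvg_cst]|exact: cvg_cst].
Qed.

Let dd (m : nat) : R := m.+1%:R^-1.
Let dd0 m : 0 <= dd m. Proof. by rewrite /dd invr_ge0. Qed.
Let dd_gt0 m : 0 < dd m. Proof. by rewrite /dd invr_gt0. Qed.

Lemma dst_reg_cvg e y : (fun m => dst e (dd m) y) @ \oo --> dst e 0 y.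
Proof.
apply: continuous_cvg; first exact: sqrt_continuous.
by apply: cvgD; [exact: cvg_cst|exact: cvg_harmonic].
Qed.

Lemma sig_reg_cvg y : (fun m => sig (dd m) y) @ \oo --> sig 0 y.
Proof. by apply: cvgM; [apply: cvgD; exact: dst_reg_cvg|exact: cvg_cst]. Qed.

Lemma tau_reg_cvg y : (fun m => tau (dd m) y) @ \oo --> tau 0 y.
Proof. by apply: cvgM; [apply: cvgB; exact: dst_reg_cvg|exact: cvg_cst]. Qed.

Lemma dir_reg_cvg e y i : dst e 0 y != 0 ->
  (fun m => dir e (dd m) y i) @ \oo --> dir e 0 y i.
Proof. by move=> y0; apply: cvgM; [exact: cvg_cst|apply: cvgV => //; exact: dst_reg_cvg]. Qed.

Lemma cutoff_reg_cvg y : (fun m => cutoff l (sig (dd m) y)) @ \oo --> cutoff l (sig 0 y).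
Proof.
apply: continuous_cvg; last exact: sig_reg_cvg.
exact: derivable1_continuous (derive_cutoff l _).1.
Qed.

Lemma pot_reg_cvg y : (fun m => pot (dd m) l y) @ \oo --> pot 0 l y.
Proof. by apply: cvgM; [exact: tau_reg_cvg|exact: cutoff_reg_cvg]. Qed.

Lemma gpot_reg_cvg y i : off_core y -> (fun m => gpot (dd m) l y i) @ \oo --> mG l y ord0 i.
Proof.
move=> Cy; rewrite mxE [1 < _]Cy; have [a0 b0] := dst_gt0 (lexx 0) Cy.
have ca := @dir_reg_cvg (-1) y i ltac:(by rewrite gt_eqF).
have cb := @dir_reg_cvg 1 y i ltac:(by rewrite gt_eqF).
apply: cvgD.
  apply: cvgM; last exact: cutoff_reg_cvg.
  by apply: cvgM; [exact: cvgB|exact: cvg_cst].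
apply: cvgM; last by apply: cvgM; [exact: cvgD|exact: cvg_cst].
apply: cvgM; first exact: tau_reg_cvg.
apply: continuous_cvg; [exact: dcutoff_continuous|exact: sig_reg_cvg].
Qed.

(** Integration by parts for the regularized potential, then passage to the limit:
    the gradients are bounded and converge off the segment. *)
Lemma weak_gradient_pot (a b c : rV) (r : R) (j : 'I_n) i phi : 0 < r ->
  test_function (obox a b) phi ->
  \int[leb]_(x in obox a b) (r * pot 0 l (rescale c r x) * partial i phi x) =
  - \int[leb]_(x in obox a b) (mG l (rescale c r x) ord0 i * phi x).
Proof.
move=> r0 tphi; have mO := measurable_obox a b.
have [M1 M10 hM1] := test_bounded tphi.
have [M2 M20 hM2] := test_partial_bounded i tphi.
have mphi D : measurable_fun D phi by exact: test_measurable tphi.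
have mdphi D : measurable_fun D (partial i phi) by exact: test_partial_measurable tphi.
have icst k : leb.-integrable (obox a b) (EFin \o (fun=> k : R)).
  apply: measurable_bounded_integrable => //; first exact: lebesgue_obox_fin.
  by exists `|k|; split; [exact: num_real|move=> y /ltW y1 x _].
have oT := @openT rV.
have pos m e x : e = 1 \/ e = -1 -> setT x -> 0 < dist2 e (dd m) x.
  by move=> _ _; rewrite dist2E addrA ltr_wpDl// addr_ge0 ?sqr_ge0 ?axis2_ge0.
have sp m := smooth_rescale c r (smooth_on_pot oT (@pos m) l).
pose u m x := r * pot (dd m) l (rescale c r x).
have su m : smooth_on setT (u m).
  by apply: smooth_onM => //; exact: smooth_on_cst.
have pu m x : partial i (u m) x = gpot (dd m) l (rescale c r x) i.
  have d1 : derivable (pot (dd m) l) (rescale c r x) (basis_vec i).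
    exact: (smooth_on_derivable (smooth_on_pot oT (@pos m) l) I).
  rewrite (has_partialM (has_partial_cst i r x) (partial_rescale d1)).2.
  rewrite mulr0 addr0 mulrA divff ?gt_eqF// mul1r.
  exact: (partial_pot oT (@pos m) l i I).
have E m : \int[leb]_(x in obox a b) (u m x * partial i phi x) =
    - \int[leb]_(x in obox a b) (gpot (dd m) l (rescale c r x) i * phi x).
  rewrite (integral_partial_test i (@open_obox _ _ a b) tphi (su m)).
  by under eq_Rintegral do rewrite pu.
have mcont (f : rV -> R) : smooth_on setT f -> measurable_fun (obox a b) f.
  move=> sf; apply: measurable_funTS; apply: continuous_measurable_rV => x.
  exact: smooth_on_cont sf _.
have cv1 : (fun m => \int[leb]_(x in obox a b) (u m x * partial i phi x)) @ \oo -->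
    \int[leb]_(x in obox a b) (r * pot 0 l (rescale c r x) * partial i phi x).
  have [||||_] := @Rdominated _ _ _ leb (obox a b) (fun m x => u m x * partial i phi x)
    (fun x => r * pot 0 l (rescale c r x) * partial i phi x) (fun=> r * M2) mO; last by [].
  - by move=> m; apply: measurable_funM => //; exact: mcont.
  - move=> x _; apply: cvgM; last exact: cvg_cst.
    by apply: cvgM; [exact: cvg_cst|exact: pot_reg_cvg].
  - exact: icst.
  - move=> m x _; rewrite normrM; apply: ler_pM => //.
    by rewrite normrM (gtr0_norm r0) ler_piMr ?(ltW r0)// pot_le1.
have cv2 : (fun m => \int[leb]_(x in obox a b) (gpot (dd m) l (rescale c r x) i * phi x)) @ \oo -->
    \int[leb]_(x in obox a b) (mG l (rescale c r x) ord0 i * phi x).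
  apply: (@Rdominated_ae _ _ _ leb (obox a b) (fun m x => gpot (dd m) l (rescale c r x) i * phi x)
    (fun x => mG l (rescale c r x) ord0 i * phi x) (fun=> 2 * M1) mO).
  - move=> m; apply: measurable_funM => //; apply: mcont.
    apply: (@smooth_rescale _ _ c r (fun y => gpot (dd m) l y i)).
    by apply: smooth_on_gpot => //; exact: pos.
  - apply: measurable_funM => //; apply: measurable_funTS.
    by apply: (@measurable_rescale _ _ (fun x => mG l x ord0 i)); exact: measurable_mG.
  - have [rr rr0 sub] := compact_le_bounded_obox a b.
    have := hyperplane_null (c ord0 (lift ord0 j)) (lift ord0 j) rr0.
    apply: filterS => x hx Ox; apply: cvgM; last exact: cvg_cst.
    apply: gpot_reg_cvg; apply: (@off_axis_off_core _ _ _ j).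
    rewrite rescaleE; apply: mulf_neq0; last by rewrite invr_eq0 gt_eqF.
    by rewrite subr_eq0; apply: hx; exact: sub.
  - exact: icst.
  - by move=> m x _; rewrite normrM; apply: ler_pM => //; exact: gpot_le2.
apply: (cvg_unique (@Rhausdorff R) cv1).
by rewrite (funext E); exact: cvgN.
Qed.

End regularisation.

(** * Weak Lebesgue spaces *)

Section weak_Lp.
Context {R : realType} {n : nat}.
Notation leb := (@lebesgue_rV R n).

Lemma weak_Lp_bound (O : set 'rV[R]_n) p f : in_weak_Lp O p f ->
  exists2 C, 0 <= C & forall lam, 0 < lam ->
    (leb (O `&` [set x | lam < `|f x|]%R) <= (C / lam `^ p)%:E)%E.
Proof.
move=> [_]; set S := ereal_sup _ => Soo.
have ub lam : 0 < lam ->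
    ((lam `^ p)%:E * leb (O `&` [set x | lam < `|f x|]%R) <= S)%E.
  by move=> lam0; apply: ereal_sup_ubound; exists lam.
have S0 : (0 <= S)%E.
  apply: le_trans (ub 1 ltr01); by rewrite mule_ge0// lee_fin powR_ge0.
have SE : S = (fine S)%:E by rewrite fineK// ge0_fin_numE.
exists (fine S); first exact: fine_ge0.
move=> lam lam0; have := ub lam lam0; rewrite SE.
have lp : 0 < lam `^ p by exact: powR_gt0.
by rewrite mulrC EFinM -lee_pdivrMl// ?invr_gt0// invrK.
Qed.

(** Dyadic layers: |f|^q <= 1 + sum_j 2^(q(j+1)) 1_(|f| > 2^j). *)
Lemma weak_Lp_Lq (O : set 'rV[R]_n) p q f : measurable O -> (leb O < +oo)%E ->
  in_weak_Lp O p f -> 0 < q -> q < p ->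
  (\int[leb]_(x in O) (`|f x| `^ q)%:E < +oo)%E.
Proof.
move=> mO Ofin wf q0 qp; have [mf _] := wf.
have [C C0 hC] := weak_Lp_bound wf.
pose E j := O `&` [set x | (2 : R) ^+ j < `|f x|].
have mnf : measurable_fun O (fun x => `|f x|) by apply: measurableT_comp.
have mE j : measurable (E j).
  have := mnf mO _ (measurable_itv `](2 : R) ^+ j, +oo[); congr measurable.
  by apply/seteqP; split => x [Ox h]; split => //; move: h; rewrite /= in_itv/= ?andbT.
pose F j x : \bar R := (((2 : R) ^+ j.+1) `^ q * \1_(E j) x)%:E.
have F0 j x : (0 <= F j x)%E by rewrite lee_fin mulr_ge0 ?powR_ge0.
have mF j : measurable_fun O (F j).
  apply/measurable_EFinP; apply: measurable_funM; first exact: measurable_cst.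
  exact: measurable_indic.
have pw x : O x -> ((`|f x| `^ q)%:E <= 1 + \sum_(j <oo) F j x)%E.
  move=> Ox; have S0 : (0 <= \sum_(j <oo) F j x)%E by apply: nneseries_ge0 => j _ _; exact: F0.
  have [f1|f1] := leP `|f x| 1.
    apply: (@le_trans _ _ 1%:E); last by rewrite leeDl.
    have p1 : (1 : R) `^ q = 1 by rewrite powR1.
    by rewrite lee_fin -[leRHS]p1 ge0_ler_powR ?nnegrE// ltW.
  have [j [h1 h2]] : exists j, (2 : R) ^+ j < `|f x| /\ `|f x| <= (2 : R) ^+ j.+1.
    have ex : exists j, `|f x| <= (2 : R) ^+ j.
      have [k hk] : exists k : nat, `|f x| <= k%:R.
        by exists (Num.truncn `|f x|).+1; apply: ltW; rewrite truncnS_gt.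
      exists k; apply: le_trans hk _; rewrite -natrX ler_nat ltnW// ltn_expl//.
    case: (ex_minnP ex) => -[|j] hj min.
      by rewrite expr0 leNgt f1 in hj.
    exists j; split => //; rewrite ltNge; apply/negP => /min.
    by rewrite ltnn.
  apply: (@le_trans _ _ (F j x)).
    rewrite /F indicE mem_set// mulr1 lee_fin.
    by rewrite ge0_ler_powR ?nnegrE// ?exprn_ge0// ltW.
  apply: (@le_trans _ _ (\sum_(j <oo) F j x)%E); last by rewrite leeDr.
  apply: le_trans (nneseries_lim_ge j.+1 _); last by move=> *; exact: F0.
  rewrite big_nat_recr//= leeDr// sume_ge0// => k _; exact: F0.
apply: (@le_lt_trans _ _ (\int[leb]_(x in O) (1 + \sum_(j <oo) F j x))%E).
  apply: ge0_le_integral => //.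
  - apply/measurable_EFinP.
    exact: (measurableT_comp (measurable_powR q) mnf).
  - apply: emeasurable_funD; first exact: measurable_cst.
    by apply: ge0_emeasurable_sum => // j x _ _; exact: F0.
rewrite ge0_integralD//; last 2 first.
- by move=> x _; apply: nneseries_ge0 => j _ _; exact: F0.
- by apply: ge0_emeasurable_sum => // j x _ _; exact: F0.
rewrite integral_cst// mul1e lte_add_pinfty//.
rewrite integral_nneseries//.
pose z := (2 : R) `^ q / 2 `^ p.
have p20 : 0 < (2 : R) `^ p by rewrite powR_gt0.
have z1 : z < 1.
  rewrite /z ltr_pdivrMr// mul1r /powR (gt_eqF (ltr0n R 2)) ltr_expR ltr_pM2r//.
  by rewrite ln_gt0// ltr1n.
have z0 : 0 <= z by rewrite divr_ge0 ?powR_ge0.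
have pX k (r : R) : ((2 : R) ^+ k) `^ r = (2 `^ r) ^+ k.
  by rewrite -powR_mulrn// -powRrM mulrC powRrM powR_mulrn// powR_ge0.
have bd j : (\int[leb]_(x in O) F j x <= (C * 2 `^ q * z ^+ j)%:E)%E.
  rewrite /F; under eq_integral do rewrite EFinM.
  rewrite ge0_integralZl ?lee_fin ?powR_ge0//; last first.
    by apply/measurable_EFinP; exact: measurable_indic.
  rewrite integral_indic// setIidl; last by move=> x [].
  apply: le_trans (lee_wpmul2l _ (hC (2 ^+ j) _)) _.
  - by rewrite lee_fin powR_ge0.
  - by rewrite exprn_gt0.
  rewrite -EFinM lee_fin !pX /z exprMn exprVn exprS.
  by rewrite le_eqVlt; apply/orP; left; apply/eqP; ring.
apply: (@le_lt_trans _ _ (\sum_(j <oo) (C * 2 `^ q * z ^+ j)%:E)%E).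
  by apply: lee_nneseries => // *; apply: integral_ge0 => *; exact: F0.
apply: (@le_lt_trans _ _ (C * 2 `^ q / (1 - z))%:E); last exact: ltry.
have a0 : 0 <= C * 2 `^ q by rewrite mulr_ge0 ?powR_ge0.
have t0 j : (0 <= (C * 2 `^ q * z ^+ j)%:E)%E by rewrite lee_fin mulr_ge0// exprn_ge0.
apply: lime_le; first by apply: is_cvg_nneseries => j _ _; exact: t0.
apply: nearW => m; rewrite sumEFin lee_fin.
have -> : \sum_(0 <= j < m) (C * 2 `^ q * z ^+ j) = series (geometric (C * 2 `^ q) z) m by [].
rewrite geometric_seriesE ?lt_eqF//=; apply: ler_wpM2r.
  by rewrite invr_ge0 subr_ge0 ltW.
by rewrite ler_piMr// gerBl exprn_ge0.
Qed.

End weak_Lp.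

(** * Gluing along disjoint cubes *)

Section gluing.
Context {R : realType} {n : nat}.
Notation rV := 'rV[R]_n.+1.
Notation leb := (@lebesgue_rV R n.+1).
Variables (c : nat -> rV) (s : nat -> R).
Hypothesis disjoint_cubes : forall j k x,
  cube (c j) (s j) x -> cube (c k) (s k) x -> j = k.

Definition vanishing_off (f : nat -> rV -> R) :=
  forall k x, ~ cube (c k) (s k) x -> f k x = 0.

(** The cube that contains x; the value 0 outside of all cubes is harmless for
    families of functions that vanish off their own cubes. *)
Definition idx (x : rV) : nat := xget 0%N [set k | cube (c k) (s k) x].

(** The sum of the functions f k: at each point at most one of them is nonzero. *)
Definition glue (f : nat -> rV -> R) x := f (idx x) x.

Lemma idxE k x : cube (c k) (s k) x -> idx x = k.
Proof.
move=> Qx; rewrite /idx; case: xgetP => [j _ /= Qj|/(_ k)//].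
exact: disjoint_cubes Qj Qx.
Qed.

Lemma glue_sum f m x : vanishing_off f ->
  \sum_(k < m) f k x = if (idx x < m)%N then glue f x else 0.
Proof.
move=> f0; have z k : k != idx x -> f k x = 0.
  move=> ki; apply: f0 => /idxE ik; move: ki; by rewrite ik eqxx.
case: ifPn => [im|].
  rewrite (bigD1 (Ordinal im))//= big1 ?addr0// => k ki.
  by apply: z; apply: contra_neq ki => ki; apply: val_inj.
rewrite -leqNgt => im; apply: big1 => k _; apply: z.
by rewrite ltn_eqF// (leq_trans (ltn_ord k)).
Qed.

Lemma glue_cvg (f : nat -> nat -> rV -> R) g x :
  (forall m, vanishing_off (f m)) ->
  (fun m => f m (idx x) x) @ \oo --> g (idx x) x ->
  (fun m => \sum_(k < m) f m k x) @ \oo --> glue g x.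
Proof.
move=> f0 fg; apply: cvg_trans fg; apply: near_eq_cvg; near=> m.
rewrite glue_sum// ifT//; near: m; exact: nbhs_infty_gt.
Unshelve. all: by end_near. Qed.

Lemma measurable_glue f : (forall k, measurable_fun [set: rV] (f k)) ->
  vanishing_off f -> measurable_fun [set: rV] (glue f).
Proof.
move=> mf f0; apply: (@measurable_fun_cvg _ _ _ _ (fun m x => \sum_(k < m) f k x)).
  by move=> m; apply: measurable_sum => k; exact: mf.
by move=> x _; apply: (@glue_cvg (fun=> f)) => //; exact: cvg_cst.
Qed.

Hypothesis small : forall k, 0 < s k <= ((2 ^ k.+2)%:R)^-1.

(** A superlevel set is covered by tubes around the vertical lines through the
    centres: their heights are summable and their cross sections have volume
    of order lambda^(-n). *)
Lemma tubes_weak_Lp (O : set rV) (C : R) (f : rV -> R) : measurable O -> measurable_fun O f -> 0 <= C ->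
  (forall x, f x != 0 -> exists2 k, cube (c k) (s k) x & forall j : 'I_n,
     `|f x| * `|x ord0 (lift ord0 j) - c k ord0 (lift ord0 j)| <= C) ->
  in_weak_Lp O n%:R f.
Proof.
move=> mO mf C0 hf; split => //.
apply: (@le_lt_trans _ _ ((2 * C) ^+ n)%:E); last exact: ltry.
apply: ge_ereal_sup => _ [lam /= lam0 <-].
pose w := C / lam.
have w0 : 0 <= w by rewrite divr_ge0// ltW.
pose B k (i : 'I_n.+1) : set R :=
  if unlift ord0 i is Some j then `[c k ord0 i - w, c k ord0 i + w]%classic
  else `[c k ord0 i - s k, c k ord0 i + s k]%classic.
have mB k i : measurable (B k i) by rewrite /B; case: unlift => *; exact: measurable_itv.
pose A k := [set x : rV | forall i, B k i (x ord0 i)].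
have mA k : measurable (A k) by exact: measurable_box.
have mnf : measurable_fun O (fun x => `|f x|) by apply: measurableT_comp.
have mE : measurable (O `&` [set x | lam < `|f x|]).
  have := mnf mO _ (measurable_itv `]lam, +oo[); congr measurable.
  by apply/seteqP; split => x [Ox h]; split => //; move: h; rewrite /= in_itv/= ?andbT.
have cov : O `&` [set x | lam < `|f x|] `<=` \bigcup_k A k.
  move=> x [_ /= lx].
  have fx0 : f x != 0 by rewrite -normr_gt0 (lt_trans lam0).
  have [k Qx hk] := hf x fx0; exists k => // i; rewrite /B.
  case: unliftP => [j ->|->] /=.
    have : `|x ord0 (lift ord0 j) - c k ord0 (lift ord0 j)| <= w.
      rewrite /w ler_pdivlMr// mulrC; apply: le_trans (hk j).
      by rewrite ler_wpM2r// ltW.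
    by rewrite ler_distl in_itv.
  by have := Qx ord0; rewrite ler_distl in_itv.
have li (u v : R) : 0 <= v -> lebesgue_measure (`[u - v, u + v]%classic : set R) = (2 * v)%:E.
  move=> v0; rewrite lebesgue_measure_itv/= lte_fin -EFinD.
  case: ifPn => [_|]; first by congr EFin; ring.
  by rewrite -leNgt => h; congr EFin; lra.
have w20 : 0 <= (2 * w) ^+ n by rewrite exprn_ge0// mulr_ge0.
have lA k : (leb (A k) <= ((2 * w) ^+ n / (2 ^ k.+1)%:R)%:E)%E.
  have /andP[s0 s1] := small k.
  have -> := lebesgue_rV_prod (mB k).
  rewrite big_ord_recl {1}/B unlift_none li ?(ltW s0)//.
  rewrite (eq_bigr (fun=> (2 * w)%:E)); last first.
    by move=> i _; rewrite /B liftK li.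
  rewrite prodEFin big_const_ord iter_mulr_1 -EFinM lee_fin mulrC.
  rewrite ler_wpM2l//.
  have -> : ((2 ^ k.+1)%:R : R)^-1 = 2 * ((2 ^ k.+2)%:R)^-1.
    by rewrite [in RHS]expnS natrM invfM mulrA divff// mul1r.
  by rewrite ler_wpM2l.
have : (leb (O `&` [set x | (lam < `|f x|)%R]) <= ((2 * w) ^+ n)%:E)%E.
  apply: (@le_trans _ _ (\sum_(k <oo) leb (A k))%E).
    exact: (measure_sigma_subadditive leb mA mE cov).
  apply: le_trans (epsilon_trick0 xpredT _); last by [].
  exact: lee_nneseries.
have lp : 0 <= lam `^ n%:R by exact: powR_ge0.
move=> h; apply: le_trans (lee_wpmul2l _ h) _; first by rewrite lee_fin.
rewrite -EFinM lee_fin (powR_mulrn _ (ltW lam0)) -exprMn /w.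
by rewrite mulrCA [lam * _]mulrC divfK ?lt0r_neq0.
Qed.

End gluing.

(** * The example *)

Section sums.
Context {R : realType}.

Lemma Rintegral_bigsum d (T : measurableType d) (mu : {measure set T -> \bar R})
    (D : set T) (I : Type) (r : seq I) (F : I -> T -> R) : measurable D ->
  (forall i, mu.-integrable D (EFin \o F i)) ->
  mu.-integrable D (EFin \o (fun x => \sum_(i <- r) F i x)) /\
  \int[mu]_(x in D) (\sum_(i <- r) F i x) = \sum_(i <- r) \int[mu]_(x in D) F i x.
Proof.
move=> mD iF; elim: r => [|i r [IH1 IH2]].
  have -> : (fun x => \sum_(i <- [::]) F i x) = cst 0.
    by apply/funext => x; rewrite big_nil.
  by rewrite big_nil Rintegral_cst// mul0r; split => //; exact: integrable0.
have -> : (fun x => \sum_(j <- i :: r) F j x) = (fun x => F i x + \sum_(j <- r) F j x).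
  by apply/funext => x; rewrite big_cons.
rewrite big_cons -IH2 RintegralD//; split => //.
exact: (integrableD mD (iF i) IH1).
Qed.

Lemma partial_sum n (I : Type) (r : seq I) (F : I -> 'rV[R]_n -> R) i x :
  (forall k, derivable (F k) x (basis_vec i)) ->
  has_partial i (fun y => \sum_(k <- r) F k y) x (\sum_(k <- r) partial i (F k) x).
Proof.
move=> dF; elim: r => [|k r [IH1 IH2]].
  have -> : (fun y => \sum_(k <- [::]) F k y) = cst 0.
    by apply/funext => y; rewrite big_nil.
  by rewrite big_nil; exact: has_partial_cst.
have -> : (fun y => \sum_(j <- k :: r) F j y) = (fun y => F k y + \sum_(j <- r) F j y).
  by apply/funext => y; rewrite big_cons.
have [d e] := partialD (dF k) IH1.
by rewrite /has_partial big_cons -IH2.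
Qed.

End sums.

Section example.
Context {R : realType} {n : nat}.
Notation rV := 'rV[R]_n.+1.
Notation leb := (@lebesgue_rV R n.+1).
Variables (l : R) (l0 : 0 < l) (dl : forall t : R, dstep t <= l / 2).
Variables (c : nat -> rV) (s : nat -> R).
Hypothesis disjoint_cubes : forall j k x,
  cube (c j) (s j) x -> cube (c k) (s k) x -> j = k.
Hypothesis small : forall k, 0 < s k <= ((2 ^ k.+2)%:R)^-1.
Hypothesis c_in : forall k, cube 0 1 (c k).
Hypothesis n1 : (1 < n)%N.

Let j0 : 'I_n := Ordinal (ltnW n1).
Definition scale k : R := s k / (2 + l).
(** The similarity that maps the k-th cube onto the cube of half-side 2 + l, which
    contains the support of the model. *)
Definition chart k (x : rV) : rV := rescale (c k) (scale k) x.
Notation Q k := (cube (c k) (s k)).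
Notation vanishing_off := (vanishing_off c s).
Notation glue := (glue c s).
Notation idx := (idx c s).

Let l2 : 0 < 2 + l. Proof. by rewrite addr_gt0. Qed.
Let s0 k : 0 < s k. Proof. by have /andP[] := small k. Qed.
Let s1 k : s k <= 4^-1.
Proof.
have /andP[_ h] := small k; apply: le_trans h _.
rewrite lef_pV2 ?posrE ?ltr0n ?expn_gt0//.
by rewrite ler_nat (@leq_pexp2l 2 2).
Qed.
Lemma scale_gt0 k : 0 < scale k. Proof. by rewrite divr_gt0. Qed.
Lemma scale_le1 k : scale k <= 8^-1.
Proof.
rewrite /scale ler_pdivrMr//; apply: le_trans (s1 k) _.
move: l0; lra.
Qed.

Lemma cube_chart k x : cube 0 (2 + l) (chart k x) <-> Q k x.
Proof.
have e i : (`|chart k x ord0 i - (0 : rV) ord0 i| <= 2 + l) = (`|x ord0 i - c k ord0 i| <= s k).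
  rewrite [X in _ - X]mxE subr0 rescaleE normrM normfV (gtr0_norm (scale_gt0 k)).
  by rewrite ler_pdivrMr ?scale_gt0// /scale mulrC divfK// lt0r_neq0.
by split => h i; have := h i; rewrite e.
Qed.

Lemma chart_far k (x : rV) : ~ Q k x -> 2 + l <= sig 0 (chart k x).
Proof. by move=> h; apply: sig_far => // /cube_chart. Qed.

Lemma Q_sub k : Q k `<=` cube 0 2.
Proof.
move=> x h i; have := h i; have := c_in k i; rewrite [X in _ - X]mxE !subr0 => h1 h2.
rewrite [X in _ - X]mxE subr0; move: h1 h2.
by have := s1 k; rewrite !ler_norml; lra.
Qed.

(** Lengths scale by the factor scale k: the potential is multiplied by it, the
    gradient and the dual field are invariant, the charge is divided by it. *)
Definition Uk k x : R := scale k * pot 0 l (chart k x).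
Definition Gk i k x : R := mG l (chart k x) ord0 i.
Definition Vk i k x : R := mV l (chart k x) ord0 i.
Definition Mk k x : R := (scale k)^-1 * mM l (chart k x).

Lemma Uk_off : vanishing_off Uk.
Proof. by move=> k x h; rewrite /Uk pot_far ?mulr0//; exact: chart_far. Qed.

Lemma Gk_off i : vanishing_off (Gk i).
Proof.
by move=> k x h; rewrite /Gk mxE; case: ifP => // _; rewrite gp_far//; exact: chart_far.
Qed.

Lemma Vk_off i : vanishing_off (Vk i).
Proof.
move=> k x h; rewrite /Vk mxE; case: ifP => // _.
by rewrite /flux gp_far ?mul0r//; exact: chart_far.
Qed.

Lemma mM_off (x : rV) : ~ cube 0 (2 + l) x -> mM l x = 0.
Proof.
move=> h; have [Cx|Cx] := boolP (1 < sig 0 x); last by rewrite /mM (negbTE Cx).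
have z k : eta k x * mM l x = 0.
  apply: oppr_inj; rewrite oppr0 -(div_mPhi l0 dl) big1// => i _.
  by apply: partial_supp h; move=> y; exact: mPhi_supp.
have h1 : (fun k => eta k x * mM l x) @ \oo --> 1 * mM l x.
  by apply: cvgMl; exact: eta_cvg.
have h2 : (fun k => eta k x * mM l x) @ \oo --> (0 : R).
  by under eq_fun do rewrite z; exact: cvg_cst.
by have := cvg_unique _ h1 h2; rewrite mul1r; apply.
Qed.

Lemma Mk_off : vanishing_off Mk.
Proof. by move=> k x h; rewrite /Mk mM_off ?mulr0// => /cube_chart. Qed.

Definition potential := glue Uk.
Definition charge := glue Mk.
Definition gradient x : rV := mG l (chart (idx x) x).
Definition dual_field x : rV := mV l (chart (idx x) x).

Let mchart (f : rV -> R) k : measurable_fun [set: rV] f ->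
  measurable_fun [set: rV] (fun x => f (chart k x)).
Proof. exact: measurable_rescale. Qed.

Lemma measurable_Uk k : measurable_fun [set: rV] (Uk k).
Proof.
apply: measurable_funM; first exact: measurable_cst.
apply: (mchart (f := pot 0 l)); apply: continuous_measurable_rV => x.
apply: (iffRL (@cvgrPdist_le _ _ _ (nbhs x) _ _ _)) => e e0.
near=> y; apply: le_trans (pot_lipschitz l0 dl x y) _.
rewrite mulrC -ler_pdivlMr ?mulr_gt0//; near: y.
by apply: cvgr_dist_le => //; rewrite divr_gt0 ?mulr_gt0.
Unshelve. all: by end_near. Qed.

Lemma measurable_potential : measurable_fun [set: rV] potential.
Proof. by apply: measurable_glue => //; [exact: measurable_Uk|exact: Uk_off]. Qed.

Lemma measurable_gradient i : measurable_fun [set: rV] (fun x => gradient x ord0 i).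
Proof.
apply: (measurable_glue disjoint_cubes (f := Gk i)); last exact: Gk_off.
by move=> k; apply: (mchart (f := fun x => mG l x ord0 i)); exact: measurable_mG.
Qed.

Lemma measurable_dual_field i : measurable_fun [set: rV] (fun x => dual_field x ord0 i).
Proof.
apply: (measurable_glue disjoint_cubes (f := Vk i)); last exact: Vk_off.
by move=> k; apply: (mchart (f := fun x => mV l x ord0 i)); exact: measurable_mV.
Qed.

Lemma measurable_charge : measurable_fun [set: rV] charge.
Proof.
apply: (measurable_glue disjoint_cubes); last exact: Mk_off.
move=> k; apply: measurable_funM; first exact: measurable_cst.
by apply: (mchart (f := mM l)); exact: measurable_mM.
Qed.

Lemma glue_neq0 f (x : rV) : vanishing_off f -> glue f x != 0 -> Q (idx x) x.
Proof. by move=> f0 h; apply: contrapT => /f0 e; move: h; rewrite /glue e eqxx. Qed.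

Lemma chart_coord k (x : rV) i : x ord0 i - c k ord0 i = scale k * chart k x ord0 i.
Proof. by rewrite rescaleE mulrC divfK// lt0r_neq0// scale_gt0. Qed.

Lemma charge_weak_Lp O : measurable O -> in_weak_Lp O n%:R charge.
Proof.
move=> mO; have [C C0 hC] := @mM_bound R n l l0 dl.
apply: (@tubes_weak_Lp _ _ c s small O C) => //.
  exact: measurable_funS measurable_charge.
move=> x /(glue_neq0 Mk_off) Qx; exists (idx x) => // j.
rewrite chart_coord /charge /glue /Mk.
have := scale_gt0 (idx x); move: (chart _ x) (scale _) => y a a0.
rewrite !normrM mulrACA normfV mulVf ?mul1r//.
by rewrite normr_eq0 lt0r_neq0.
Qed.

Lemma dual_field_weak_Lp O i : measurable O -> in_weak_Lp O n%:R (fun x => dual_field x ord0 i).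
Proof.
move=> mO; have C0 : 0 <= 2 * (2 + l) ^+ 2 by rewrite mulr_ge0// exprn_ge0// ltW.
apply: (@tubes_weak_Lp _ _ c s small O (2 * (2 + l) ^+ 2)) => //.
  exact: measurable_funS (measurable_dual_field i).
move=> x /(glue_neq0 (@Vk_off i)) Qx; exists (idx x) => // j.
rewrite chart_coord /dual_field.
have := scale_gt0 (idx x); have := scale_le1 (idx x).
move: (chart _ x) (scale _) => y a a1 a0.
rewrite normrM (gtr0_norm a0) mulrCA -[leRHS]mul1r.
apply: ler_pM; rewrite ?mulr_ge0 ?(ltW a0)//; last exact: mV_bound.
by apply: le_trans a1 _; lra.
Qed.

Definition lower : rV := const_mx (-3).
Definition upper : rV := const_mx 3.
Notation Omega := (obox lower upper).

Let mO : measurable Omega. Proof. exact: measurable_obox. Qed.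
Let oO : open Omega. Proof. exact: (@open_obox R n.+1 lower upper). Qed.

Lemma cube2_sub : cube 0 2 `<=` Omega.
Proof.
move=> x h i; have := h i; rewrite [X in _ - X]mxE subr0 ler_norml.
by rewrite ![const_mx _ _ _]mxE; lra.
Qed.

Lemma weak_Ln_integrable f : in_weak_Lp Omega n%:R f -> leb.-integrable Omega (EFin \o f).
Proof.
move=> wf; have [mf _] := wf; apply/integrableP; split; first exact/measurable_EFinP.
have n1' : 1 < n%:R :> R by rewrite ltr1n.
have := weak_Lp_Lq mO (lebesgue_obox_fin _ _) wf ltr01 n1'.
by under eq_integral do rewrite powRr1//.
Qed.

Lemma charge_integrable : leb.-integrable Omega (EFin \o charge).
Proof. exact/weak_Ln_integrable/charge_weak_Lp. Qed.

Lemma dual_field_integrable i : leb.-integrable Omega (EFin \o (fun x => dual_field x ord0 i)).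
Proof. exact/weak_Ln_integrable/dual_field_weak_Lp. Qed.

(** Test fields converging to the dual field: only the first m cubes are used, with
    a neighbourhood of their light segments removed. *)
Definition Phi m i x : R := \sum_(k < m) mPhi l m i (chart k x).
Definition Ek m k x : R := (scale k)^-1 * (eta m (chart k x) * mM l (chart k x)).

Lemma Phi_off m i : vanishing_off (fun k x => mPhi l m i (chart k x)).
Proof. by move=> k x h; rewrite mPhi_supp// => /cube_chart. Qed.

Lemma Ek_off m : vanishing_off (Ek m).
Proof. by move=> k x h; rewrite /Ek mM_off ?mulr0// => /cube_chart. Qed.

Lemma Phi_le m i x : `|Phi m i x| <= `|dual_field x ord0 i|.
Proof.
rewrite /Phi; have -> := glue_sum disjoint_cubes m x (@Phi_off m i).
case: ifP => _; last by rewrite normr0.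
rewrite /glue mPhiE normrM; have /andP[e0 e1] := eta01 m (chart (idx x) x).
by rewrite ger0_norm// ler_piMl.
Qed.

Lemma Phi_cvg i x : (fun m => Phi m i x) @ \oo --> dual_field x ord0 i.
Proof.
apply: (@glue_cvg _ _ c s disjoint_cubes (fun m k x => mPhi l m i (chart k x)) (Vk i)).
  by move=> m; exact: Phi_off.
exact: mPhi_cvg.
Qed.

Lemma sum_Ek_le m x : `|\sum_(k < m) Ek m k x| <= `|charge x|.
Proof.
rewrite (glue_sum disjoint_cubes m x (@Ek_off m)).
case: ifP => _; last by rewrite normr0.
have /andP[e0 e1] := eta01 m (chart (idx x) x).
rewrite /charge /glue /Ek /Mk mulrCA; move: e0 e1.
by move: (eta _ _) (_ * mM _ _) => e z e0 e1; rewrite normrM (ger0_norm e0) ler_piMl.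
Qed.

Lemma sum_Ek_cvg x : (fun m => \sum_(k < m) Ek m k x) @ \oo --> charge x.
Proof.
apply: (@glue_cvg _ _ c s disjoint_cubes Ek Mk); first exact: Ek_off.
rewrite /Ek /Mk; set y := chart _ _; apply: cvgM; first exact: cvg_cst.
have [Cx|Cx] := boolP (1 < sig 0 y).
  by rewrite -[X in _ --> X]mul1r; apply: cvgMl; exact: eta_cvg.
rewrite /mM (negbTE Cx); under eq_fun do rewrite mulr0; exact: cvg_cst.
Qed.

Lemma smooth_chart m i k : smooth_on setT (fun x => mPhi l m i (chart k x)).
Proof. exact: (smooth_rescale (c k) (scale k) (smooth_mPhi l0 dl m i)). Qed.

Lemma Phi_test m i : test_function Omega (Phi m i).
Proof.
apply: (@test_function_of _ _ _ (cube 0 2)).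
- apply: smooth_onT; apply: smooth_on_sum; first exact: openT.
  by move=> k; exact: smooth_chart.
- exact: compact_cube.
- exact: cube2_sub.
- move=> x h; apply: big1 => k _; apply: Phi_off => Qx; apply: h.
  exact: Q_sub Qx.
Qed.

Lemma div_Phi m x : \sum_i partial i (Phi m i) x = - \sum_(k < m) Ek m k x.
Proof.
have e i : partial i (Phi m i) x =
    \sum_(k < m) (scale k)^-1 * partial i (mPhi l m i) (chart k x).
  have [_ ->] := @partial_sum R n.+1 'I_m (index_enum 'I_m)
    (fun k x => mPhi l m i (chart k x)) i x
    (fun k => smooth_on_derivable (x := x) (i := i) (@smooth_chart m i k) I).
  apply: eq_bigr => k _.
  have [_ ->//] := @partial_rescale R n.+1 (c k) (scale k) (mPhi l m i) i x
    (smooth_on_derivable (i := i) (smooth_mPhi l0 dl m i) I).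
rewrite (eq_bigr _ (fun i _ => e i)) exchange_big/= -sumrN.
apply: eq_bigr => k _; rewrite -mulr_sumr (div_mPhi l0 dl).
by rewrite /Ek mulrN.
Qed.

(** Testing the weak gradient of w with the fields Phi gives the identity for the
    truncated field and charge; both sides converge, dominated by the integrable
    dual field and charge. *)
Lemma calibrated : calibrates lower upper charge dual_field.
Proof.
move=> w g Lw [Lg wg].
have measE m : measurable_fun Omega (fun x => \sum_(k < m) Ek m k x).
  rewrite (_ : (fun x => _) = (fun x => - \sum_i partial i (Phi m i) x)); last first.
    by apply/funext => x; rewrite div_Phi opprK.
  apply: (measurableT_comp (@oppr_measurable R setT)); apply: measurable_sum => i.
  exact: test_partial_measurable (Phi_test m i).
have AB m : \int[leb]_(x in Omega) (\sum_i Phi m i x * g x ord0 i) =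
    \int[leb]_(x in Omega) ((\sum_(k < m) Ek m k x) * w x).
  have i1 i : leb.-integrable Omega (EFin \o (fun x => Phi m i x * g x ord0 i)).
    by apply: Loo_mul_integrable (Lg i); apply: Loo_integrable; apply: test_Loo; exact: Phi_test.
  have i2 i : leb.-integrable Omega (EFin \o (fun x => w x * partial i (Phi m i) x)).
    apply: Loo_mul_integrable; first exact: Loo_integrable.
    by apply: test_partial_Loo; exact: Phi_test.
  have [_ ->] := Rintegral_bigsum (index_enum 'I_n.+1) mO i1.
  transitivity (- \int[leb]_(x in Omega) (\sum_i w x * partial i (Phi m i) x)).
    have [_ ->] := Rintegral_bigsum (index_enum 'I_n.+1) mO i2.
    rewrite -sumrN; apply: eq_bigr => i _; rewrite (wg i _ (Phi_test m i)) opprK.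
    by apply: eq_Rintegral => x _; rewrite mulrC.
  rewrite -mulN1r -RintegralZl//; last first.
    by have [] := Rintegral_bigsum (index_enum 'I_n.+1) mO i2.
  apply: eq_Rintegral => x _; rewrite -mulr_sumr div_Phi mulrN mulN1r opprK mulrC//.
have mg i : measurable_fun Omega (fun x => g x ord0 i) by have [] := Lg i.
have mw : measurable_fun Omega w by have [] := Lw.
have c1 : (fun m => \int[leb]_(x in Omega) (\sum_i Phi m i x * g x ord0 i)) @ \oo -->
    \int[leb]_(x in Omega) (\sum_i dual_field x ord0 i * g x ord0 i).
  have iD i : leb.-integrable Omega (EFin \o (fun x => `|dual_field x ord0 i * g x ord0 i|)).
    have := Loo_mul_integrable (dual_field_integrable i) (Lg i).
    by move=> /integrable_abse.
  have [iD' _] := Rintegral_bigsum (index_enum 'I_n.+1) mO iD.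
  apply: (Rdominated mO _ _ iD' _).2.
  - move=> m; apply: measurable_sum => i; apply: measurable_funM => //.
    exact: test_measurable (Phi_test m i).
  - move=> x _; apply: cvg_big => [|i _]; first exact: add_continuous.
    by apply: cvgMl; exact: Phi_cvg.
  - move=> m x _; apply: le_trans (ler_norm_sum _ _ _) _.
    by apply: ler_sum => i _; rewrite !normrM ler_wpM2r// Phi_le.
have c2 : (fun m => \int[leb]_(x in Omega) ((\sum_(k < m) Ek m k x) * w x)) @ \oo -->
    \int[leb]_(x in Omega) (charge x * w x).
  have iD : leb.-integrable Omega (EFin \o (fun x => `|charge x * w x|)).
    by have := Loo_mul_integrable charge_integrable Lw => /integrable_abse.
  apply: (Rdominated mO _ _ iD _).2.
  - by move=> m; apply: measurable_funM.
  - by move=> x _; apply: cvgMl; exact: sum_Ek_cvg.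
  - move=> m x _; rewrite normrM [leRHS]normrM ler_wpM2r//; exact: sum_Ek_le.
apply: (cvg_unique _ c1); first exact: Rhausdorff.
by rewrite (funext AB).
Qed.

Lemma Uk_lipschitz k x y : `|Uk k x - Uk k y| <= (2 * n.+1%:R) * `|x - y|.
Proof.
rewrite /Uk -mulrBr normrM (gtr0_norm (scale_gt0 k)).
apply: (@le_trans _ _ (scale k * (2 * n.+1%:R * `|chart k x - chart k y|))).
  by rewrite ler_wpM2l ?(ltW (scale_gt0 k))//; exact: pot_lipschitz.
have -> : chart k x - chart k y = (scale k)^-1 *: (x - y).
  by rewrite /chart /rescale -scalerBr opprB addrA subrK.
rewrite normrZ normfV (gtr0_norm (scale_gt0 k)) mulrCA.
by rewrite [scale k * _]mulrA divff ?mul1r// lt0r_neq0// scale_gt0.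
Qed.

(** If x and y lie in different cubes, the piece of the potential at x vanishes at
    y and conversely, so each of the two values is controlled by |x - y|. *)
Lemma potential_lipschitz x y : `|potential x - potential y| <= 2 * (2 * n.+1%:R) * `|x - y|.
Proof.
set K := 2 * n.+1%:R; have K0 : 0 <= K * `|x - y| by rewrite !mulr_ge0.
rewrite -mulrA mulr_natl mulr2n.
have one z t : idx z != idx t -> `|potential z| <= K * `|z - t|.
  move=> ne; have -> : potential z = Uk (idx z) z - Uk (idx z) t.
    rewrite [Uk _ t]Uk_off ?subr0// => /(idxE disjoint_cubes) e.
    by move: ne; rewrite e eqxx.
  exact: Uk_lipschitz.
have [e|ne] := eqVneq (idx x) (idx y).
  apply: (@le_trans _ _ (K * `|x - y|)); last by rewrite lerDl.
  rewrite /potential /glue e; exact: Uk_lipschitz.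
apply: le_trans (ler_normB _ _) _; apply: lerD; first exact: one.
by rewrite distrC; apply: one; rewrite eq_sym.
Qed.

Lemma potential_le1 x : `|potential x| <= 1.
Proof.
rewrite /potential /glue /Uk; have := scale_gt0 (idx x); have := scale_le1 (idx x).
have := pot_le1 l (chart (idx x) x) (lexx 0).
move: (pot _ _ _) (scale _) => p a p1 a1 a0.
rewrite normrM (gtr0_norm a0) -[leRHS]mul1r ler_pM ?(ltW a0)//.
by apply: le_trans a1 _; lra.
Qed.

Lemma potential_off x : ~ cube 0 2 x -> potential x = 0.
Proof. by move=> h; apply: Uk_off => Qx; apply: h; exact: Q_sub Qx. Qed.

Lemma charge_off x : ~ cube 0 2 x -> charge x = 0.
Proof. by move=> h; apply: Mk_off => Qx; apply: h; exact: Q_sub Qx. Qed.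

Lemma potential_Loo : in_Lp Omega +oo%E potential.
Proof.
apply/in_LooP; split; first exact: measurable_funS measurable_potential.
by exists 1 => //; apply: nearW => x _; exact: potential_le1.
Qed.

Lemma potential_weak_gradient : Linfty_weak_gradient Omega potential gradient.
Proof.
split=> [i|i phi tphi].
  apply/in_LooP; split; first exact: measurable_funS (measurable_gradient i).
  by exists 1 => //; apply: nearW => x _; exact: mG_norm_le1.
have [M M0 hM] := test_bounded tphi; have [N N0 hN] := test_partial_bounded i tphi.
have mp : measurable_fun Omega phi by exact: test_measurable tphi.
have mdp : measurable_fun Omega (partial i phi) by exact: test_partial_measurable tphi.
have fin : (leb Omega < +oo)%E by exact: lebesgue_obox_fin.
have icst (C : R) : leb.-integrable Omega (EFin \o cst C).
  apply: (@ae_bounded_integrable _ _ _ leb Omega mO _ `|C|) => //.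
  by apply: nearW => x _.
have mU k : measurable_fun Omega (Uk k) by exact: measurable_funS (measurable_Uk k).
have mG' k : measurable_fun Omega (Gk i k).
  apply: (@measurable_funS _ _ _ _ setT) => //.
  by apply: (mchart (f := fun x => mG l x ord0 i)); exact: measurable_mG.
have Uk1 k x : `|Uk k x| <= 1.
  have [Qx|/Uk_off->] := pselect (Q k x); last by rewrite normr0.
  by have := potential_le1 x; rewrite /potential /glue (idxE disjoint_cubes Qx).
have iU k : leb.-integrable Omega (EFin \o (fun x => Uk k x * partial i phi x)).
  apply: (@ae_bounded_integrable _ _ _ leb Omega mO _ N) => //; first exact: measurable_funM.
  by apply: nearW => x _; rewrite normrM -[leRHS]mul1r ler_pM.
have iG k : leb.-integrable Omega (EFin \o (fun x => Gk i k x * phi x)).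
  apply: (@ae_bounded_integrable _ _ _ leb Omega mO _ M) => //; first exact: measurable_funM.
  apply: nearW => x _; rewrite normrM -[leRHS]mul1r ler_pM//; exact: mG_norm_le1.
have eqm m : \int[leb]_(x in Omega) ((\sum_(k < m) Uk k x) * partial i phi x) =
    - \int[leb]_(x in Omega) ((\sum_(k < m) Gk i k x) * phi x).
  transitivity (\sum_(k < m) \int[leb]_(x in Omega) (Uk k x * partial i phi x)).
    have [_ <-] := Rintegral_bigsum (index_enum 'I_m) mO (fun k => iU (val k)).
    by apply: eq_Rintegral => x _; rewrite mulr_suml.
  transitivity (- \sum_(k < m) \int[leb]_(x in Omega) (Gk i k x * phi x)).
    rewrite -sumrN; apply: eq_bigr => k _.
    exact: (weak_gradient_pot l0 dl (c k) j0 i (scale_gt0 k) tphi).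
  congr (- _); have [_ <-] := Rintegral_bigsum (index_enum 'I_m) mO (fun k => iG (val k)).
  by apply: eq_Rintegral => x _; rewrite mulr_suml.
have c1 : (fun m => \int[leb]_(x in Omega) ((\sum_(k < m) Uk k x) * partial i phi x)) @ \oo -->
    \int[leb]_(x in Omega) (potential x * partial i phi x).
  apply: (Rdominated mO _ _ (icst N) _).2.
  - by move=> m; apply: measurable_funM => //; exact: measurable_sum.
  - move=> x _; apply: cvgMl.
    by apply: (@glue_cvg _ _ c s disjoint_cubes (fun=> Uk)); [move=> _; exact: Uk_off|exact: cvg_cst].
  - move=> m x _; rewrite normrM -[leRHS]mul1r ler_pM//=.
    rewrite (glue_sum disjoint_cubes m x Uk_off); case: ifP => _; last by rewrite normr0.
    exact: potential_le1.
have c2 : (fun m => \int[leb]_(x in Omega) ((\sum_(k < m) Gk i k x) * phi x)) @ \oo -->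
    \int[leb]_(x in Omega) (gradient x ord0 i * phi x).
  apply: (Rdominated mO _ _ (icst M) _).2.
  - by move=> m; apply: measurable_funM => //; exact: measurable_sum.
  - move=> x _; apply: cvgMl.
    by apply: (@glue_cvg _ _ c s disjoint_cubes (fun=> Gk i) (Gk i)); [move=> _; exact: Gk_off|exact: cvg_cst].
  - move=> m x _; rewrite normrM -[leRHS]mul1r ler_pM//=.
    rewrite (glue_sum disjoint_cubes m x (@Gk_off i)); case: ifP => _; last by rewrite normr0.
    exact: mG_norm_le1.
apply: (cvg_unique _ c1); first exact: Rhausdorff.
by rewrite (funext eqm); apply: cvgN.
Qed.

Lemma gradient_dual x : enorm (gradient x) < 1 /\
  forall i, dual_field x ord0 i * Num.sqrt (1 - enorm (gradient x) ^+ 2) = gradient x ord0 i.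
Proof.
rewrite /gradient /dual_field; set y := chart _ _.
have [Cy|Cy] := boolP (1 < sig 0 y).
  by split=> [|i]; [exact: mG_lt1|exact: mG_dual].
split=> [|i]; last by rewrite !mxE (negbTE Cy) mul0r.
rewrite /enorm big1 ?sqrtr0// => i _.
by rewrite mxE (negbTE Cy) expr0n.
Qed.

Lemma potential_competitor : competitor Omega (fun=> 0) potential.
Proof.
have W : W1infty Omega potential by split; [exact: potential_Loo|exists gradient; exact: potential_weak_gradient].
split=> //.
- move=> x _; exists setT; first exact: filterT.
  exists (2 * (2 * n.+1%:R)); split; first exact: num_real.
  move=> K hK [y z] _ /=; apply: le_trans (potential_lipschitz y z) _.
  by rewrite ler_wpM2r// ltW.
- apply/(@Lnorm_oo R n.+1 (fun x => ((enorm \o weak_gradient Omega potential) \_ Omega) x) 1).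
  have := weak_gradient_ae_unique (weak_gradientP W) potential_weak_gradient.
  apply: filterS => x h; rewrite patchE; case: ifPn => [/set_mem Ox|_]; last by rewrite normr0.
  by rewrite /= (h Ox) ger0_norm ?enorm_ge0//; have [/ltW] := gradient_dual x.
- move=> x0 y [_]; rewrite (iffLR (@interior_id _ Omega) oO) => nOx _.
  have h : \forall z \near within (open_segment x0 y) (nbhs x0), (0 : R) = potential z.
    apply: cvg_within.
    have oC : open (~` cube (0 : rV) 2) by apply: closed_openC; exact: closed_cube.
    have : nbhs x0 (~` cube (0 : rV) 2).
      by apply: open_nbhs_nbhs; split => // /cube2_sub.
    by apply: filterS => z /potential_off ->.
  by apply: cvg_trans (near_eq_cvg h) _; exact: cvg_cst.
Qed.

Lemma bounded_domain_box : bounded_domain Omega.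
Proof.
have O0 : Omega 0 by apply: cube2_sub => i; rewrite subrr normr0.
split.
- by exists 0.
- exact: oO.
- have -> : Omega = \bigcup_(y in Omega) closed_segment (0 : rV) y.
    apply/seteqP; split=> [y Oy|x [y Oy [t /= /[!in_itv]/= /andP[t0 t1] <-]]].
      exists y => //; exists 1; first by rewrite /= in_itv/= ler01 lexx.
      by rewrite subr0 add0r scale1r.
    move=> i; have := Oy i; rewrite /lower /upper ![const_mx _ _ _]mxE => /andP[h1 h2].
    have -> : (0 + t *: (y - 0)) ord0 i = t * y ord0 i by rewrite add0r subr0 mxE.
    move: t0; rewrite le_eqVlt => /predU1P[<-|t0].
      by rewrite mul0r oppr_lt0 ltr0n.
    have := mulr_gt0 t0 (_ : 0 < y ord0 i + 3); have := mulr_gt0 t0 (_ : 0 < 3 - y ord0 i).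
    move=> /(_ ltac:(lra)) k1 /(_ ltac:(lra)) k2; apply/andP; split; nra.
  apply: bigcup_connected.
    exists 0 => y Oy; exists 0; first by rewrite /= in_itv/= ler01 lexx.
    by rewrite scale0r addr0.
  move=> y _; have -> : closed_segment (0 : rV) y = (fun t : R => t *: y) @` `[0, 1].
    rewrite /closed_segment; congr image; apply/funext => t.
    by rewrite add0r subr0.
  apply: connected_continuous_connected; first exact: segment_connected.
  apply: continuous_subspaceT; exact: scalel_continuous.
- exists 3; split; first exact: num_real.
  move=> M M3 x Ox; apply/rV_norm_le; first by apply: le_trans (ltW M3).
  move=> i; have := Ox i; rewrite ![const_mx _ _ _]mxE => /andP[h1 h2].
  by rewrite ler_norml; apply/andP; split; lra.
Qed.

Lemma admissible_zero : admissible Omega (fun=> 0).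
Proof.
split=> [|x y _ _ xy _|]; last by exists potential; exact: potential_competitor.
  by apply: continuous_subspaceT => x; exact: cst_continuous.
rewrite subrr normr0 lt0r enorm_ge0 andbT; apply: contra_neq xy => e.
apply/eqP; rewrite -subr_eq0; apply/eqP/rowP => i; rewrite [RHS]mxE.
by apply/eqP; rewrite -normr_le0 -e; exact: rV_coord_enorm.
Qed.

Lemma box_data : dirichlet_data Omega (fun=> 0) charge.
Proof.
split; [exact: bounded_domain_box|exact: admissible_zero|].
by apply/in_L1P => //; exact: charge_integrable.
Qed.

Lemma charge_Lq q : 0 < q -> q < n%:R -> in_Lp Omega q%:E charge.
Proof.
move=> q0 qn; have wM := charge_weak_Lp mO; have [mM' _] := wM; split => //.
have := weak_Lp_Lq mO (lebesgue_obox_fin _ _) wM q0 qn.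
rewrite /finite_norm unlock /= => h.
apply: poweR_lty; apply: le_lt_trans h.
rewrite [leRHS]integral_mkcond le_eqVlt; apply/orP; left; apply/eqP.
apply: eq_integral => x _; rewrite /= !patchE; case: ifPn => //= _.
by rewrite normr0 powR0// gt_eqF.
Qed.

Lemma charge_compact : compactly_supported_in Omega charge.
Proof.
exists (cube 0 2); split; [exact: compact_cube|exact: cube2_sub|].
by apply: nearW => x _ /charge_off.
Qed.

Lemma potential_minimizer : dirichlet_minimizer Omega (fun=> 0) charge potential.
Proof.
have [_ _ LM] := box_data.
have ce w : competitor Omega (fun=> 0) w -> energy Omega charge potential <= energy Omega charge w /\
    (energy Omega charge w <= energy Omega charge potential ->
     {ae leb, forall x, Omega x -> weak_gradient Omega w x = weak_gradient Omega potential x}).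
  move=> cw; apply: (calibrated_energy potential_competitor cw LM potential_weak_gradient).
  - by apply: nearW => x _; exact: gradient_dual.
  - exact: dual_field_integrable.
  - exact: calibrated.
split; first by split; [exact: potential_competitor|move=> w /ce[]].
move=> v [cv mv] x /set_mem Ox.
apply: (equal_weak_gradients_eq ord0 potential_competitor cv) => //.
by apply: (ce v cv).2; exact: mv potential_competitor.
Qed.

Lemma potential_pole k (e : R) : e = 1 \/ e = -1 ->
  potential (c k + (e * scale k) *: basis_vec ord0) = e * scale k.
Proof.
move=> he; have r0 := scale_gt0 k.
have T : chart k (c k + (e * scale k) *: basis_vec ord0) = e *: basis_vec ord0.
  rewrite /chart /rescale addrAC subrr add0r scalerA mulrCA mulVf ?mulr1//.
  exact: lt0r_neq0.
have Qx : Q k (c k + (e * scale k) *: basis_vec ord0).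
  apply/cube_chart; rewrite T => i; rewrite [X in _ - X]mxE subr0 !mxE.
  have : `|e| = 1 by case: he => ->; rewrite ?normrN normr1.
  rewrite normrM => ->; rewrite mul1r.
  by case: (i == ord0); rewrite ?normr1 ?normr0 //=; move: l0; lra.
rewrite /potential /glue (idxE disjoint_cubes Qx) /Uk T pot_focus//.
by rewrite mulrC.
Qed.

(** The centre of a cube is the midpoint of the segment between the rescaled poles,
    along which the potential has slope one. *)
Lemma centers_light k : light_segments Omega potential (c k).
Proof.
have r0 := scale_gt0 k.
pose A e := c k + (e * scale k) *: basis_vec ord0 : rV.
have AB : A 1 - A (-1) = (2 * scale k) *: basis_vec ord0.
  rewrite /A opprD addrACA subrr add0r -scalerBl; congr (_ *: _); ring.
have BA : A (-1) - A 1 = - ((2 * scale k) *: basis_vec ord0) by rewrite -AB opprB.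
have N : enorm (A 1 - A (-1)) = 2 * scale k.
  rewrite AB /enorm big_ord_recl big1 ?addr0 => [|i _].
    by rewrite !mxE eqxx mulr1 sqrtr_sqr gtr0_norm// mulr_gt0.
  by rewrite !mxE mulr0 expr0n.
exists (A 1, A (-1)); last first.
  exists 2^-1; first by rewrite /= in_itv/=; apply/andP; split; lra.
  rewrite [X in 2^-1 *: X]BA scalerN scalerA mulrA mulVf ?mul1r ?pnatr_eq0//.
  by rewrite /A mul1r addrK.
split => /=.
- apply: contra_neq (lt0r_neq0 (mulr_gt0 (ltr0n R 2) r0)) => e.
  by rewrite -N e subrr /enorm big1 ?sqrtr0// => i _; rewrite mxE expr0n.
- move=> x [t /= /[!in_itv]/= /andP[t0 t1] <-]; apply: cube2_sub; apply: (@Q_sub k).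
  apply/cube_chart => i; rewrite [X in _ - X]mxE subr0.
  rewrite rescaleE BA scalerN scalerA /A mul1r !mxE.
  set d := (_ == _)%:R : R; have d01 : 0 <= d <= 1 by rewrite /d; case: (_ == _); rewrite /= ?ler01 ?lexx.
  have -> : (c k ord0 i + scale k * d - t * (2 * scale k) * d - c k ord0 i) / scale k =
      (1 - 2 * t) * d by field; exact: lt0r_neq0.
  have /andP[d0 d1] := d01; rewrite ler_norml; apply/andP; split; move: l0; nra.
- rewrite N (potential_pole k (or_introl erefl)) (potential_pole k (or_intror erefl)).
  by rewrite mul1r mulN1r opprK -mulr2n mulr_natl ger0_norm// mulrn_wge0// ltW.
Qed.

Lemma measurable_light : measurable (light_set Omega potential).
Proof.
by apply: measurableI => //; apply: closed_measurable_rV; exact: closed_closure.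
Qed.

Lemma light_positive : (0 < leb (closure (range c)))%E ->
  (0 < leb (light_set Omega potential))%E.
Proof.
move=> h; apply: (lt_le_trans h); apply: le_measure; rewrite ?inE.
- by apply: closed_measurable_rV; exact: closed_closure.
- exact: measurable_light.
- move=> x cx; split.
    by apply: closure_subset cx => _ [k _ <-]; exact: centers_light.
  apply: cube2_sub => i; have C1 : cube 0 1 x.
    apply: (@closed_cube _ n.+1 (0 : rV) 1); move: x cx; apply: closure_subset.
    by move=> _ [k _ <-]; exact: c_in.
  by apply: le_trans (C1 i) _; lra.
Qed.

End example.

(** * Conclusion *)

Section conclusion.
Context {R : realType}.

Lemma light_fat_minimizer n : (1 < n)%N ->
  exists (Omega : set 'rV[R]_n.+1) (u0 mu u : 'rV[R]_n.+1 -> R),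
    [/\ dirichlet_data Omega u0 mu /\ dirichlet_minimizer Omega u0 mu u,
        in_weak_Lp Omega n%:R mu, compactly_supported_in Omega mu,
        forall q, 0 < q -> q < n%:R -> in_Lp Omega q%:E mu &
        measurable (light_set Omega u) /\
        (0 < lebesgue_rV n.+1 (light_set Omega u))%E].
Proof.
move=> n1; have [L L0 hL] := @dstep_bounded R.
(* a cutoff of width 2 * L has slope at most 1/2 *)
have l0 : 0 < 2 * L by rewrite mulr_gt0.
have dl t : dstep t <= 2 * L / 2 by rewrite mulrC mulKf.
have [c [s [small cin dis pos]]] := @cube_packing R n.
exists (obox (lower (n := n)) (upper (n := n))), (fun=> 0), (charge (2 * L) c s), (potential (2 * L) c s).
split.
- split; first exact: box_data.
  exact: potential_minimizer.
- apply: charge_weak_Lp => //; exact: measurable_obox.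
- exact: charge_compact.
- move=> q; exact: charge_Lq.
- split; first exact: measurable_light.
  exact: light_positive.
Qed.

Lemma hausdorff_measure_ge0 n s (A : set 'rV[R]_n.+1) : (0 <= hausdorff_measure s A)%E.
Proof.
apply: (@le_trans _ _ (hausdorff_premeasure 1 s A)); last first.
  by apply: ereal_sup_ubound; exists 1 => /=.
apply: le_ereal_inf_tmp => _ [U _ <-]; apply: nneseries_ge0 => k _ _.
exact: diam_pow_ge0.
Qed.

End conclusion.

Theorem corollary1p9 (R : realType) :
  (forall (n : nat) (q : R), (4 <= n)%N -> 2 <= q -> q < n%:R - 1 ->
     ~ (forall (Omega : set 'rV[R]_n) (u0 mu u : 'rV[R]_n -> R),
          dirichlet_data Omega u0 mu -> in_Lp Omega q%:E mu ->
          dirichlet_minimizer Omega u0 mu u ->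
          (hausdorff_dim (light_set Omega u) <= (n%:R - q)%:E)%E)
     /\ exists (Omega : set 'rV[R]_n) (u0 mu u : 'rV[R]_n -> R),
          [/\ dirichlet_data Omega u0 mu,
              in_weak_Lp Omega (n%:R - 1) mu,
              compactly_supported_in Omega mu,
              in_Lp Omega q%:E mu &
              dirichlet_minimizer Omega u0 mu u
              /\ (0 < lebesgue_rV n (light_set Omega u))%E])
  /\
  (forall n : nat, (3 <= n)%N ->
     ~ (forall (Omega : set 'rV[R]_n) (u0 mu u : 'rV[R]_n -> R),
          dirichlet_data Omega u0 mu -> dirichlet_minimizer Omega u0 mu u ->
          hausdorff_measure (n%:R - 1) (light_set Omega u) = 0%E)
     /\ exists (Omega : set 'rV[R]_n) (u0 mu u : 'rV[R]_n -> R),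
          [/\ dirichlet_data Omega u0 mu,
              dirichlet_minimizer Omega u0 mu u &
              (0 < hausdorff_measure (n%:R - 1) (light_set Omega u))%E]).
Proof.
split=> [[//|n] q n4 q2|[//|n] n3]; rewrite -natr1 addrK.
- move=> qn; have n1 : (1 < n)%N by rewrite -ltnS; apply: leq_trans n4.
  have [A [u0 [mu [u [[D M] W C Lq [mL pL]]]]]] := @light_fat_minimizer R _ n1.
  have q0 : 0 < q by apply: lt_le_trans q2.
  split; last first.
    by exists A, u0, mu, u; split => //; exact: Lq.
  move=> /(_ A u0 mu u D (Lq q q0 qn) M) dim.
  have : (hausdorff_dim (light_set A u) < n.+1%:R%:E)%E.
    by apply: le_lt_trans dim _; rewrite lte_fin -natr1; move: q0; lra.
  move=> /ereal_inf_lt[_ [s [s0 Hs] <-]]; rewrite lte_fin => /ltW sn.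
  by move: pL; rewrite (hausdorff_null s0 sn mL Hs) ltxx.
- have [A [u0 [mu [u [[D M] W C Lq [mL pL]]]]]] := @light_fat_minimizer R _ n3.
  (* otherwise the light set would have volume 0 *)
  have H : hausdorff_measure n%:R (light_set A u) != 0%E.
    apply/eqP => H0; move: pL; rewrite (hausdorff_null _ _ mL H0) ?ltxx//.
    by rewrite ler_nat.
  split; first by move=> /(_ A u0 mu u D M) /eqP; exact/negP.
  exists A, u0, mu, u; split => //.
  by rewrite lt0e H hausdorff_measure_ge0.
Qed.
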